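(* The operator $L_{dir}$ is a spectral operator in the sense of Dunford.
   Context: Let $k>1$ be an integer, $\omega>0$, and let $q\in L_2[0,\omega]$ be complex-valued. $H^{2k}[0,\omega]$ is the Sobolev space of $y$ with $y^{(2k-1)}$ absolutely continuous and $y^{(2k)}\in L_2[0,\omega]$. The operator $L_{dir}:D(L_{dir})\subset L_2[0,\omega]\to L_2[0,\omega]$ is $L_{dir}y=(-1)^k y^{(2k)}-qy$, with domain consisting of the $y\in H^{2k}[0,\omega]$ satisfying $y(0)=y''(0)=\dots=y^{(2k-2)}(0)=0$ and $y(\omega)=y''(\omega)=\dots=y^{(2k-2)}(\omega)=0$. ''Spectral operator'' is meant in the standard sense of Dunford and Schwartz for (possibly unbounded) closed operators. *)

(* Defs.v *)
From HB Require Import structures.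
From mathcomp Require Import all_boot all_order all_algebra.
From mathcomp Require Import generic_quotient ring_quotient.
From mathcomp Require Import complex.
From mathcomp Require Import all_classical all_reals all_analysis.
From mathcomp Require Import measurable_realfun.

Set Implicit Arguments.
Unset Strict Implicit.
Unset Printing Implicit Defensive.

Import Order.TTheory GRing.Theory Num.Theory ComplexField.
Import numFieldNormedType.Exports.

Local Open Scope classical_set_scope.
Local Open Scope ring_scope.
Local Open Scope complex_scope.

Section complex_L2.
Context d (T : measurableType d) (R : realType).
Variable mu : {measure set T -> \bar R}.
Implicit Types f g : T -> R[i].

Let normcE (z : R[i]) : (Normc.normc z)%:C = `|z|.
Proof. by []. Qed.

Let normc_ge0 (z : R[i]) : 0 <= Normc.normc z.
Proof. by case: z => a b; rewrite sqrtr_ge0. Qed.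

Let normcD (x y : R[i]) : Normc.normc (x + y) <= Normc.normc x + Normc.normc y.
Proof. by have := ler_normD x y; rewrite -!normcE -rmorphD lecR. Qed.

Definition complex_measurable f :=
  measurable_fun setT (fun x => complex.Re (f x)) /\
  measurable_fun setT (fun x => complex.Im (f x)).

(* [Normc.normc] is the [R]-valued modulus; [`|z|] is [R[i]]-valued. *)
Definition L2norm f : R := fine ('N[mu]_2%:E [EFin \o (@Normc.normc R \o f)])%E.

Definition square_integrable f :=
  complex_measurable f /\ finite_norm mu 2%:E (@Normc.normc R \o f).

Lemma measurable_normc f :
  complex_measurable f -> measurable_fun setT (@Normc.normc R \o f).
Proof.
move=> [mr mi].
rewrite (_ : _ \o f = fun x =>
  (complex.Re (f x) ^+ 2 + complex.Im (f x) ^+ 2) `^ 2^-1); last first.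
  by apply/funext => x /=; case: (f x) => a b /=; rewrite powR12_sqrt// addr_ge0 ?sqr_ge0.
apply: (measurableT_comp (measurable_powR _)) => //.
by apply: measurable_funD; apply: measurable_funX.
Qed.

Lemma complex_measurableD f g : complex_measurable f -> complex_measurable g ->
  complex_measurable (f + g).
Proof.
move=> [fr fi] [gr gi]; split.
- rewrite (_ : (fun _ => _) = (fun x => complex.Re (f x)) \+ (fun x => complex.Re (g x))).
    exact: measurable_funD.
  by apply/funext => x /=; rewrite fctE; case: (f x) (g x) => [a b] [a' b'].
- rewrite (_ : (fun _ => _) = (fun x => complex.Im (f x)) \+ (fun x => complex.Im (g x))).
    exact: measurable_funD.
  by apply/funext => x /=; rewrite fctE; case: (f x) (g x) => [a b] [a' b'].
Qed.

Lemma complex_measurableZ (c : R[i]) f : complex_measurable f ->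
  complex_measurable (c *: f).
Proof.
case: c => u v [fr fi]; split.
- rewrite (_ : (fun _ => _) =
    (fun x => u * complex.Re (f x)) \- (fun x => v * complex.Im (f x))).
    by apply: measurable_funB; apply: measurable_funM.
  by apply/funext => x /=; rewrite fctE; case: (f x).
- rewrite (_ : (fun _ => _) =
    (fun x => u * complex.Im (f x)) \+ (fun x => v * complex.Re (f x))).
    by apply: measurable_funD; apply: measurable_funM.
  by apply/funext => x /=; rewrite fctE; case: (f x).
Qed.

Let le12 : (1 <= 2%:E :> \bar R)%E.
Proof. by rewrite lee_fin ler1n. Qed.

Let ge0_le_Lnorm2 (f g : T -> R) :
  measurable_fun setT f -> measurable_fun setT g ->
  (forall x, 0 <= f x <= g x) ->
  ('N[mu]_2%:E [EFin \o f] <= 'N[mu]_2%:E [EFin \o g])%E.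
Proof.
move=> mf mg fg; rewrite unlock /Lnorm.
have h (x : T) : `|f x| `^ 2 <= `|g x| `^ 2.
  have /andP[f0 fgx] := fg x.
  by rewrite ge0_ler_powR ?nnegrE ?normr_ge0// !ger0_norm// (le_trans f0).
have m (u : T -> R) : measurable_fun setT u ->
    measurable_fun setT (fun x => ((`|u x| `^ 2)%:E))%E.
  move=> mu'; apply/measurable_EFinP.
  by apply: (measurableT_comp (measurable_powR _)) => //; exact: measurableT_comp.
apply: gt0_ler_poweR => //.
- by rewrite in_itv/= leey andbT; apply: integral_ge0 => x _; rewrite lee_fin powR_ge0.
- by rewrite in_itv/= leey andbT; apply: integral_ge0 => x _; rewrite lee_fin powR_ge0.
- rewrite ge0_le_integral//.
  + by move=> x _; rewrite lee_fin powR_ge0.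
  + exact: m.
  + exact: m.
  + by move=> x _; rewrite lee_fin.
Qed.

Let LnormcD f g : complex_measurable f -> complex_measurable g ->
  ('N[mu]_2%:E [EFin \o (@Normc.normc R \o (f + g)%R)] <=
   'N[mu]_2%:E [EFin \o (@Normc.normc R \o f)] +
   'N[mu]_2%:E [EFin \o (@Normc.normc R \o g)])%E.
Proof.
move=> mf mg.
have nf := measurable_normc mf; have ng := measurable_normc mg.
apply: le_trans (eminkowski _ nf ng le12).
apply: ge0_le_Lnorm2.
- exact/measurable_normc/complex_measurableD.
- exact: measurable_funD.
- by move=> x /=; rewrite normc_ge0 normcD.
Qed.

Let LnormcZ (c : R[i]) f : square_integrable f ->
  ('N[mu]_2%:E [EFin \o (@Normc.normc R \o (c *: f)%R)] =
   (Normc.normc c)%:E * 'N[mu]_2%:E [EFin \o (@Normc.normc R \o f)])%E.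
Proof.
move=> [mf ff].
have Lf : @Normc.normc R \o f \in Lfun mu 2%:E.
  by apply/andP; split; rewrite inE//=; exact: measurable_normc.
have := @LnormZ _ _ _ mu _ le12 (Lfun_Sub le12 Lf) (Normc.normc c).
rewrite ger0_norm ?normc_ge0// => <-.
by apply: eq_Lnorm => x /=; rewrite fctE /= Normc.normcM.
Qed.

Definition L2pred : {pred T -> R[i]} := fun f => `[< square_integrable f >].

Lemma L2predP f : reflect (square_integrable f) (f \in L2pred).
Proof. exact: asboolP. Qed.

Fact L2pred_submod : submod_closed L2pred.
Proof.
split.
- apply/L2predP; split.
    by split; rewrite (_ : (fun _ => _) = cst 0)//.
  rewrite /finite_norm (_ : _ \o _ = cst 0%E) ?Lnorm0//.
  by apply/funext => x; congr EFin; exact: Normc.normc0.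
- move=> c f g /L2predP[mf ff] /L2predP[mg fg]; apply/L2predP; split.
    by apply: complex_measurableD => //; exact: complex_measurableZ.
  apply: le_lt_trans (LnormcD _ mg) _; first exact: complex_measurableZ.
  rewrite lte_add_pinfty// LnormcZ//.
  by rewrite lte_mul_pinfty// ?lee_fin ?normc_ge0.
Qed.

HB.instance Definition _ := GRing.isSubmodClosed.Build _ _ L2pred L2pred_submod.

Record L2fun := MkL2fun { L2fun_val :> T -> R[i]; _ : L2fun_val \in L2pred }.

HB.instance Definition _ := [isSub for L2fun_val].
HB.instance Definition _ := [Choice of L2fun by <:].
HB.instance Definition _ := [SubChoice_isSubLmodule of L2fun by <:].

Lemma L2fun_valB (f g : L2fun) x : L2fun_val (f - g) x = f x - g x.
Proof. by []. Qed.

Lemma L2fun_valD (f g : L2fun) x : L2fun_val (f + g) x = f x + g x.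
Proof. by []. Qed.

Lemma L2fun_valZ (c : R[i]) (f : L2fun) x : L2fun_val (c *: f) x = c * f x.
Proof. by []. Qed.

(* [L2 mu] is the quotient by almost everywhere equality; applying a class to a
   point uses the canonical representative of the class, so such values are
   meaningful only almost everywhere. *)
Definition ae_null : {pred L2fun} := fun f : L2fun => `[< {ae mu, forall x, L2fun_val f x = 0} >].

Lemma ae_nullP (f : L2fun) : reflect {ae mu, forall x, L2fun_val f x = 0} (f \in ae_null).
Proof. exact: asboolP. Qed.

Fact ae_null_zmod : zmod_closed ae_null.
Proof.
split; first by apply/ae_nullP; exact: aeW.
move=> f g /ae_nullP f0 /ae_nullP g0; apply/ae_nullP.
by apply: filterS2 f0 g0 => x fx gx; rewrite L2fun_valB fx gx subrr.
Qed.

HB.instance Definition _ := GRing.isZmodClosed.Build _ ae_null ae_null_zmod.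

Local Open Scope quotient_scope.

Definition L2 : Type := Quotient.quot ae_null.
HB.instance Definition _ := EqQuotient.on L2.
HB.instance Definition _ := GRing.Zmodule.on L2.

Definition L2_fun (u : L2) : T -> R[i] := repr u : L2fun.
Coercion L2_fun : L2 >-> Funclass.

Lemma L2_eqP (f g : L2fun) :
  reflect {ae mu, forall x, f x = g x} (\pi_L2 f == \pi_L2 g).
Proof.
rewrite -[_ == _]Quotient.idealrBE; apply: (iffP (ae_nullP _)).
  by apply: filterS => x; rewrite L2fun_valB => /eqP; rewrite subr_eq0 => /eqP.
by apply: filterS => x fg; rewrite L2fun_valB fg subrr.
Qed.

Lemma L2_funK (f : L2fun) : {ae mu, forall x, (\pi_L2 f : L2) x = f x}.
Proof. by apply/L2_eqP; rewrite reprK. Qed.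

Definition L2_scale (c : R[i]) (u : L2) : L2 := \pi_L2 (c *: (repr u : L2fun)).

Lemma L2_scale_pi (c : R[i]) (f : L2fun) :
  L2_scale c (\pi_L2 f) = \pi_L2 (c *: f).
Proof.
apply/eqP; rewrite /L2_scale; apply/L2_eqP.
by apply: filterS (L2_funK f) => x fx; rewrite !L2fun_valZ -fx.
Qed.

Fact L2_scaleA (a b : R[i]) (u : L2) :
  L2_scale a (L2_scale b u) = L2_scale (a * b) u.
Proof.
by rewrite -(reprK u) [L2_scale b _]L2_scale_pi !L2_scale_pi scalerA.
Qed.

Fact L2_scale1 : left_id 1 L2_scale.
Proof. by move=> u; rewrite -[u]reprK L2_scale_pi scale1r. Qed.

Lemma L2_piD (f g : L2fun) : (\pi_L2 (f + g) : L2) = \pi_L2 f + \pi_L2 g.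
Proof. exact: Quotient.pi_add. Qed.

Fact L2_scaleDr : right_distributive L2_scale +%R.
Proof.
move=> c u v; rewrite -(reprK u) -(reprK v) -L2_piD.
by rewrite 3!L2_scale_pi scalerDr L2_piD.
Qed.

Fact L2_scaleDl (u : L2) : {morph L2_scale^~ u : a b / a + b}.
Proof.
by move=> a b; rewrite -(reprK u) /= 3!L2_scale_pi scalerDl L2_piD.
Qed.

HB.instance Definition _ := GRing.Zmodule_isLmodule.Build R[i] L2
  L2_scaleA L2_scale1 L2_scaleDr L2_scaleDl.

Lemma L2_sq (f : L2fun) : square_integrable f.
Proof. by apply/L2predP; case: f. Qed.

Let ae_Lnorm2 (f g : L2fun) : {ae mu, forall x, f x = g x} ->
  ('N[mu]_2%:E [EFin \o (@Normc.normc R \o f)] =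
   'N[mu]_2%:E [EFin \o (@Normc.normc R \o g)])%E.
Proof.
move=> fg; rewrite unlock /Lnorm; congr (_ `^ _)%E.
have m (u : L2fun) : measurable_fun setT
    (fun x => (`|(EFin \o (@Normc.normc R \o u)) x| `^ 2))%E.
  apply/measurable_EFinP; apply: (measurableT_comp (measurable_powR _)) => //.
  by apply: measurableT_comp => //; apply: measurable_normc; case: (L2_sq u).
apply: ae_eq_integral => //.
by apply: filterS fg => x fgx _ /=; rewrite fgx.
Qed.

Definition L2_norm (u : L2) : R[i] := (L2norm u)%:C.

Let L2_norm_pi (f : L2fun) : L2_norm (\pi_L2 f) = (L2norm f)%:C.
Proof.
congr (fine _)%:C; apply: ae_Lnorm2; exact: L2_funK.
Qed.

Let L2normK (f : L2fun) :
  (L2norm f)%:E = 'N[mu]_2%:E [EFin \o (@Normc.normc R \o f)]%E.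
Proof.
rewrite /L2norm fineK// ge0_fin_numE ?Lnorm_ge0//.
by case: (L2_sq f).
Qed.

Fact L2_ler_normD (u v : L2) : L2_norm (u + v) <= L2_norm u + L2_norm v.
Proof.
rewrite -(reprK u) -(reprK v) -L2_piD !L2_norm_pi -rmorphD lecR.
rewrite -lee_fin EFinD !L2normK.
by apply: LnormcD; [case: (L2_sq (repr u))|case: (L2_sq (repr v))].
Qed.

Fact L2_normrZ (c : R[i]) (u : L2) : L2_norm (c *: u) = `|c| * L2_norm u.
Proof.
rewrite -(reprK u) [c *: _]L2_scale_pi !L2_norm_pi -normcE -rmorphM.
congr (_%:C); apply: EFin_inj; rewrite EFinM !L2normK.
exact: LnormcZ (L2_sq _).
Qed.

Fact L2_normr0_eq0 (u : L2) : L2_norm u = 0 -> u = 0.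
Proof.
rewrite -(reprK u) L2_norm_pi; set f : L2fun := repr u => n0.
have f0 : ('N[mu]_2%:E [EFin \o (@Normc.normc R \o f)] = 0)%E.
  by rewrite -L2normK (complexI n0).
have [mf _] := L2_sq f.
have mnf : measurable_fun setT (EFin \o (@Normc.normc R \o f)).
  by apply/measurable_EFinP; exact: measurable_normc.
have := Lnorm_eq0_eq0 mnf (lt_le_trans lte01 le12) f0.
move=> ae0; rewrite -[RHS](reprK (0 : L2)); apply/eqP/L2_eqP.
have z0 : {ae mu, forall x, (repr (0 : L2) : L2fun) x = 0}.
  have := L2_funK 0; rewrite (_ : \pi_L2 (0 : L2fun) = 0 :> L2)//.
  by apply: (addrI (\pi_L2 0 : L2)); rewrite -L2_piD !addr0.
apply: filterS2 ae0 z0 => x fx0 zx; have [fx] := fx0 I.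
by rewrite zx; exact: Normc.eq0_normc.
Qed.

HB.instance Definition _ := Lmodule_isNormed.Build R[i] L2
  L2_ler_normD L2_normrZ L2_normr0_eq0.

End complex_L2.

Section spectral_operator.
Context (R : realType) (X : normedModType R[i]).

(* A (possibly unbounded) operator in X is given by its graph. *)
Implicit Types (T : set (X * X)) (E : set R[i]^o -> X -> X).

Definition op_dom T : set X := [set x | exists y, T (x, y)].

Definition closed_operator T :=
  [/\ forall x y z, T (x, y) -> T (x, z) -> y = z,
      T (0, 0),
      forall (a : R[i]) p q, T p -> T q -> T (a *: p + q)
    & closed T].

Definition op_restr T (Y : set X) : set (X * X) := [set p | T p /\ Y p.1].

(* [z] is in the resolvent set of the operator [T] acting in the subspace [Y]:
   [z - T] has an inverse [S] that is bounded and defined on all of [Y]. *)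
Definition resolvent_set T (Y : set X) : set R[i]^o := [set z |
  exists S : X -> X,
    [/\ forall y, Y y -> Y (S y) /\ T (S y, z *: S y - y),
        forall x w, Y x -> T (x, w) -> S (z *: x - w) = x
      & exists M : R, forall y, Y y -> `|S y| <= M%:C * `|y|]].

Definition spectrum T (Y : set X) : set R[i]^o := ~` resolvent_set T Y.

Definition borel_set : set (set R[i]^o) := <<s [set A : set R[i]^o | open A] >>.

Record spectral_measure E : Prop := SpectralMeasure {
  spm_linear : forall e, borel_set e ->
    forall (a : R[i]) x y, E e (a *: x + y) = a *: E e x + E e y;
  spm_bounded : exists M : R, forall e, borel_set e ->
    forall x, `|E e x| <= M%:C * `|x|;
  spm_set0 : forall x, E set0 x = 0;
  spm_setT : forall x, E setT x = x;
  spm_setI : forall e f, borel_set e -> borel_set f ->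
    forall x, E (e `&` f) x = E e (E f x);
  spm_setC : forall e, borel_set e -> forall x, E (~` e) x = x - E e x;
  spm_sigma_additive : forall F : nat -> set R[i]^o,
    (forall n, borel_set (F n)) -> trivIset setT F ->
    forall x, (\sum_(0 <= n < m) E (F n) x) @[m --> \oo] -->
              E (\bigcup_n F n) x
}.

(* Spectra and closures are taken in the finite complex plane. The first
   condition makes the restriction to [range (E e)] bounded when [e] is bounded,
   so nothing is lost at infinity; it also implies that the domain is dense. *)
Definition spectral_operator T := closed_operator T /\
  exists2 E, spectral_measure E &
    [/\ forall e, borel_set e -> bounded_set e -> range (E e) `<=` op_dom T,
        forall e, borel_set e ->
          forall x y, T (x, y) -> T (E e x, E e y)
      & forall e, borel_set e ->
          spectrum (op_restr T (range (E e))) (range (E e)) `<=` closure e].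

End spectral_operator.

Section dirichlet_operator.
Context (R : realType).
Implicit Types (k n : nat) (omega : R) (A : set R) (y : R -> R[i]^o).

Definition diff_quotient y (x t : R) : R[i]^o := (t - x)^-1%:C * (y t - y x).

(* Derivative at [x] relative to [A]: one-sided at the end points of an
   interval. *)
Definition derivable_within A y (x : R) :=
  cvg (diff_quotient y x t @[t --> within A x^']).

Definition derive_within A y (x : R) : R[i]^o :=
  lim (diff_quotient y x t @[t --> within A x^']).

Definition derivn_within A n y : R -> R[i]^o := iter n (derive_within A) y.

Definition absolutely_continuous (a b : R) y :=
  forall eps : R, 0 < eps -> exists2 delta : R, 0 < delta &
    forall (n : nat) (s t : 'I_n -> R),
      (forall i, a <= s i /\ s i <= t i /\ t i <= b) ->
      trivIset setT (fun i => `]s i, t i[%classic) ->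
      \sum_i (t i - s i) < delta ->
      \sum_i `|y (t i) - y (s i)| < eps%:C.

Definition lebesgue_on omega : {measure set (measurableTypeR R) -> \bar R} :=
  mrestr lebesgue_measure (measurable_itv `[0, omega]).

Local Notation L2itv omega := (L2 (lebesgue_on omega)).

(* The values of [y] outside the interval are irrelevant here: the complement of
   the interval is null for [lebesgue_on omega]. *)
Definition represents omega (u : L2itv omega) y :=
  {ae lebesgue_on omega, forall x, u x = y x}.

Definition sobolev omega n y :=
  [/\ forall j, (j < n.-1)%N -> forall x, x \in `[0, omega] ->
        derivable_within `[0, omega] (derivn_within `[0, omega] j y) x,
      absolutely_continuous 0 omega (derivn_within `[0, omega] n.-1 y)
    & exists w : L2itv omega, represents w (derivn_within `[0, omega] n y)].

Definition dirichlet_bc omega k y :=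
  forall j, (j < k)%N ->
    derivn_within `[0, omega] (2 * j) y 0 = 0 /\
    derivn_within `[0, omega] (2 * j) y omega = 0.

(* Graph of [u |-> (-1)^k u^(2k) - q u]; [y] is the unique continuous
   representative of the class [u]. *)
Definition L_dir omega k (q : L2itv omega) : set (L2itv omega * L2itv omega) :=
  [set p | exists y : R -> R[i]^o,
    [/\ sobolev omega (2 * k) y, dirichlet_bc omega k y, represents p.1 y &
        represents p.2 (fun x =>
          (-1) ^+ k * derivn_within `[0, omega] (2 * k) y x - q x * y x)]].

End dirichlet_operator.

Notation L2itv omega := (L2 (lebesgue_on omega)).

(* Main.v *)
(* Expanding in the sine basis [phi n] turns [L_dir] into [A - Q], where [A] is
   diagonal with eigenvalues [(n+1)^(2k) (pi/omega)^(2k)] and [Q] maps [phi n] to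
   [q phi n]. The vectors [q phi n] are bounded in [L2] although [Q] itself need
   not be bounded; the eigenvalue gaps grow at least like [n^3] because [k > 1].
   Let [J X] keep of the matrix of [X] the diagonal and the upper left [N] by [N]
   block. Dividing the other entries by the gaps gives [G X] with
   [A (G X) - (G X) A = X - J X], and [G] is small when [N] is large. So
   [X = Q (1 + G X) - (G X) (J X)] has a solution by contraction, and then
   [(A - Q) (1 + G X) = (1 + G X) (A - J X)]: the operator is similar to the direct
   sum of an [N] by [N] matrix and a diagonal operator. The spectral measure is
   carried over from there: on the matrix block it consists of projections on
   generalized eigenspaces, on the diagonal part of indicator functions. *)
From HB Require Import structures.
Require Import Defs.
From mathcomp Require Import all_boot all_order all_algebra.
From mathcomp Require Import complex.
From mathcomp Require Import all_classical all_reals all_analysis.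
From mathcomp Require Import ring lra zify.
From mathcomp Require Import generic_quotient measurable_realfun.
Set Implicit Arguments.
Unset Strict Implicit.
Unset Printing Implicit Defensive.
Import Order.TTheory GRing.Theory Num.Theory ComplexField.
Import numFieldNormedType.Exports.
Local Open Scope classical_set_scope.
Local Open Scope ring_scope.
Local Open Scope complex_scope.

(** * Complex modulus and norms with values in the reals *)

Section real_norm.
Context (R : realType).
Local Notation C := R[i].

(** Since [Q] has bounded columns but may be unbounded, the unknown [X] is also sought among
    matrices with uniformly bounded columns, and every product has to make sense there. The cubic
    gaps serve this purpose: with indices counted from 1, the larger index of an entry outside the
    block exceeds [N], so the reciprocal gap is at most a constant times [1 / (N m n)]. The factor
    [1 / m] makes the coefficients of each column of [G X] absolutely summable, so that [Q (G X)]
    exists; [1 / n] makes [G X] a bounded operator; [1 / N] makes both small. The block is there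
    because the low gaps need not dominate [q]; it may contain Jordan blocks. The intertwining
    relation is checked on basis vectors only: closedness extends it to one inclusion of graphs, and
    equality follows from a real shift under which the smaller operator is onto and the larger one
    injective. The domain of [L_dir] is recognised in coordinates: integration by parts gives the
    coefficients, and conversely a Dirichlet problem with square integrable right-hand side is
    solved. *)

Definition cn (c : C) : R := Normc.normc c.

Lemma cnE (c : C) : `|c| = (cn c)%:C. Proof. by []. Qed.

Lemma cn_ge0 c : 0 <= cn c.
Proof. by case: c => a b; rewrite /cn /= sqrtr_ge0. Qed.

Lemma cnD x y : cn (x + y) <= cn x + cn y.
Proof. by rewrite -lecR rmorphD -!cnE ler_normD. Qed.

Lemma cnM x y : cn (x * y) = cn x * cn y.
Proof. exact: Normc.normcM. Qed.

Lemma cnN x : cn (- x) = cn x.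
Proof. by apply: complexI; rewrite -!cnE normrN. Qed.

Lemma cn0 : cn 0 = 0. Proof. exact: Normc.normc0. Qed.
Lemma cn1 : cn 1 = 1. Proof. by apply: complexI; rewrite -cnE normr1. Qed.

Lemma cn_eq0 x : cn x = 0 -> x = 0. Proof. exact: Normc.eq0_normc. Qed.

Lemma cn_real (a : R) : cn a%:C = `|a|.
Proof. by rewrite /cn /= expr0n /= addr0 sqrtr_sqr. Qed.

Lemma cnV x : cn x^-1 = (cn x)^-1.
Proof. by apply: complexI; rewrite -cnE normfV fmorphV. Qed.

Lemma cn_nat (n : nat) : cn n%:R = n%:R.
Proof. by rewrite -(rmorph_nat (@real_complex R)) cn_real ger0_norm. Qed.

Lemma cn_sum (I : Type) (r : seq I) (P : pred I) (F : I -> C) :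
  cn (\sum_(i <- r | P i) F i) <= \sum_(i <- r | P i) cn (F i).
Proof.
elim/big_rec2: _ => [|i a b _ ab]; first by rewrite cn0.
by rewrite (le_trans (cnD _ _))// lerD2l.
Qed.

Lemma cnsq (z : C) : cn z ^+ 2 = complex.Re z ^+ 2 + complex.Im z ^+ 2.
Proof. by case: z => a b; rewrite /cn /= sqr_sqrtr// addr_ge0// sqr_ge0. Qed.

Context (H : normedModType C).

(** The norm takes its values in [R[i]], where the order is only partial. By [nrE] its real part
    loses nothing, and estimates and limits can be handled in [R]. *)
Definition nr (x : H) : R := complex.Re `|x|.

Lemma nrE (x : H) : `|x| = (nr x)%:C.
Proof.
have := normr_ge0 x; rewrite /nr; set z := `|x|; move: z => z; case: z => a b.
by rewrite lecE/= => /andP[/eqP-> _].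
Qed.

Lemma nr_ge0 x : 0 <= nr x.
Proof. by rewrite -lecR -nrE; exact: normr_ge0. Qed.

Lemma nrD x y : nr (x + y) <= nr x + nr y.
Proof. by have := ler_normD x y; rewrite !nrE -rmorphD lecR. Qed.

Lemma nrZ a x : nr (a *: x) = cn a * nr x.
Proof. by apply: complexI; rewrite -nrE rmorphM normrZ nrE. Qed.

Lemma nrN x : nr (- x) = nr x.
Proof. by apply: complexI; rewrite -!nrE normrN. Qed.

Lemma nr0 : nr 0 = 0. Proof. by apply: complexI; rewrite -nrE normr0. Qed.

Lemma nrB x y : nr (x - y) = nr (y - x).
Proof. by rewrite -nrN opprB. Qed.

Lemma nr_eq0 x : nr x = 0 -> x = 0.
Proof. by move=> x0; apply/eqP; rewrite -normr_eq0 nrE x0. Qed.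

Lemma nr_sum (I : Type) (r : seq I) (P : pred I) (F : I -> H) :
  nr (\sum_(i <- r | P i) F i) <= \sum_(i <- r | P i) nr (F i).
Proof.
elim/big_rec2: _ => [|i a b _ ab]; first by rewrite nr0.
by rewrite (le_trans (nrD _ _))// lerD2l.
Qed.

Definition hcvg (u : nat -> H) (s : H) := nr (s - u n) @[n --> \oo] --> (0 : R).

Lemma hcvgP u s : hcvg u s <-> u @ \oo --> s.
Proof.
split=> [us|/cvgrPdist_lt us].
- apply/cvgrPdist_lt => e e0.
  have [er e0'] : e = (complex.Re e)%:C /\ 0 < complex.Re e.
    by case: e e0 => a b; rewrite ltcE/= => /andP[/eqP-> ->].
  move/cvgrPdist_lt : us => /(_ _ e0'); apply: filterS => n.
  by rewrite sub0r normrN ger0_norm ?nr_ge0// nrE er ltcR.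
- apply/cvgrPdist_lt => e e0.
  have e0' : 0 < e%:C by rewrite ltcR.
  apply: filterS (us _ e0') => n.
  by rewrite nrE ltcR sub0r normrN ger0_norm ?nr_ge0.
Qed.

Lemma squeeze0 (a b : nat -> R) : (forall n, 0 <= a n) ->
  (\forall n \near \oo, a n <= b n) -> b @ \oo --> 0 -> a @ \oo --> 0.
Proof.
move=> a0 ab b0; apply: (@squeeze_cvgr _ _ _ _ (cst 0) b) => //; last exact: cvg_cst.
by apply: filterS ab => n; rewrite a0.
Qed.

Lemma hcvg_near u s (b : nat -> R) :
  (\forall n \near \oo, nr (s - u n) <= b n) -> b @ \oo --> 0 -> hcvg u s.
Proof. by move=> h; apply: squeeze0 => // n; exact: nr_ge0. Qed.

Lemma hcvg_uniq u s t : hcvg u s -> hcvg u t -> s = t.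
Proof.
move=> /hcvgP us /hcvgP ut.
exact: (@cvg_unique _ (@norm_hausdorff _ H) _ _ _ _ us ut).
Qed.

Lemma hcvg_lin a u s v t : hcvg u s -> hcvg v t ->
  hcvg (fun n => a *: u n + v n) (a *: s + t).
Proof.
move=> us vt; apply: (@hcvg_near _ _ (fun n => cn a * nr (s - u n) + nr (t - v n))).
  near=> n; rewrite opprD addrACA -scalerBr (le_trans (nrD _ _))// lerD2r nrZ//.
rewrite -[X in _ --> X]addr0 -[X in _ --> X + _](mulr0 (cn a)).
by apply: cvgD => //; apply: cvgM => //; exact: cvg_cst.
Unshelve. all: by end_near. Qed.

Lemma hcvg_cst s : hcvg (fun=> s) s.
Proof.
rewrite /hcvg subrr; rewrite (_ : (fun _ => _) = cst 0) ?nr0; first exact: cvg_cst.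
by apply/funext.
Qed.

Lemma hcvgD u s v t : hcvg u s -> hcvg v t ->
  hcvg (fun n => u n + v n) (s + t).
Proof.
move=> us vt; rewrite -[s]scale1r; under eq_fun do rewrite -[u _]scale1r.
exact: hcvg_lin.
Qed.

Lemma hcvgB u s v t : hcvg u s -> hcvg v t ->
  hcvg (fun n => u n - v n) (s - t).
Proof.
move=> us vt; rewrite addrC -scaleN1r.
under eq_fun do rewrite addrC -scaleN1r.
exact: hcvg_lin.
Qed.

Lemma hcvg_le u s M : hcvg u s -> (\forall n \near \oo, nr (u n) <= M) -> nr s <= M.
Proof.
move=> us uM; apply/ler_addgt0Pr => e e0.
move/cvgrPdist_lt : us => /(_ _ e0) us.
near \oo => n.
rewrite -[s](subrK (u n)) addrC addrC (le_trans (nrD _ _))// addrC lerD//.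
  by near: n.
by apply: ltW; near: n; apply: filterS us => n; rewrite sub0r normrN ger0_norm ?nr_ge0.
Unshelve. all: by end_near. Qed.

Lemma le0_cvg0 (a : R) (b : nat -> R) : 0 <= a ->
  (\forall n \near \oo, a <= b n) -> b @ \oo --> 0 -> a = 0.
Proof.
move=> a0 ab b0; apply/eqP; rewrite eq_le a0 andbT.
rewrite -(cvg_lim (@Rhausdorff R) b0); apply: limr_ge => //.
by apply/cvg_ex; exists 0.
Qed.

End real_norm.

(** * Orthonormal bases *)

Section finite_sums.
Context (R : realType).

Lemma sum_mono (f : nat -> R) n m : (forall i, 0 <= f i) -> (n <= m)%N ->
  \sum_(i < n) f i <= \sum_(i < m) f i.
Proof.
move=> f0 nm; rewrite -(subnKC nm) big_split_ord /= lerDl.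
by apply: sumr_ge0 => i _.
Qed.

Lemma sum_tail (f : nat -> R) L K n : (forall i, 0 <= f i) ->
  (forall n, \sum_(i < n) f i <= L) ->
  \sum_(i < n) (if (i < K)%N then 0 else f i) <= L - \sum_(i < K) f i.
Proof.
move=> f0 fL; set g := fun i : nat => if (i < K)%N then 0 else f i.
rewrite (@le_trans _ _ (\sum_(i < K + n) g i))//.
  by apply: (@sum_mono g) => [i|]; rewrite ?leq_addl// /g; case: ifP.
rewrite lerBrDl (le_trans _ (fL (K + n)%N))// !big_split_ord /= lerD2l.
rewrite [X in X + _]big1 ?add0r; last by move=> i _; rewrite /g /= ltn_ord.
by apply: ler_sum => i _; rewrite /g ltnNge leq_addr.
Qed.

Lemma sum_mulr_le_sqr n (x y : nat -> R) A B : 0 <= A -> 0 <= B ->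
  \sum_(i < n) x i ^+ 2 <= A ^+ 2 -> \sum_(i < n) y i ^+ 2 <= B ^+ 2 ->
  \sum_(i < n) x i * y i <= A * B.
Proof.
move=> A0 B0 xA yB.
suff h a b : 0 <= a -> 0 <= b -> \sum_(i < n) x i ^+ 2 <= a ^+ 2 ->
    \sum_(i < n) y i ^+ 2 <= b ^+ 2 -> 0 < a -> 0 < b -> \sum_(i < n) x i * y i <= a * b.
  apply/ler_addgt0Pr => e e0.
  (* The division below needs positive bounds, so both are enlarged by [d]; as [d <= 1], the product
     grows by at most [d * (A + B + 1)]. *)
  pose d := Num.min 1 (e / (A + B + 1)).
  have AB : 0 < A + B + 1 by rewrite ltr_wpDl// addr_ge0.
  have d0 : 0 < d by rewrite /d lt_min ltr01/= divr_gt0.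
  have d1 : d <= 1 by rewrite /d ge_min lexx.
  have de : d * (A + B + 1) <= e by rewrite -ler_pdivlMr// /d ge_min lexx orbT.
  have Ad : 0 < A + d by rewrite ltr_wpDl.
  have Bd : 0 < B + d by rewrite ltr_wpDl.
  rewrite (le_trans (h (A + d) (B + d) (ltW Ad) (ltW Bd) _ _ Ad Bd))//.
  - by rewrite (le_trans xA)// ler_sqr ?nnegrE ?(ltW Ad)// lerDl ltW.
  - by rewrite (le_trans yB)// ler_sqr ?nnegrE ?(ltW Bd)// lerDl ltW.
  - by nra.
move=> a0 b0 xa yb {}a0 {}b0.
(* AM-GM, weighted so that each of the two square sums contributes [a * b / 2]. *)
have xy i : x i * y i <= (b / a * x i ^+ 2 + a / b * y i ^+ 2) / 2.
  have : 0 <= (b * x i - a * y i) ^+ 2 / (a * b) by rewrite divr_ge0 ?sqr_ge0// mulr_ge0 ?ltW.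
  have -> : (b * x i - a * y i) ^+ 2 / (a * b) =
    b / a * x i ^+ 2 + a / b * y i ^+ 2 - 2 * (x i * y i).
    by field; rewrite !gt_eqF.
  lra.
apply: le_trans; first by apply: ler_sum => i _; exact: xy.
rewrite -mulr_suml big_split /= -!mulr_sumr ler_pdivrMr//.
have -> : a * b * 2 = b / a * a ^+ 2 + a / b * b ^+ 2 by field; rewrite !gt_eqF.
by rewrite lerD// ler_wpM2l// divr_ge0// ltW.
Qed.

End finite_sums.

Section orthonormal_basis.
Context (R : realType) (H : normedModType R[i]).
Local Notation C := R[i].

(* [co n x] is the coefficient of [x] along [e n]; no inner product is assumed. *)
Record onb (e : nat -> H) (co : nat -> H -> C) : Prop := Onb {
  co_lin : forall n a x y, co n (a *: x + y) = a * co n x + co n y;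
  co_e : forall m n, co m (e n) = (m == n)%:R;
  bessel : forall n x, \sum_(i < n) cn (co i x) ^+ 2 <= nr x ^+ 2;
  parseval : forall x M, 0 <= M ->
    (forall n, \sum_(i < n) cn (co i x) ^+ 2 <= M ^+ 2) -> nr x <= M;
  riesz_fischer : forall (c : nat -> C) M,
    (forall n, \sum_(i < n) cn (c i) ^+ 2 <= M) -> exists x, forall n, co n x = c n;
  abs_cvg : forall (u : nat -> H) M, (forall n, \sum_(i < n) nr (u i) <= M) ->
    exists s, hcvg (fun n => \sum_(i < n) u i) s }.

Context (e : nat -> H) (co : nat -> H -> C) (B : onb e co).

Lemma co0 n : co n 0 = 0.
Proof.
have := co_lin B n 1 0 0; rewrite scale1r addr0 mul1r => /eqP.
by rewrite -subr_eq0 opprD addrA subrr sub0r oppr_eq0 => /eqP.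
Qed.

Lemma coZ n a x : co n (a *: x) = a * co n x.
Proof. by have := co_lin B n a x 0; rewrite !addr0 co0 addr0. Qed.

Lemma coD n x y : co n (x + y) = co n x + co n y.
Proof. by have := co_lin B n 1 x y; rewrite scale1r mul1r. Qed.

Lemma coN n x : co n (- x) = - co n x.
Proof. by rewrite -scaleN1r coZ mulN1r. Qed.

Lemma coB n x y : co n (x - y) = co n x - co n y.
Proof. by rewrite coD coN. Qed.

Lemma co_sum n (I : Type) (r : seq I) (P : pred I) (F : I -> H) :
  co n (\sum_(i <- r | P i) F i) = \sum_(i <- r | P i) co n (F i).
Proof. by apply: (big_morph _ (coD n) (co0 n)). Qed.

Lemma co_le n x : cn (co n x) <= nr x.
Proof.
rewrite -ler_sqr ?nnegrE ?cn_ge0 ?nr_ge0// (le_trans _ (bessel B n.+1 x))//.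
by rewrite big_ord_recr /= lerDr; apply: sumr_ge0 => i _; rewrite sqr_ge0.
Qed.

Lemma nr_e n : nr (e n) <= 1.
Proof.
apply: (parseval B) => // m; rewrite expr1n.
under eq_bigr do rewrite (co_e B).
case: (ltnP n m) => nm.
  rewrite (bigD1 (Ordinal nm))//= eqxx cn1 expr1n big1 ?addr0// => i.
  by rewrite -val_eqE/= => /negbTE ->; rewrite cn0 expr0n.
rewrite big1// => i _; rewrite ltn_eqF ?cn0 ?expr0n//.
exact: leq_trans (ltn_ord i) nm.
Qed.

Lemma co_inj x y : (forall n, co n x = co n y) -> x = y.
Proof.
move=> xy; apply/eqP; rewrite -subr_eq0; apply/eqP/nr_eq0/eqP.
rewrite eq_le nr_ge0 andbT; apply: (parseval B) => // n.
by rewrite expr0n big1// => i _; rewrite coB xy subrr cn0 expr0n.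
Qed.

Lemma co_trunc n K x :
  co n (\sum_(i < K) co i x *: e i) = if (n < K)%N then co n x else 0.
Proof.
rewrite co_sum; under eq_bigr do rewrite coZ (co_e B).
case: ltnP => nK.
  rewrite (bigD1 (Ordinal nK))//= eqxx mulr1 big1 ?addr0// => i.
  by rewrite -val_eqE/= eq_sym => /negbTE ->; rewrite mulr0.
rewrite big1// => i _; rewrite gtn_eqF ?mulr0//.
exact: leq_trans (ltn_ord i) nK.
Qed.

(** By [bessel] the squared coefficients form a convergent series, and [parseval] bounds the
    remainder of the expansion by the tail of that series. *)
Lemma trunc_cvg x : hcvg (fun K => \sum_(i < K) co i x *: e i) x.
Proof.
pose f i := cn (co i x) ^+ 2; pose S n := \sum_(i < n) f i.
have f0 i : 0 <= f i by rewrite sqr_ge0.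
have ndS : nondecreasing_seq S by move=> m n mn; exact: sum_mono.
have ubS : has_ubound (range S).
  by exists (nr x ^+ 2) => _ [n _ <-]; exact: (bessel B).
have SL := nondecreasing_cvgn ndS ubS; set L := sup _ in SL.
have SleL n : S n <= L by apply: sup_upper_bound => //; split => //; exists (S 0), 0.
apply/cvgrPdist_lt => d d0; move/cvgrPdist_lt : SL => /(_ (d ^+ 2 / 4)).
have dd : 0 < d ^+ 2 / 4 by rewrite divr_gt0// exprn_gt0.
move=> /(_ dd); apply: filterS => K; rewrite ger0_norm ?subr_ge0// => LK.
rewrite sub0r normrN ger0_norm ?nr_ge0//.
apply: (@le_lt_trans _ _ (d / 2)); last by lra.
apply: (parseval B) => [|n]; first by rewrite divr_ge0// ltW.
rewrite (_ : (d / 2) ^+ 2 = d ^+ 2 / 4); last by field.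
rewrite (le_trans _ (ltW LK))//.
rewrite (le_trans _ (@sum_tail _ f L K n f0 SleL))//.
apply: ler_sum => i _; rewrite coB co_trunc; case: ifP => _.
  by rewrite subrr cn0 expr0n.
by rewrite subr0.
Qed.

Definition hlim (u : nat -> H) : H := get [set s | hcvg u s].

Lemma hlim_cvg u s : hcvg u s -> hlim u = s.
Proof. by move=> us; apply: (hcvg_uniq _ us); apply: (@getPex _ [set s | hcvg u s]); exists s. Qed.

(** [get] returns an unspecified vector if none has these coefficients; [co_mk] excludes this when
    [c] is dominated by the coefficients of some vector. *)
Definition mk (c : nat -> C) : H := get [set x | forall n, co n x = c n].

Lemma co_mk c x W : 0 <= W -> (forall n, cn (c n) <= W * cn (co n x)) ->
  (forall n, co n (mk c) = c n) /\ nr (mk c) <= W * nr x.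
Proof.
move=> W0 cW.
have cb n : \sum_(i < n) cn (c i) ^+ 2 <= (W * nr x) ^+ 2.
  apply: (@le_trans _ _ (\sum_(i < n) W ^+ 2 * cn (co i x) ^+ 2)).
    apply: ler_sum => i _; rewrite -exprMn ler_sqr ?nnegrE ?cn_ge0//.
    by rewrite mulr_ge0// cn_ge0.
  by rewrite -mulr_sumr exprMn ler_wpM2l ?sqr_ge0//; exact: (bessel B).
have comk n : co n (mk c) = c n.
  exact: (@getPex _ [set x | forall n, co n x = c n] (riesz_fischer B cb)).
split=> //; apply: (parseval B) => [|n]; first by rewrite mulr_ge0// nr_ge0.
by under eq_bigr do rewrite comk.
Qed.

(** The matrix with columns [g] applied to [v]. The value is meaningful when the series converges,
    which [summable] ensures by absolute convergence. *)
Definition lc (v : H) (g : nat -> H) : H := hlim (fun n => \sum_(i < n) co i v *: g i).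

Definition summable (v : H) (g : nat -> H) (M : R) :=
  forall n, \sum_(i < n) cn (co i v) * nr (g i) <= M.

Lemma lcP v g M : summable v g M ->
  hcvg (fun n => \sum_(i < n) co i v *: g i) (lc v g) /\ nr (lc v g) <= M.
Proof.
move=> vg.
have [s us] : exists s, hcvg (fun n => \sum_(i < n) co i v *: g i) s.
  apply: (abs_cvg B (u := fun i => co i v *: g i) (M := M)) => n.
  by rewrite (le_trans _ (vg n))//; apply: ler_sum => i _; rewrite nrZ.
have -> : lc v g = s by exact: hlim_cvg.
split => //; apply: (hcvg_le us); apply: nearW => n.
rewrite (le_trans (nr_sum _ _ _))// (le_trans _ (vg n))//.
by apply: ler_sum => i _; rewrite nrZ.
Qed.

Lemma lc_eq v (g : nat -> H) s : hcvg (fun n => \sum_(i < n) co i v *: g i) s -> lc v g = s.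
Proof. exact: hlim_cvg. Qed.

Lemma summable_lin a v w g M N : summable v g M -> summable w g N ->
  summable (a *: v + w) g (cn a * M + N).
Proof.
move=> vM wN n; rewrite (@le_trans _ _ (\sum_(i < n) (cn a * (cn (co i v) * nr (g i)) + cn (co i w) * nr (g i))))//.
  apply: ler_sum => i _; rewrite coD coZ mulrA -mulrDl ler_wpM2r ?nr_ge0//.
  by rewrite (le_trans (cnD _ _))// cnM.
rewrite big_split /= -mulr_sumr; apply: lerD; last exact: wN.
by apply: ler_wpM2l; [exact: cn_ge0|exact: vM].
Qed.

Lemma lc_linl a v w g M N : summable v g M -> summable w g N ->
  lc (a *: v + w) g = a *: lc v g + lc w g.
Proof.
move=> /lcP[vg _] /lcP[wg _]; apply: lc_eq.
rewrite [X in hcvg X _](_ : _ = fun n => a *: (\sum_(i < n) co i v *: g i) + \sum_(i < n) co i w *: g i); first exact: hcvg_lin.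
apply/funext => n; rewrite scaler_sumr -big_split /=; apply: eq_bigr => i _.
by rewrite coD coZ scalerDl scalerA.
Qed.

Lemma lc_subr v g g' M N : summable v g M -> summable v g' N ->
  lc v g - lc v g' = lc v (fun i => g i - g' i).
Proof.
move=> /lcP[vg _] /lcP[wg _]; apply/esym/lc_eq.
rewrite [X in hcvg X _](_ : _ = fun n => (\sum_(i < n) co i v *: g i) - \sum_(i < n) co i v *: g' i); first exact: hcvgB.
apply/funext => n; rewrite -sumrB; apply: eq_bigr => i _.
by rewrite scalerBr.
Qed.

Lemma lc_e n g : lc (e n) g = g n.
Proof.
apply: lc_eq; apply: (@hcvg_near _ _ _ _ (fun=> 0)); last exact: cvg_cst.
near=> m; have nm : (n < m)%N by near: m; exact: nbhs_infty_gt.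
rewrite (bigD1 (Ordinal nm))//= (co_e B) eqxx scale1r big1 ?addr0 ?subrr ?nr0//.
by move=> i; rewrite -val_eqE/= (co_e B) => /negbTE ->; rewrite scale0r.
Unshelve. all: by end_near. Qed.

End orthonormal_basis.

(** * Perturbed diagonal operators *)

Section more_limits.
Context (R : realType).

Lemma le_cvg0 (x y : R) (z : nat -> R) : (\forall i \near \oo, x <= y + z i) ->
  z @ \oo --> 0 -> x <= y.
Proof.
move=> xyz z0; rewrite -[y]addr0 -(cvg_lim (@Rhausdorff R) z0) -lerBlDl.
apply: limr_ge; first by apply/cvg_ex; exists 0.
by apply: filterS xyz => i; rewrite lerBlDl.
Qed.

(** Induction against the telescoping majorant [4 - 2 / (n + 1)]. The bound is kept as a square to
    fit [sum_mulr_le_sqr]; it is the origin of the factors [2] in the estimates of [G]. *)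
Lemma sum_invsqr_le n : \sum_(i < n) ((i.+1%:R : R)^-1) ^+ 2 <= 2 ^+ 2.
Proof.
suff : \sum_(i < n) ((i.+1%:R : R)^-1) ^+ 2 <= 4 - 2 * (n.+1%:R)^-1.
  by move/le_trans; apply; have : 0 < (n.+1%:R : R)^-1 by []; move: (_^-1) => y; lra.
elim: n => [|n IH]; first by rewrite big_ord0 invr1; lra.
rewrite big_ord_recr /= (le_trans (lerD IH (lexx _)))//.
have n0 : 1 <= n.+1%:R :> R by rewrite ler1n.
rewrite -[n.+2]addn1 natrD; move: (n.+1%:R) n0 => x x1.
rewrite -lerBrDl -subr_ge0.
rewrite (_ : _ - _ = (x - 1) / (x ^+ 2 * (x + 1))); last first.
  by field; rewrite !gt_eqF//; lra.
by rewrite divr_ge0//; [lra|rewrite mulr_ge0 ?sqr_ge0//; lra].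
Qed.

Lemma cvg0M (c : R) (a : nat -> R) : a @ \oo --> 0 -> (fun j => c * a j) @ \oo --> 0.
Proof.
by move=> a0; rewrite -[X in _ --> X](mulr0 c); apply: cvgM => //; exact: cvg_cst.
Qed.

Lemma cvg0D (a a' : nat -> R) : a @ \oo --> 0 -> a' @ \oo --> 0 ->
  (fun j => a j + a' j) @ \oo --> 0.
Proof. by move=> a0 a0'; rewrite -[X in _ --> X]addr0; exact: cvgD. Qed.

End more_limits.

Section perturbed_diagonal.
Context (R : realType) (H : normedModType R[i]).
Local Notation C := R[i].
Context (e : nat -> H) (co : nat -> H -> C) (B : onb e co).
Context (lam : nat -> R) (b : nat -> H) (Cb : R) (kappa : R).
Hypothesis bC : forall n, nr (b n) <= Cb.
Hypothesis Cb1 : 1 <= Cb.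
Hypothesis kappa0 : 0 < kappa.
Hypothesis lam_ge : forall n, kappa * n.+1%:R ^+ 2 <= lam n.

Local Notation lc := (lc co).
Local Notation summable := (summable co).

(* The operator [A - B] with [A] diagonal with eigenvalues [lam] and [B] mapping
   [e n] to [b n]. *)
Definition pert_op : set (H * H) := [set p | exists h,
  (forall n, co n h = (lam n)%:C * co n p.1) /\
  hcvg (fun n => \sum_(i < n) co i p.1 *: b i) (h - p.2)].

Local Notation T := pert_op.

Let lam_gt0 n : 0 < lam n.
Proof. by rewrite (lt_le_trans _ (lam_ge n))// mulr_gt0// exprn_gt0. Qed.

Let Cb0 : 0 <= Cb. Proof. by rewrite (le_trans ler01). Qed.

Lemma pert_op_lin a p q : T p -> T q -> T (a *: p + q).
Proof.
move=> [h [ha hb]] [h' [ha' hb']]; exists (a *: h + h'); split=> [n|].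
  by rewrite (co_lin B) ha ha' (co_lin B) mulrDr mulrCA.
rewrite opprD addrACA -scalerBr.
rewrite [X in hcvg X _](_ : _ = fun n => a *: (\sum_(i < n) co i p.1 *: b i) + \sum_(i < n) co i q.1 *: b i); first exact: hcvg_lin.
apply/funext => n; rewrite scaler_sumr -big_split /=; apply: eq_bigr => i _.
by rewrite (co_lin B) scalerDl scalerA.
Qed.

Lemma pert_op0 : T (0, 0).
Proof.
exists 0; split=> [n|]; first by rewrite (co0 B) mulr0.
rewrite subr0 [X in hcvg X _](_ : _ = fun=> 0); first exact: hcvg_cst.
by apply/funext => n; rewrite big1// => i _; rewrite (co0 B) scale0r.
Qed.

Lemma pert_op_fun u f f' : T (u, f) -> T (u, f') -> f = f'.
Proof.
move=> [h [ha hb]] [h' [ha' hb']].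
have hh' : h = h' by apply: (co_inj B) => n; rewrite ha ha'.
by apply: oppr_inj; apply: (@addrI _ h); rewrite [in RHS]hh'; exact: (hcvg_uniq hb).
Qed.

Lemma summable_b u M : (forall n, \sum_(i < n) cn (co i u) <= M) -> summable u b (Cb * M).
Proof.
move=> uM n; rewrite (@le_trans _ _ (\sum_(i < n) Cb * cn (co i u)))//.
  by apply: ler_sum => i _; rewrite mulrC ler_wpM2r ?cn_ge0.
by rewrite -mulr_sumr ler_wpM2l.
Qed.

Section shifted.
Variables (s eps : R).
Hypothesis eps0 : 0 < eps.
Hypothesis epsC : eps * Cb <= 1 / 2.
Hypothesis s_ge : (kappa * eps ^+ 2)^-1 <= s.

Let s0 : 0 < s.
Proof. by rewrite (lt_le_trans _ s_ge)// invr_gt0 mulr_gt0// exprn_gt0. Qed.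

Let w n := (lam n + s)^-1.

(** By AM-GM [(lam i + s)^2 >= 4 * lam i * s], and the lower bounds on [lam i] and [s] make this at
    least [4 * (i + 1)^2 / eps^2]; then [sum_invsqr_le] applies. *)
Let sum_w n : \sum_(i < n) w i ^+ 2 <= eps ^+ 2.
Proof.
apply: (@le_trans _ _ (\sum_(i < n) (eps ^+ 2 / 4) * ((i.+1%:R : R)^-1) ^+ 2)).
  apply: ler_sum => i _; rewrite /w !exprVn -[leLHS]mul1r.
  rewrite ler_pdivrMr ?exprn_gt0 ?addr_gt0// mulrAC.
  have li := lam_ge i; set x := (i.+1%:R : R) in li *.
  rewrite ler_pdivlMr ?exprn_gt0 ?ltr0Sn// mul1r.
  have h : kappa * x ^+ 2 * (kappa * eps ^+ 2)^-1 <= lam i * s.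
    by apply: ler_pM => //; [rewrite mulr_ge0 ?sqr_ge0// ltW|rewrite invr_ge0 mulr_ge0 ?sqr_ge0// ltW].
  have h' : x ^+ 2 <= eps ^+ 2 * (lam i * s).
    rewrite -ler_pdivrMl ?exprn_gt0// (le_trans _ h)// le_eqVlt; apply/orP; left; apply/eqP.
    by field; rewrite !gt_eqF.
  rewrite (le_trans h')//.
  have := mulr_ge0 (sqr_ge0 eps) (sqr_ge0 (lam i - s)).
  by move: (eps ^+ 2) => E; rewrite !expr2; nra.
rewrite -mulr_sumr (le_trans (ler_wpM2l _ (sum_invsqr_le R n)))//.
  by rewrite divr_ge0// sqr_ge0.
by rewrite le_eqVlt; apply/orP; left; apply/eqP; field.
Qed.

(** The coefficients of [u] are those of [h + s u] times [w], so Cauchy-Schwarz makes them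
    absolutely summable, with some finite sum [L]. Replacing [h] by [f] costs at most [Cb * L] in
    norm, hence [eps * Cb * L <= L / 2] in the estimate, which is absorbed on the left. *)
Lemma pert_op_l1 u f : T (u, f) ->
  forall n, \sum_(i < n) cn (co i u) <= 2 * eps * nr (f + s%:C *: u).
Proof.
move=> [h /= [ha hb]].
have hs n : \sum_(i < n) cn (co i u) <= eps * nr (h + s%:C *: u).
  apply: (@le_trans _ _ (\sum_(i < n) w i * cn (co i (h + s%:C *: u)))).
    apply: ler_sum => i _; rewrite (coD B) (coZ B) ha -mulrDl -rmorphD cnM cn_real.
    by rewrite gtr0_norm ?addr_gt0// /w mulrA mulVf ?mul1r// gt_eqF// addr_gt0.
  apply: (@sum_mulr_le_sqr _ n w (fun i => cn (co i (h + s%:C *: u)))) => //; rewrite ?nr_ge0 ?(ltW eps0)//.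
  exact: (bessel B).
pose S' n := \sum_(i < n) cn (co i u).
have supS : has_sup (range S').
  split; first by exists (S' 0); exists 0%N.
  by exists (eps * nr (h + s%:C *: u)) => _ [n _ <-]; exact: hs.
have SL n : S' n <= sup (range S').
  by apply: sup_upper_bound => //; exists n.
set L := sup _ in SL.
have [_ ] := lcP B (summable_b SL).
rewrite (lc_eq hb) => hfL.
have hfs : nr (h + s%:C *: u) <= nr (f + s%:C *: u) + Cb * L.
  have -> : h + s%:C *: u = (f + s%:C *: u) + (h - f) by rewrite [RHS]addrC addrA subrK.
  by rewrite (le_trans (nrD _ _))// lerD2l.
have L0 : 0 <= L by rewrite (le_trans _ (SL 0))// /S' big_ord0.
have : L <= eps * (nr (f + s%:C *: u) + Cb * L).
  apply: ge_sup => //; first by case: supS.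
  by move=> _ [n _ <-]; rewrite (le_trans (hs n))// ler_pM2l.
move=> LL n; rewrite (le_trans (SL n))//.
by have := ler_wpM2r L0 epsC; lra.
Qed.

Lemma pert_op_inj u : T (u, - (s%:C *: u)) -> u = 0.
Proof.
move=> /pert_op_l1; rewrite addNr nr0 mulr0 => h.
apply: (co_inj B) => n; rewrite (co0 B); apply: cn_eq0; apply/eqP.
rewrite eq_le cn_ge0 andbT (le_trans _ (h n.+1))// big_ord_recr /= lerDr.
by apply: sumr_ge0 => i _; exact: cn_ge0.
Qed.

(** Norm convergence alone does not control the unbounded map [e n |-> b n]. The estimate
    [pert_op_l1], applied to differences, gives convergence of the coefficients in the [l1] norm,
    and this does. *)
Lemma pert_op_seq_closed (u_ f_ : nat -> H) u f : (forall j, T (u_ j, f_ j)) ->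
  hcvg u_ u -> hcvg f_ f -> T (u, f).
Proof.
move=> Tuf uu ff.
pose d j := nr (f_ j - f) + s * nr (u_ j - u).
have d0 : d @ \oo --> 0.
  apply: cvg0D; first by under eq_fun do rewrite nrB; exact: ff.
  by apply: cvg0M; under eq_fun do rewrite nrB; exact: uu.
have l1 j n : \sum_(i < n) cn (co i (u_ j - u)) <= 2 * eps * d j.
  (* For fixed [n], replacing [u] by [u_ i] changes the sum of [n] moduli by at most [n] times the
     distance, which vanishes as [i] grows. *)
  apply: (@le_cvg0 _ _ _ (fun i => 2 * eps * d i + n%:R * nr (u_ i - u))).
    apply: nearW => i.
    have := pert_op_lin (-1) (Tuf i) (Tuf j).
    rewrite /= ![-1 *: _]scaleN1r => /pert_op_l1/(_ n); rewrite ![- _ + _]addrC => l1ij.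
    rewrite (@le_trans _ _ (\sum_(k < n) (cn (co k (u_ j - u_ i)) + nr (u_ i - u))))//.
      apply: ler_sum => k _; rewrite (_ : u_ j - u = (u_ j - u_ i) + (u_ i - u)); last by rewrite addrA subrK.
      by rewrite (coD B) (le_trans (cnD _ _))// lerD2l (co_le B).
    rewrite big_split /= sumr_const card_ord addrA -[X in _ + X <= _]mulr_natl lerD2r (le_trans l1ij)//.
    rewrite -mulrDr ler_wpM2l ?mulr_ge0 ?(ltW eps0)//.
    have -> : f_ j - f_ i + s%:C *: (u_ j - u_ i) = ((f_ j - f) + s%:C *: (u_ j - u)) - ((f_ i - f) + s%:C *: (u_ i - u)).
      rewrite opprD addrACA -scalerBr; congr (_ + _ *: _).
        by rewrite opprB addrA subrK.
      by rewrite opprB addrA subrK.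
    rewrite (le_trans (nrD _ _))// nrN lerD// (le_trans (nrD _ _))// lerD2l nrZ cn_real gtr0_norm//.
  apply: cvg0D; first exact: cvg0M.
  by apply: cvg0M; under eq_fun do rewrite nrB; exact: uu.
have lcj j := lcP B (summable_b (pert_op_l1 (Tuf j))).
have lcd j := lcP B (summable_b (l1 j)).
have hj j : exists2 h, (forall n, co n h = (lam n)%:C * co n (u_ j)) & h = f_ j + lc (u_ j) b.
  have [h /= [h1 h2]] := Tuf j; exists h => //.
  by rewrite (lc_eq h2) addrC subrK.
(* [u] is [u_ 0] minus [u_ 0 - u], and both have absolutely summable coefficients. *)
have [M uM] : exists M, summable u b M.
  exists (cn (-1) * (Cb * (2 * eps * d 0)) + Cb * (2 * eps * nr (f_ 0 + s%:C *: u_ 0))).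
  have := summable_lin B (-1) (summable_b (l1 0)) (summable_b (pert_op_l1 (Tuf 0))).
  by rewrite scaleN1r opprB subrK.
have [lcu _] := lcP B uM.
exists (f + lc u b); split => /=; last by rewrite addrC addKr.
have lcdj j : lc (u_ j - u) b = lc (u_ j) b - lc u b.
  rewrite addrC -scaleN1r (lc_linl B (-1) uM (summable_b (pert_op_l1 (Tuf j)))).
  by rewrite scaleN1r addrC.
have hcv : hcvg (fun j => f_ j + lc (u_ j) b) (f + lc u b).
  apply: hcvgD => //; apply: (@hcvg_near _ _ _ _ (fun j => Cb * (2 * eps * d j))).
    by apply: nearW => j; rewrite nrB -lcdj; case: (lcd j).
  by do 2 apply: cvg0M.
move=> n; apply/eqP; rewrite -subr_eq0; apply/eqP/cn_eq0.
apply: (@le0_cvg0 _ _ (fun j => nr ((f + lc u b) - (f_ j + lc (u_ j) b)) + lam n * nr (u_ j - u))).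
- exact: cn_ge0.
- apply: nearW => j; have [h h1 h2] := hj j.
  rewrite (_ : _ - _ = (co n (f + lc u b) - co n h) + (lam n)%:C * (co n (u_ j) - co n u)); last first.
    by rewrite h1 mulrBr addrA subrK.
  rewrite -!(coB B) (le_trans (cnD _ _))// h2 lerD ?(co_le B)// cnM cn_real gtr0_norm//.
  by rewrite ler_pM2l// (co_le B).
- apply: cvg0D => //; apply: cvg0M.
  by under eq_fun do rewrite nrB; exact: uu.
Qed.

End shifted.

End perturbed_diagonal.

(** * Intertwining by a fixed point *)

Section similarity.
Context (R : realType) (H : normedModType R[i]).
Local Notation C := R[i].
Context (e : nat -> H) (co : nat -> H -> C) (B : onb e co).
Context (lam : nat -> R) (b : nat -> H) (Cb : R) (kappa : R).
Hypothesis bC : forall n, nr (b n) <= Cb.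
Hypothesis Cb1 : 1 <= Cb.
Hypothesis kappa0 : 0 < kappa.
Hypothesis lam_ge : forall n, kappa * n.+1%:R ^+ 2 <= lam n.
Variable N : nat.
Definition in_block (m n : nat) := (m == n) || ((m < N)%N && (n < N)%N).
Variables (gam : nat -> nat -> R) (delta : R).
Hypothesis delta0 : 0 <= delta.
Hypothesis delta_Cb : 20 * (delta * Cb) <= 1.
Hypothesis gam_le : forall m n, `|gam m n| <= delta * (m.+1%:R^-1 * n.+1%:R^-1).
Hypothesis gamE : forall m n, (lam m - lam n) * gam m n = (~~ in_block m n)%:R.

Local Notation lc := (lc co).
Local Notation summable := (summable co).
Local Notation mk := (mk co).

Let Cb0 : 0 <= Cb. Proof. by rewrite (le_trans ler01). Qed.

Let inv_le1 n : (n.+1%:R : R)^-1 <= 1.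
Proof. by rewrite invf_le1// ler1n. Qed.

(** The overview's [G] and [J] act on each column separately, so a matrix is handled as a sequence
    of vectors and only its columns need to lie in [H]. *)
Definition Gam n x := mk (fun m => (gam m n)%:C * co m x).
Definition Jbl n x := mk (fun m => (in_block m n)%:R * co m x).

Lemma Gam_spec n x : (forall m, co m (Gam n x) = (gam m n)%:C * co m x) /\
  nr (Gam n x) <= delta * n.+1%:R^-1 * nr x.
Proof.
apply: (co_mk B) => [|m]; first by rewrite mulr_ge0 ?invr_ge0.
rewrite cnM cn_real ler_wpM2r ?cn_ge0// (le_trans (gam_le _ _))//.
by rewrite ler_wpM2l// ler_piMl ?invr_ge0.
Qed.

Lemma co_Gam n x m : co m (Gam n x) = (gam m n)%:C * co m x.
Proof. by case: (Gam_spec n x). Qed.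

Lemma Jbl_spec n x : (forall m, co m (Jbl n x) = (in_block m n)%:R * co m x) /\
  nr (Jbl n x) <= 1 * nr x.
Proof.
apply: (co_mk B) => [//|m].
by rewrite cnM cn_nat ler_wpM2r ?cn_ge0// lern1 leq_b1.
Qed.

Lemma co_Jbl n x m : co m (Jbl n x) = (in_block m n)%:R * co m x.
Proof. by case: (Jbl_spec n x). Qed.

Lemma nr_Jbl n x : nr (Jbl n x) <= nr x.
Proof. by case: (Jbl_spec n x); rewrite mul1r. Qed.

Lemma GamB n x y : Gam n (x - y) = Gam n x - Gam n y.
Proof. by apply: (co_inj B) => m; rewrite (coB B) !co_Gam (coB B) mulrBr. Qed.

Lemma JblB n x y : Jbl n (x - y) = Jbl n x - Jbl n y.
Proof. by apply: (co_inj B) => m; rewrite (coB B) !co_Jbl (coB B) mulrBr. Qed.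

(** Cauchy-Schwarz with the row weight [1 / (i + 1)]: square summable coefficients become absolutely
    summable ones, to which the columns [b] can be applied. *)
Lemma sum_Gam n x k : \sum_(i < k) cn (co i (Gam n x)) <= 2 * delta * nr x.
Proof.
apply: (@le_trans _ _ (delta * \sum_(i < k) i.+1%:R^-1 * cn (co i x))).
  rewrite mulr_sumr; apply: ler_sum => i _; rewrite co_Gam cnM cn_real mulrA.
  rewrite ler_wpM2r ?cn_ge0// (le_trans (gam_le _ _))// ler_wpM2l//.
  by rewrite ler_piMr ?invr_ge0.
rewrite [2 * _]mulrC -mulrA ler_wpM2l//.
apply: (@sum_mulr_le_sqr _ k (fun i => i.+1%:R^-1) (fun i => cn (co i x))) => //.
- exact: nr_ge0.
- exact: sum_invsqr_le.
- exact: (bessel B).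
Qed.

Lemma summable_Gam_b n x : summable (Gam n x) b (Cb * (2 * delta * nr x)).
Proof. by apply: (summable_b bC); [exact: Cb1|exact: sum_Gam]. Qed.

Definition GX (X : nat -> H) i := Gam i (X i).

(** Here the column weight is used: it makes [G X] a bounded operator although [X] has merely
    bounded columns. *)
Lemma summable_GX v X K : 0 <= K -> (forall n, nr (X n) <= K) ->
  summable v (GX X) (2 * delta * K * nr v).
Proof.
move=> K0 XK n.
apply: (@le_trans _ _ (delta * K * \sum_(i < n) i.+1%:R^-1 * cn (co i v))).
  rewrite mulr_sumr; apply: ler_sum => i _.
  rewrite mulrA [leRHS]mulrC ler_wpM2l ?cn_ge0//.
  case: (Gam_spec i (X i)) => _ /le_trans; apply.
  by rewrite mulrAC ler_wpM2r ?invr_ge0// ler_wpM2l.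
rewrite (_ : 2 * delta * K * nr v = delta * K * (2 * nr v)); last by ring.
rewrite ler_wpM2l ?mulr_ge0//.
apply: (@sum_mulr_le_sqr _ n (fun i => i.+1%:R^-1) (fun i => cn (co i v))) => //.
- exact: nr_ge0.
- exact: sum_invsqr_le.
- exact: (bessel B).
Qed.

(* [X n], [b n] and [GX X n] are the columns of [X], [Q] and [G X]. *)
Definition sim_step (X : nat -> H) n :=
  b n + lc (Gam n (X n)) b - lc (Jbl n (X n)) (GX X).

(** Radius of an invariant ball: [b] contributes [Cb] and the other two terms of [sim_step] at most
    [12 * delta * Cb^2], which is below [Cb]. *)
Let K := 2 * Cb.
Let K0 : 0 <= K. Proof. by rewrite mulr_ge0. Qed.

Lemma sim_step_ball X : (forall n, nr (X n) <= K) -> forall n, nr (sim_step X n) <= K.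
Proof.
move=> XK n; have [_ h1] := lcP B (summable_Gam_b n (X n)).
have [_ h2] := lcP B (summable_GX (Jbl n (X n)) K0 XK).
rewrite (le_trans (nrD _ _))// nrN (le_trans (lerD (nrD _ _) (lexx _)))//.
have h3 : nr (lc (Gam n (X n)) b) <= Cb * (2 * delta * K).
  by rewrite (le_trans h1)// !ler_wpM2l ?mulr_ge0.
have h4 : nr (lc (Jbl n (X n)) (GX X)) <= 2 * delta * K * K.
  by rewrite (le_trans h2)// ler_wpM2l ?mulr_ge0// (le_trans (nr_Jbl _ _)).
apply: (le_trans (lerD (lerD (bC n) h3) h4)); rewrite /K.
have h : 0 <= delta * Cb * Cb by rewrite !mulr_ge0.
by have := ler_wpM2r Cb0 delta_Cb; lra.
Qed.

(** One linear and two bilinear differences contribute [2], [4] and [4] times [delta * Cb * d]; the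
    constant [20] in [delta_Cb] is what turns [10 * delta * Cb] into [1 / 2]. *)
Lemma sim_step_contract X Y d : 0 <= d -> (forall n, nr (X n) <= K) ->
  (forall n, nr (Y n) <= K) -> (forall n, nr (X n - Y n) <= d) ->
  forall n, nr (sim_step X n - sim_step Y n) <= d / 2.
Proof.
move=> d0 XK YK XYd n.
(* The quadratic term is split into [J (X - Y)] against [G X] and [J Y] against [G (X - Y)]. *)
have -> : sim_step X n - sim_step Y n =
  lc (Gam n (X n - Y n)) b - lc (Jbl n (X n - Y n)) (GX X) -
  lc (Jbl n (Y n)) (GX (fun i => X i - Y i)).
  have -> : lc (Gam n (X n - Y n)) b = lc (Gam n (X n)) b - lc (Gam n (Y n)) b.
    rewrite GamB addrC -scaleN1r (lc_linl B (-1) (summable_Gam_b n (Y n)) (summable_Gam_b n (X n))).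
    by rewrite scaleN1r addrC.
  have -> : lc (Jbl n (X n - Y n)) (GX X) = lc (Jbl n (X n)) (GX X) - lc (Jbl n (Y n)) (GX X).
    rewrite JblB addrC -scaleN1r.
    rewrite (lc_linl B (-1) (summable_GX (Jbl n (Y n)) K0 XK) (summable_GX (Jbl n (X n)) K0 XK)).
    by rewrite scaleN1r addrC.
  have -> : lc (Jbl n (Y n)) (GX (fun i => X i - Y i)) = lc (Jbl n (Y n)) (GX X) - lc (Jbl n (Y n)) (GX Y).
    rewrite (lc_subr B (summable_GX (Jbl n (Y n)) K0 XK) (summable_GX (Jbl n (Y n)) K0 YK)).
    by congr (lc _ _); apply/funext => i; rewrite /GX GamB.
  rewrite /sim_step.
  set p := lc (Gam n (X n)) b; set q := lc (Gam n (Y n)) b.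
  set r := lc (Jbl n (X n)) (GX X); set s := lc (Jbl n (Y n)) (GX X).
  set t := lc (Jbl n (Y n)) (GX Y).
  have -> : p - q - (r - s) - (s - t) = p - q + (t - r).
    by rewrite !opprB -addrA [s - r + _]addrC [t - s + _]addrA subrK.
  by rewrite opprD opprK addrACA [- r + t]addrC opprD [b n + p + _]addrACA subrr add0r.
have [_ h1] := lcP B (summable_Gam_b n (X n - Y n)).
have [_ h2] := lcP B (summable_GX (Jbl n (X n - Y n)) K0 XK).
have [_ h3] := lcP B (summable_GX (Jbl n (Y n)) d0 XYd).
rewrite (le_trans (nrD _ _))// nrN (le_trans (lerD (nrD _ _) (lexx _)))// nrN.
have h1' : nr (lc (Gam n (X n - Y n)) b) <= Cb * (2 * delta * d).
  by rewrite (le_trans h1)// !ler_wpM2l ?mulr_ge0.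
have h2' : nr (lc (Jbl n (X n - Y n)) (GX X)) <= 2 * delta * K * d.
  by rewrite (le_trans h2)// ler_wpM2l ?mulr_ge0// (le_trans (nr_Jbl _ _)).
have h3' : nr (lc (Jbl n (Y n)) (GX (fun i => X i - Y i))) <= 2 * delta * d * K.
  by rewrite (le_trans h3)// ler_wpM2l ?mulr_ge0// (le_trans (nr_Jbl _ _)).
apply: (le_trans (lerD (lerD h1' h2') h3')); rewrite /K.
have h : 0 <= delta * Cb * d by rewrite !mulr_ge0.
by have := ler_wpM2r d0 delta_Cb; lra.
Qed.

(** Banach iteration for the supremum of the column norms. The limit is taken column by column, and
    the rate [2 * K / 2 ^+ j], uniform in the column, is what lets [sim_step] pass to the limit. *)
Lemma sim_fixpoint : exists X : nat -> H, (forall n, nr (X n) <= K) /\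
  forall n, X n = sim_step X n.
Proof.
pose Y j := iter j sim_step (fun=> 0).
have YK j n : nr (Y j n) <= K.
  by elim: j n => [n|j IH]; [rewrite /= nr0|exact: sim_step_ball].
have Yd j n : nr (Y j.+1 n - Y j n) <= K / 2 ^+ j.
  elim: j n => [n|j IH n]; first by rewrite subr0 expr0 divr1.
  have d0 : 0 <= K / 2 ^+ j by rewrite divr_ge0// exprn_ge0.
  have := sim_step_contract d0 (YK j.+1) (YK j) IH n.
  by rewrite exprS invfM mulrCA [2^-1 * _]mulrC.
have YX n : exists x, forall j, nr (x - Y j n) <= 2 * K / 2 ^+ j.
  have half (j k : nat) : \sum_(i < k) K / 2 ^+ (j + i) <= 2 * K / 2 ^+ j.
    suff : \sum_(i < k) K / 2 ^+ (j + i) <= 2 * K / 2 ^+ j - 2 * K / 2 ^+ (j + k).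
      by move/le_trans; apply; rewrite gerBl divr_ge0 ?mulr_ge0// exprn_ge0.
    elim: k => [|k IH]; first by rewrite big_ord0 addn0 subrr.
    rewrite big_ord_recr /= (le_trans (lerD IH (lexx _)))// addnS exprS.
    rewrite le_eqVlt; apply/orP; left; apply/eqP; field.
    by rewrite !expf_neq0.
  have [|x ux] := abs_cvg B (u := fun j => Y j.+1 n - Y j n) (M := 2 * K / 2 ^+ 0).
    move=> k; apply: le_trans (half 0 k); apply: ler_sum => i _; exact: Yd.
  exists x => j; apply: (@hcvg_le _ _ (fun k => \sum_(i < j + k) (Y i.+1 n - Y i n) - Y j n)).
    apply: hcvgB; last exact: hcvg_cst.
    rewrite /hcvg; under eq_fun do rewrite addnC.
    by move: ux; rewrite /hcvg -(cvg_shiftn j).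
  apply: nearW => k.
  have -> : \sum_(i < j + k) (Y i.+1 n - Y i n) - Y j n = \sum_(i < k) (Y (j + i).+1 n - Y (j + i) n).
    rewrite big_split_ord /= [X in X + _ - _](_ : _ = Y j n); last first.
      rewrite -(big_mkord xpredT (fun i => Y i.+1 n - Y i n)) telescope_sumr//.
      by rewrite subr0.
    by rewrite addrC addKr.
  apply: le_trans (nr_sum _ _ _) _; apply: le_trans (half j k).
  by apply: ler_sum => i _; exact: Yd.
have [X XY] := choice YX.
have cv0 : (fun j => 2 * K / 2 ^+ j) @ \oo --> 0.
  apply: cvg0M; under eq_fun do rewrite -exprVn.
  by apply: cvg_expr; rewrite ger0_norm ?invr_ge0// invf_lt1// ltr1n.
have XK n : nr (X n) <= K.
  by apply: (@hcvg_le _ _ (fun j => Y j n)); [apply: hcvg_near cv0; apply: nearW|apply: nearW].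
exists X; split => // n; apply/eqP; rewrite -subr_eq0; apply/eqP/nr_eq0.
apply: (@le0_cvg0 _ _ (fun j => 2 * K / 2 ^+ j + 2 * K / 2 ^+ j)); first exact: nr_ge0.
- apply: nearW => j.
  have -> : X n - sim_step X n = (X n - Y j.+1 n) + (Y j.+1 n - sim_step X n) by rewrite addrA subrK.
  have d0 : 0 <= 2 * K / 2 ^+ j by rewrite divr_ge0 ?mulr_ge0// exprn_ge0.
  rewrite (le_trans (nrD _ _))// lerD//.
    by rewrite (le_trans (XY _ _))// ler_wpM2l ?mulr_ge0// lef_pV2 ?posrE ?exprn_gt0// ler_weXn2l// ler1n.
  rewrite nrB (le_trans (sim_step_contract d0 XK (YK j) _ n))//.
  by rewrite ler_pdivrMr// ler_peMr// ler1n.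
- exact: cvg0D.
Qed.

End similarity.

(** * Similarity with a block operator *)

Section near_identity.
Context (R : realType) (H : normedModType R[i]).
Local Notation C := R[i].
Context (e : nat -> H) (co : nat -> H -> C) (B : onb e co).
Variable g : nat -> H.
Hypothesis g_small : forall v, summable co v g (nr v / 2).

Definition simU v := v + lc co v g.
Local Notation U := simU.

Lemma simU_lin a v w : U (a *: v + w) = a *: U v + U w.
Proof. by rewrite /U (lc_linl B a (g_small v) (g_small w)) scalerDr addrACA. Qed.

Lemma simU0 : U 0 = 0.
Proof. by have := simU_lin (-1) 0 0; rewrite scaler0 addr0 scaleN1r addNr. Qed.

Lemma simUZ a v : U (a *: v) = a *: U v.
Proof. by have := simU_lin a v 0; rewrite simU0 !addr0. Qed.

Lemma simUD v w : U (v + w) = U v + U w.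
Proof. by have := simU_lin 1 v w; rewrite !scale1r. Qed.

Lemma simUB v w : U (v - w) = U v - U w.
Proof. by rewrite simUD -scaleN1r simUZ scaleN1r. Qed.

Lemma simU_le v : nr (U v) <= 2 * nr v.
Proof.
have [_ h] := lcP B (g_small v); rewrite (le_trans (nrD _ _))//.
by have := nr_ge0 v; lra.
Qed.

Lemma simU_ge v : nr v <= 2 * nr (U v).
Proof.
have [_ h] := lcP B (g_small v).
have : nr v <= nr (U v) + nr (lc co v g).
  by rewrite -{1}[v](addrK (lc co v g)) (le_trans (nrD _ _))// nrN.
lra.
Qed.

Lemma simU_inj : injective U.
Proof.
move=> v w vw; apply/eqP; rewrite -subr_eq0; apply/eqP/nr_eq0/eqP.
rewrite eq_le nr_ge0 andbT (le_trans (simU_ge _))// simUB vw subrr nr0 mulr0//.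
Qed.

Lemma simU_cvg v_ v : hcvg v_ v -> hcvg (fun n => U (v_ n)) (U v).
Proof.
move=> vv; apply: (@hcvg_near _ _ _ _ (fun n => 2 * nr (v - v_ n))).
  by apply: nearW => n; rewrite -simUB simU_le.
exact: cvg0M.
Qed.

(** Neumann series: with [u j] the [j]-th iterate of [- G] at [y], the images of the partial sums
    telescope to [y - u k]. *)
Lemma simU_surj y : exists v, U v = y.
Proof.
pose G v := lc co v g.
pose u j := iter j (fun v => - G v) y.
have nu j : nr (u j) <= nr y / 2 ^+ j.
  elim: j => [|j IH]; first by rewrite expr0 divr1.
  have [_ h] := lcP B (g_small (u j)).
  by rewrite /= nrN (le_trans h)// exprSr invfM mulrA ler_pM2r.
have half k : \sum_(i < k) nr y / 2 ^+ i <= 2 * nr y.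
  suff : \sum_(i < k) nr y / 2 ^+ i <= 2 * nr y - 2 * nr y / 2 ^+ k.
    by move/le_trans; apply; rewrite gerBl divr_ge0 ?mulr_ge0 ?nr_ge0// exprn_ge0.
  elim: k => [|k IH]; first by rewrite big_ord0 expr0 divr1 subrr.
  rewrite big_ord_recr /= (le_trans (lerD IH (lexx _)))// exprS.
  rewrite le_eqVlt; apply/orP; left; apply/eqP; field.
  by rewrite !expf_neq0.
have [|v uv] := abs_cvg B (u := u) (M := 2 * nr y).
  by move=> k; apply: le_trans (half k); apply: ler_sum => i _; exact: nu.
exists v; have Uv := simU_cvg uv.
have Us k : U (\sum_(i < k) u i) = y - u k.
  elim: k => [|k IH]; first by rewrite big_ord0 simU0 subrr.
  by rewrite big_ord_recr /= simUD IH /simU addrA subrK opprK.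
apply: (hcvg_uniq Uv); under eq_fun do rewrite Us.
apply: (@hcvg_near _ _ _ _ (fun k => nr y * 2^-1 ^+ k)).
  by apply: nearW => k; rewrite opprB addrC subrK exprVn.
by apply: cvg0M; apply: cvg_expr; rewrite ger0_norm ?invr_ge0// invf_lt1// ltr1n.
Qed.

Definition simV y := get [set v | U v = y].

Lemma simUV y : U (simV y) = y.
Proof. exact: (@getPex _ [set v | U v = y] (simU_surj y)). Qed.

Lemma simVU v : simV (U v) = v.
Proof. by apply: simU_inj; rewrite simUV. Qed.

Lemma simV_lin a v w : simV (a *: v + w) = a *: simV v + simV w.
Proof. by apply: simU_inj; rewrite simU_lin !simUV. Qed.

Lemma simV_le y : nr (simV y) <= 2 * nr y.
Proof. by rewrite -{2}(simUV y) simU_ge. Qed.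

End near_identity.

(** * Block operators in coordinates: a finite matrix and a diagonal tail *)

Section block_operators.
Context (R : realType) (H : normedModType R[i]).
Local Notation C := R[i].
Context (e : nat -> H) (co : nat -> H -> C) (B : onb e co).
Variable N : nat.
Implicit Types (P Q : 'M[C]_N) (w : nat -> C).

(* In coordinates: the matrix [P] on the first [N] ones, the diagonal operator
   with entries [w] on the others. *)
Definition cblk P w (c : nat -> C) (m : nat) : C :=
  if insub m is Some i then \sum_j P i j * c j else w m * c m.

Lemma cblk_lt P w c (i : 'I_N) : cblk P w c i = \sum_j P i j * c j.
Proof. by rewrite /cblk valK. Qed.

Lemma cblk_ge P w c m : (N <= m)%N -> cblk P w c m = w m * c m.
Proof. by move=> Nm; rewrite /cblk insubF// ltnNge Nm. Qed.

Lemma cblk_ind (p : nat -> Prop) : (forall i : 'I_N, p i) ->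
  (forall m, (N <= m)%N -> p m) -> forall m, p m.
Proof. by move=> pl pg m; case: (ltnP m N) => [mN|/pg//]; exact: (pl (Ordinal mN)). Qed.

Lemma cblk_eq P w w' c c' : c =1 c' -> (forall m, (N <= m)%N -> w m = w' m) ->
  cblk P w c =1 cblk P w' c'.
Proof.
move=> cc ww; apply: cblk_ind => [i|m Nm].
  by rewrite !cblk_lt; apply: eq_bigr => j _; rewrite cc.
by rewrite !cblk_ge// cc ww.
Qed.

Lemma cblk_lin P w a c c' m :
  cblk P w (fun i => a * c i + c' i) m = a * cblk P w c m + cblk P w c' m.
Proof.
move: m; apply: cblk_ind => [i|m Nm].
  rewrite !cblk_lt mulr_sumr -big_split; apply: eq_bigr => j _ /=.
  by rewrite mulrDr mulrCA.
by rewrite !cblk_ge// mulrDr mulrCA.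
Qed.

Lemma cblkM P Q w w' c m :
  cblk P w (cblk Q w' c) m = cblk (P *m Q) (fun m => w m * w' m) c m.
Proof.
move: m; apply: cblk_ind => [i|m Nm]; last by rewrite !cblk_ge// mulrA.
rewrite !cblk_lt; under eq_bigr do rewrite cblk_lt mulr_sumr.
rewrite exchange_big /=; apply: eq_bigr => j _; rewrite mxE mulr_suml.
by apply: eq_bigr => k _; rewrite mulrA.
Qed.

Lemma cblkD P Q w w' c m :
  cblk (P + Q) (fun m => w m + w' m) c m = cblk P w c m + cblk Q w' c m.
Proof.
move: m; apply: cblk_ind => [i|m Nm]; last by rewrite !cblk_ge// mulrDl.
by rewrite !cblk_lt -big_split; apply: eq_bigr => j _; rewrite mxE mulrDl.
Qed.

Lemma cblkN P w c m : cblk (- P) (fun m => - w m) c m = - cblk P w c m.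
Proof.
move: m; apply: cblk_ind => [i|m Nm]; last by rewrite !cblk_ge// mulNr.
by rewrite !cblk_lt -sumrN; apply: eq_bigr => j _; rewrite mxE mulNr.
Qed.

Lemma cblk_scalar a w c m : (forall m, (N <= m)%N -> w m = a) -> cblk a%:M w c m = a * c m.
Proof.
move=> wa; move: m; apply: cblk_ind => [i|m Nm]; last by rewrite cblk_ge// wa.
rewrite cblk_lt (bigD1 i)//= mxE eqxx mulr1n big1 ?addr0// => j.
by rewrite mxE eq_sym => /negbTE ->; rewrite mulr0n mul0r.
Qed.

Lemma cblk0 w c m : (forall m, (N <= m)%N -> w m = 0) -> cblk 0 w c m = 0.
Proof.
move=> w0; move: m; apply: cblk_ind => [i|m Nm]; last by rewrite cblk_ge// w0// mul0r.
by rewrite cblk_lt big1// => j _; rewrite mxE mul0r.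
Qed.

(** The vector with coordinates [cblk P w]. The finite block is written out in basis vectors, while
    the tail exists by Riesz-Fischer as soon as [w] is bounded. *)
Definition blop P w x : H := \sum_(i < N) (\sum_(j < N) P i j * co j x) *: e i +
  mk co (fun m => if (m < N)%N then 0 else w m * co m x).

Lemma blop_spec P w W x : 0 <= W -> (forall m, (N <= m)%N -> cn (w m) <= W) ->
  (forall m, co m (blop P w x) = cblk P w (co^~ x) m) /\
  nr (blop P w x) <= (\sum_i \sum_j cn (P i j) + W) * nr x.
Proof.
move=> W0 wW.
have [|c1 c2] := co_mk B (c := fun m => if (m < N)%N then 0 else w m * co m x) (x := x) W0.
  move=> m; case: ltnP => Nm; first by rewrite cn0 mulr_ge0// cn_ge0.
  by rewrite cnM ler_wpM2r ?cn_ge0 ?wW.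
split; last first.
  rewrite (le_trans (nrD _ _))// mulrDl lerD// (le_trans (nr_sum _ _ _))// mulr_suml.
  apply: ler_sum => i _; rewrite nrZ mulr_suml (@le_trans _ _ (cn (\sum_j P i j * co j x)))//.
    by rewrite ler_piMr ?cn_ge0// (nr_e B).
  rewrite (le_trans (cn_sum _ _ _))//; apply: ler_sum => j _.
  by rewrite cnM ler_wpM2l ?cn_ge0// (co_le B).
apply: cblk_ind => [i|m Nm]; rewrite (coD B) c1 (co_sum B).
  rewrite ltn_ord addr0 cblk_lt (bigD1 i)//= (coZ B) (co_e B) eqxx mulr1 [X in _ + X]big1 ?addr0// => j.
  by rewrite -val_eqE/= (coZ B) (co_e B) eq_sym => /negbTE ->; rewrite mulr0.
rewrite ltnNge Nm cblk_ge//= big1 ?add0r// => j _.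
by rewrite (coZ B) (co_e B) gtn_eqF ?mulr0// (leq_trans (ltn_ord j)).
Qed.

End block_operators.

(** * Spectral projections of a matrix *)

Section spectral_projections.
Context (F : closedFieldType) (n : nat) (M : 'M[F]_n.+1).

Lemma coprimep_prod_seq (I : eqType) (r : seq I) (P : I -> {poly F}) (p : {poly F}) :
  {in r, forall i, coprimep p (P i)} -> coprimep p (\prod_(i <- r) P i).
Proof.
move=> h; rewrite big_seq_cond; apply: (big_ind (coprimep p)).
- exact: coprimep1.
- by move=> x y px py; rewrite coprimepMr px.
- by move=> i /andP[/h].
Qed.

Lemma dvdp_prod_coprime (I : eqType) (r : seq I) (P : I -> {poly F}) (d : {poly F}) :
  uniq r -> {in r &, forall i j, i != j -> coprimep (P i) (P j)} ->
  {in r, forall i, P i %| d} -> \prod_(i <- r) P i %| d.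
Proof.
elim: r => [|a r IH] /=; first by rewrite big_nil dvd1p.
move=> /andP[ar ur] cop dv; rewrite big_cons Gauss_dvdp.
  rewrite dv ?mem_head// IH// => [i j ir jr|i ir].
    by apply: cop; rewrite inE ?ir ?jr orbT.
  by rewrite dv// inE ir orbT.
apply: coprimep_prod_seq => i ir; apply: cop; rewrite ?mem_head// ?inE ?ir ?orbT//.
by apply: contraNneq ar => ->.
Qed.

Lemma dvdp_prod_sub (I : eqType) (r s : seq I) (P : I -> {poly F}) :
  {subset s <= r} -> \prod_(i <- s) P i %| (\prod_(i <- r) P i) ^+ size s.
Proof.
elim: s => [|a s IH] sr; first by rewrite big_nil dvd1p.
rewrite big_cons /= exprS dvdp_mul//; last by apply: IH => x xs; rewrite sr// inE xs orbT.
by rewrite (big_rem a)/= ?dvdp_mulIl// sr// mem_head.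
Qed.

(** All matrices here are polynomials in [M], so they commute. Bezout coefficients for the coprime
    factors of a polynomial killed by [M] give the projections on generalized eigenspaces, and
    Bezout again gives the inverse of [z - M] on each of them. *)
Lemma spectral_projections : exists (r : seq F) (pi : F -> 'M[F]_n.+1),
  [/\ uniq r, \sum_(a <- r) pi a = 1,
      {in r &, forall a b, a != b -> pi a * pi b = 0},
      forall a, M * pi a = pi a * M
    & forall z, {in r, forall a, z != a -> exists S : 'M[F]_n.+1,
        [/\ (z%:M - M) * S * pi a = pi a, S * M = M * S
          & forall b, S * pi b = pi b * S]}].
Proof.
have [s sE] := closed_field_poly_normal (char_poly M).
rewrite (monicP (char_poly_monic M)) scale1r in sE.
(* The exponent [k] exceeds every multiplicity, so one exponent serves all eigenvalues and [Q] is a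
   multiple of the characteristic polynomial. *)
pose r := undup s; pose k := (size s).+1.
pose P a := ('X - a%:P : {poly F}) ^+ k.
pose Q := \prod_(a <- r) P a.
have ur : uniq r by exact: undup_uniq.
have sQ : char_poly M %| Q.
  rewrite /Q prodrXl sE.
  have sub : {subset s <= r} by move=> x; rewrite mem_undup.
  apply: (@dvdp_trans _ ((\prod_(a <- r) ('X - a%:P)) ^+ size s)); last first.
    by rewrite dvdp_exp2l.
  exact: dvdp_prod_sub.
have QM : horner_mx M Q = 0.
  by move: sQ => /dvdpP[q ->]; rewrite rmorphM /= Cayley_Hamilton mulr0.
have copP a b : a != b -> coprimep (P a) (P b).
  by move=> ab; apply/coprimep_expl/coprimep_expr/coprimep_XsubC2; rewrite subr_eq0 eq_sym.
pose Qc a := \prod_(b <- rem a r) P b.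
have QcE a : a \in r -> Q = P a * Qc a by move=> ar; rewrite /Q (big_rem a).
have remN a b : a \in r -> b \in rem a r -> b != a /\ b \in r.
  by move=> ar; rewrite (rem_filter _ ur) mem_filter => /andP[].
have PQc a b : a \in r -> b \in r -> a != b -> P b %| Qc a.
  move=> ar br ab; rewrite /Qc (big_rem b)/= ?dvdp_mulIl//.
  by rewrite (rem_filter _ ur) mem_filter br andbT /= eq_sym.
have bez a : exists v, a \in r -> exists u, u * P a + v * Qc a = 1.
  case: (boolP (a \in r)) => ar; last by exists 0.
  have : coprimep (P a) (Qc a).
    apply: coprimep_prod_seq => b /(remN _ _ ar)[ba _].
    by apply: copP; rewrite eq_sym.
  by move=> /Bezout_eq1_coprimepP[[u v] /= uv]; exists v => _; exists u.
have [v vP] := choice bez.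
pose p a := v a * Qc a.
have commX (x y : {poly F}) : horner_mx M x * horner_mx M y = horner_mx M y * horner_mx M x.
  by rewrite -!rmorphM mulrC.
have MX : M = horner_mx M 'X by rewrite horner_mx_X.
exists r, (fun a => horner_mx M (p a)); split => //.
- rewrite -rmorph_sum /=; apply/eqP; rewrite eq_sym -subr_eq0 -(rmorph1 (horner_mx M)) -rmorphB.
  (* Checked modulo each [P b]: there [p b] is congruent to 1 and the other [p a] to 0. *)
  suff /dvdpP[q ->] : Q %| 1 - \sum_(a <- r) p a by rewrite rmorphM /= QM mulr0.
  apply: dvdp_prod_coprime => // [i j _ _|b br]; first exact: copP.
  rewrite (big_rem b)//= opprD addrA; apply: dvdp_sub; last first.
    rewrite big_seq; apply: (big_ind (dvdp (P b))) => [|x y|a abr].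
    + exact: dvdp0.
    + exact: dvdp_add.
    + apply: dvdp_mull; have [ab ar] := remN _ _ br abr.
      exact: PQc.
  have [u uv] := vP b br; rewrite -uv /p addrK; exact: dvdp_mull.
- move=> a b ar br ab; rewrite -rmorphM /=.
  have /dvdpP[q ->] : Q %| p a * p b; last by rewrite rmorphM /= QM mulr0.
  by rewrite (QcE b br) dvdp_mul ?dvdp_mulIr// dvdp_mull// PQc.
- by move=> a; have := commX 'X (p a); rewrite horner_mx_X.
- move=> z a ar za.
  (* From [u * ('X - z) + w * P a = 1]: the second summand times [p a] is a multiple of [Q], so
     [- u] evaluated at [M] inverts [z - M] on the range of the projection. *)
  have : coprimep ('X - z%:P) (P a).
    by apply/coprimep_expr/coprimep_XsubC2; rewrite subr_eq0 eq_sym.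
  move=> /Bezout_eq1_coprimepP[[u w] /= uw].
  exists (horner_mx M (- u)); split.
  + rewrite -(horner_mx_C M) [X in (_ - X) * _ * _]MX -rmorphB -!rmorphM /=.
    have -> : (z%:P - 'X) * - u * p a = p a - w * v a * Q.
      rewrite (QcE a ar) -[p a in RHS]mul1r -uw /p; ring.
    by rewrite rmorphB (rmorphM _ (w * v a)) /= QM mulr0 subr0.
  + by have := commX (- u) 'X; rewrite horner_mx_X.
  + by move=> b; exact: commX.
Qed.

End spectral_projections.

(** * The spectral measure *)

Lemma cancel_image (V : zmodType) (p t J J' q : V) :
  p + (t - J' - J) + q - (p + q - (J + J')) = t.
Proof.
have -> : t - J' - J = t - (J + J') by rewrite opprD addrAC addrA.
move: (J + J') => s; rewrite opprB [p + _ + q]addrAC [p + q + _]addrC.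
by rewrite [s - _]addrC addrA addrK subrK.
Qed.

Section similar_operator.
Context (R : realType) (H : normedModType R[i]).
Local Notation C := R[i].
Context (e : nat -> H) (co : nat -> H -> C) (B : onb e co).
Context (lam : nat -> R) (b : nat -> H) (Cb : R) (kappa : R).
Hypothesis bC : forall n, nr (b n) <= Cb.
Hypothesis Cb1 : 1 <= Cb.
Hypothesis kappa0 : 0 < kappa.
Hypothesis lam_ge : forall n, kappa * n.+1%:R ^+ 2 <= lam n.
Variable N' : nat.
Local Notation N := N'.+1.
Variables (gam : nat -> nat -> R) (delta : R).
Hypothesis delta0 : 0 <= delta.
Hypothesis delta_Cb : 20 * (delta * Cb) <= 1.
Hypothesis gam_le : forall m n, `|gam m n| <= delta * (m.+1%:R^-1 * n.+1%:R^-1).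
Hypothesis gamE : forall m n, (lam m - lam n) * gam m n = (~~ in_block N m n)%:R.
Variable X : nat -> H.
Hypothesis XK : forall n, nr (X n) <= 2 * Cb.
Hypothesis XE : forall n, X n = sim_step co b N gam X n.

Local Notation T := (pert_op co lam b).
Local Notation g := (GX co gam X).
Local Notation U := (simU co g).
Local Notation V := (simV co g).

Let Cb0 : 0 <= Cb. Proof. by rewrite (le_trans ler01). Qed.

Let lam_gt0 n : 0 < lam n.
Proof. by rewrite (lt_le_trans _ (lam_ge n))// mulr_gt0// exprn_gt0. Qed.

Lemma g_small v : summable co v g (nr v / 2).
Proof.
move=> n; rewrite (le_trans (summable_GX B delta0 gam_le v _ XK n)) ?mulr_ge0//.
rewrite [leRHS]mulrC ler_wpM2r ?nr_ge0//. have := delta_Cb; lra.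
Qed.

Let U_lin := simU_lin B g_small.
Let UB := simUB B g_small.
Let UZ := simUZ B g_small.
Let UV := simUV B g_small.
Let VU := simVU B g_small.
Let coGam := co_Gam B delta0 gam_le.
Let coJ := @co_Jbl _ _ _ _ B N.

Definition col_image n : H := (lam n)%:C *: e n - Jbl co N n (X n).

(** This is [(A - Q) (1 + G X) = (1 + G X) (A - J X)] on [e n]. The commutator identity [gamE] gives
    the diagonal part, and the fixed point equation [XE] identifies the rest with
    [Q (1 + G X) e n]. *)
Lemma pert_op_basis n : T (U (e n), U (col_image n)).
Proof.
exists ((lam n)%:C *: e n + (X n - Jbl co N n (X n)) + (lam n)%:C *: g n); split => /=.
  move=> m; rewrite /simU (lc_e B) !(coD B) (coN B) !(coZ B) coJ /GX coGam (co_e B).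
  set x := co m (X n).
  have -> : x - (in_block N m n)%:R * x = (lam m - lam n)%:C * (gam m n)%:C * x.
    rewrite -rmorphM gamE /= rmorph_nat; case: in_block => /=.
      by rewrite mul1r subrr mul0r.
    by rewrite mul0r subr0 mul1r.
  rewrite rmorphB /=; by case: eqVneq => [->|_]; rewrite ?mulr1n ?mulr0n ?mulr1 ?mulr0; ring.
have sg := summable_Gam_b B bC Cb1 delta0 gam_le n (X n).
have [sgc _] := lcP B sg.
have -> : (lam n)%:C *: e n + (X n - Jbl co N n (X n)) + (lam n)%:C *: g n - U (col_image n)
  = b n + lc co (g n) b.
  rewrite /col_image UB UZ.
  have -> : U (Jbl co N n (X n)) = Jbl co N n (X n) + lc co (Jbl co N n (X n)) g by [].
  have -> : U (e n) = e n + g n by rewrite /simU (lc_e B).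
  rewrite {1}XE /sim_step -/(GX co gam X n).
  by rewrite scalerDr cancel_image.
rewrite /simU (lc_e B).
rewrite [X in hcvg X _](_ : _ = fun k => (\sum_(i < k) co i (e n) *: b i) + \sum_(i < k) co i (g n) *: b i).
  apply: hcvgD; last exact: sgc.
  have := lc_e B n b; have [|h _] := @lcP _ _ _ _ B (e n) b Cb.
    move=> k; rewrite (le_trans (summable_b bC Cb1 (M := 1) _ k)) ?mulr1// => {}k.
    case: (ltnP n k) => nk.
      rewrite (bigD1 (Ordinal nk))//= (co_e B) eqxx cn1 big1 ?addr0// => i.
      by rewrite -val_eqE/= (co_e B) => /negbTE ->; rewrite cn0.
    rewrite big1// => i _; rewrite (co_e B) ltn_eqF ?cn0//.
    exact: leq_trans (ltn_ord i) nk.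
  by move=> <-.
apply/funext => k; rewrite -big_split; apply: eq_bigr => i _.
by rewrite (coD B) scalerDl.
Qed.

Definition bmx : 'M[C]_N := \matrix_(i, j) ((lam i)%:C * (i == j)%:R - co i (X j)).
Definition mu m : C := (lam m)%:C - co m (X m).

(** The graph of [A - J X] on its maximal domain: square summability of the image coordinates is
    implicit in the existence of [w]. *)
Definition T0 v w := forall m, co m w = cblk bmx mu (co^~ v) m.

Let eps : R := (2 * Cb)^-1.
Let eps0 : 0 < eps.
Proof. by rewrite invr_gt0 mulr_gt0// (lt_le_trans _ Cb1). Qed.
Let epsC : eps * Cb <= 1 / 2.
Proof. by rewrite /eps invfM -mulrA mulVf ?mulr1 ?mul1r// gt_eqF// (lt_le_trans _ Cb1). Qed.

Lemma pert_op_closed_seq (u_ f_ : nat -> H) u f : (forall j, T (u_ j, f_ j)) ->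
  hcvg u_ u -> hcvg f_ f -> T (u, f).
Proof. exact: (pert_op_seq_closed B bC Cb1 kappa0 lam_ge eps0 epsC (lexx _)). Qed.

(** The basis vectors give the claim for finite expansions, and closedness of [T] extends it to all
    of [T0]. *)
Lemma T0_pert_op v w : T0 v w -> T (U v, U w).
Proof.
move=> vw.
have TK K : T (U (\sum_(i < K) co i v *: e i), U (\sum_(i < K) co i v *: col_image i)).
  elim: K => [|K IH].
    by rewrite !big_ord0 (simU0 B g_small); exact: (pert_op0 B).
  rewrite !big_ord_recr /= ![_ + _ *: _]addrC !(U_lin (co K v)).
  have := pert_op_lin B (co K v) (pert_op_basis K) IH. by [].
apply: (pert_op_closed_seq TK).
  by apply: (simU_cvg B g_small); exact: (trunc_cvg B).
apply: (simU_cvg B g_small).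
apply: (@hcvg_near _ _ _ _ (fun K => nr (w - \sum_(i < K) co i w *: e i))); last exact: (trunc_cvg B).
(* Once [K] is at least the block size, truncation commutes with the block operator, so the image of
   the truncated [v] is the truncated [w]. *)
near=> K; have NK : (N <= K)%N by near: K; exact: nbhs_infty_ge.
rewrite le_eqVlt; apply/orP; left; apply/eqP; congr (nr (_ - _)).
apply: (co_inj B) => m; rewrite (co_trunc B) (co_sum B).
have colE i : co m (col_image i) = (lam i)%:C * (m == i)%:R - (in_block N m i)%:R * co m (X i).
  by rewrite /col_image (coB B) (coZ B) (co_e B) coJ.
under eq_bigr do rewrite (coZ B) colE.
case: ltnP => mK; last first.
  rewrite big1// => i _.
  have mi : (m == i) = false by rewrite gtn_eqF// (leq_trans (ltn_ord i)).
  by rewrite /in_block mi ltnNge (leq_trans NK mK) /= !(mulr0, mul0r, subrr).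
rewrite vw; case: (ltnP m N) => mN.
  rewrite -[m]/(nat_of_ord (Ordinal mN)) cblk_lt.
  rewrite -(subnKC NK) big_split_ord /= [X in _ + X]big1 ?addr0; last first.
    move=> i _; have mi : (m == N + i)%N = false by rewrite ltn_eqF// ltn_addr.
    have Ni : (N + i < N)%N = false by rewrite ltnNge leq_addr.
    by rewrite /in_block mi Ni andbF !(mulr0, mul0r, subrr).
  apply: eq_bigr => i _; rewrite !mxE /= /in_block mN ltn_ord orbT mul1r mulrC.
  by congr (_ * _); rewrite -val_eqE /=; congr (_ - _); case: eqVneq => [->//|]; rewrite !mulr0.
rewrite cblk_ge// (bigD1 (Ordinal mK))//= eqxx big1 ?addr0 => [|i].
  by rewrite /in_block eqxx mul1r mulr1 mulrC.
rewrite -val_eqE /= eq_sym => /negbTE mi.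
by rewrite /in_block mi ltnNge mN /= !(mulr0, mul0r, subrr).
Unshelve. all: by end_near. Qed.


Lemma mu_le m : cn (mu m - (lam m)%:C) <= 2 * Cb.
Proof. by rewrite /mu addrAC subrr add0r cnN (le_trans (co_le B _ _)). Qed.

(** Among [size (char_poly bmx)] distinct candidates, one more than the degree, some [- (s0 + j)] is
    not an eigenvalue. *)
Lemma bmx_shift_unit (s0 : R) : exists2 s, s0 <= s & s%:C%:M + bmx \in unitmx.
Proof.
pose sz := size (char_poly bmx).
pose rs := [seq - (s0 + j%:R)%:C : C | j <- iota 0 sz].
have [/allP rall|/allPn[x xrs xr]] := boolP (all (root (char_poly bmx)) rs).
  have urs : uniq rs.
    rewrite map_inj_uniq ?iota_uniq// => i j /oppr_inj/complexI/addrI/eqP.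
    by rewrite eqr_nat => /eqP.
  have := max_poly_roots (monic_neq0 (char_poly_monic bmx)) (introT allP rall) urs.
  by rewrite size_map size_iota ltnn.
move: xrs xr => /mapP[j _ ->] xr; exists (s0 + j%:R); first by rewrite lerDl.
move: xr; rewrite -eigenvalue_root_char /eigenvalue negbK /eigenspace kermx_eq0 row_free_unit.
by rewrite rmorphN /= opprK addrC.
Qed.

(** The block of the shifted operator is invertible by [bmx_shift_unit]; on the tail [lam m > 0] and
    [|mu m - lam m| <= 2 * Cb], so a shift beyond [2 * Cb + 1] keeps every diagonal entry at modulus
    at least 1. *)
Lemma T0_shift_surj : exists2 s : R, (kappa * eps ^+ 2)^-1 <= s &
  forall y, exists v, T0 v (y - s%:C *: v).
Proof.
have [s s_ge su] := bmx_shift_unit ((kappa * eps ^+ 2)^-1 + 2 * Cb + 1).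
have k0 : 0 < (kappa * eps ^+ 2)^-1 by rewrite invr_gt0 mulr_gt0 ?exprn_gt0.
exists s; first by rewrite (le_trans _ s_ge)// -addrA lerDl addr_ge0// mulr_ge0.
move=> y.
have ms m : 1 <= cn (mu m + s%:C).
  have h := cnD (mu m + s%:C) (- (mu m - (lam m)%:C)).
  have e1 : mu m + s%:C - (mu m - (lam m)%:C) = (lam m + s)%:C.
    by rewrite rmorphD /=; ring.
  have s0 : 0 < s by rewrite (lt_le_trans _ s_ge)// ltr_wpDl// addr_ge0 ?(ltW k0)// mulr_ge0.
  move: h; rewrite e1 cn_real cnN ger0_norm; last by rewrite addr_ge0 ?(ltW (lam_gt0 _))// ltW.
  have := mu_le m; have := lam_gt0 m; lra.
pose w m := (mu m + s%:C)^-1.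
have w1 m : (N <= m)%N -> cn (w m) <= 1.
  by move=> _; rewrite /w cnV invf_le1// (lt_le_trans _ (ms m)).
have [cv _] := blop_spec B (invmx (s%:C%:M + bmx)) y ler01 w1.
set v := blop _ _ _ _ _ in cv; exists v => m.
rewrite (coB B) (coZ B); apply/eqP; rewrite subr_eq; apply/eqP.
transitivity (cblk (s%:C%:M + bmx) (fun m => s%:C + mu m) (co^~ v) m); last first.
  by rewrite cblkD addrC (@cblk_scalar _ _ s%:C).
rewrite (cblk_eq _ cv (fun _ _ => erefl)) cblkM mulmxV//.
rewrite cblk_scalar ?mul1r// => k _.
by rewrite /w addrC mulfV//; apply: contraTneq (ms k) => ->; rewrite cn0 -ltNge ltr01.
Qed.

(** [T] extends the transported [T0]. For a suitable real [s] the shifted [T0] is onto while the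
    shifted [T] is injective, which leaves no room for a proper extension. *)
Lemma pert_opP u f : T (u, f) <-> T0 (V u) (V f).
Proof.
split=> [Tuf|/T0_pert_op]; last by rewrite !UV.
have [s s_ge surj] := T0_shift_surj.
have [v vP] := surj (V (f + s%:C *: u)).
have Tv := T0_pert_op vP.
rewrite UB UZ UV in Tv.
have := pert_op_lin B (-1) Tv Tuf.
have -> : -1 *: (U v, f + s%:C *: u - s%:C *: U v) + (u, f) =
    (u - U v, - (s%:C *: (u - U v))) :> H * H.
  congr pair; first by rewrite scaleN1r addrC.
  rewrite scalerBr scaleN1r; move: (s%:C *: u) (s%:C *: U v) => x z.
  by rewrite /= !opprB opprD [- f - x]addrC addrA subrK.
move=> /(pert_op_inj B bC Cb1 kappa0 lam_ge eps0 epsC s_ge)/eqP.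
rewrite subr_eq0 => /eqP uE.
have fE : f = U (V (f + s%:C *: u) - s%:C *: v).
  rewrite UB UZ UV -uE addrK//.
by rewrite uE VU fE VU.
Qed.


(** * Spectral projections and resolvents of the block operator *)

Section functional_calculus.
Variables (r : seq C) (pi : C -> 'M[C]_N).
Hypothesis pi1 : \sum_(a <- r) pi a = 1.
Hypothesis pi_orth : {in r &, forall a b, a != b -> pi a * pi b = 0}.
Hypothesis r_uniq : uniq r.
Hypothesis pi_comm : forall a, bmx * pi a = pi a * bmx.
Hypothesis pi_res : forall z, {in r, forall a, z != a -> exists S : 'M[C]_N,
  [/\ (z%:M - bmx) * S * pi a = pi a, S * bmx = bmx * S
    & forall b, S * pi b = pi b * S]}.
Implicit Types A D : set C.

Definition ind A (z : C) : C := (z \in A)%:R.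

Lemma indI A D z : ind (A `&` D) z = ind A z * ind D z.
Proof. by rewrite /ind in_setI -natrM mulnb. Qed.

Lemma indC A z : ind (~` A) z = 1 - ind A z.
Proof. by rewrite /ind in_setC; case: (z \in A); rewrite ?subrr ?subr0. Qed.

Lemma ind_le A z : cn (ind A z) <= 1.
Proof. by rewrite /ind cn_nat lern1 leq_b1. Qed.

Lemma indM A z : ind A z * ind A z = ind A z.
Proof. by rewrite -indI setIid. Qed.

Definition pmx A : 'M[C]_N := \sum_(a <- r) ind A a *: pi a.

Lemma pi_idem a : a \in r -> pi a * pi a = pi a.
Proof.
move=> ar; rewrite -[RHS]mulr1 -pi1 mulr_sumr (big_rem a)//= big_seq big1 ?addr0// => i.
rewrite (rem_filter _ r_uniq) mem_filter => /andP[/= ia ir].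
by rewrite pi_orth// eq_sym.
Qed.

Lemma pmxM_pi A a : a \in r -> pmx A * pi a = ind A a *: pi a.
Proof.
move=> ar; rewrite /pmx mulr_suml (big_rem a)//= -scalerAl pi_idem//.
rewrite big_seq big1 ?addr0// => i.
rewrite (rem_filter _ r_uniq) mem_filter => /andP[/= ia ir].
by rewrite -scalerAl pi_orth// scaler0.
Qed.

Lemma pmxI A D : pmx (A `&` D) = pmx A * pmx D.
Proof.
rewrite {3}/pmx mulr_sumr; apply: eq_big_seq => a ar.
by rewrite -scalerAr pmxM_pi// scalerA mulrC indI.
Qed.

Lemma pmxC A : pmx (~` A) = 1 - pmx A.
Proof.
rewrite -pi1 /pmx -sumrB; apply: eq_bigr => a _.
by rewrite indC scalerBl scale1r.
Qed.

Lemma pmx_comm A : bmx * pmx A = pmx A * bmx.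
Proof.
rewrite /pmx mulr_sumr mulr_suml; apply: eq_bigr => a _.
by rewrite -scalerAl -scalerAr pi_comm.
Qed.

Let Kp : R := \sum_i \sum_j \sum_(a <- r) cn (pi a i j).

Lemma pmx_le A : \sum_i \sum_j cn (pmx A i j) <= Kp.
Proof.
apply: ler_sum => i _; apply: ler_sum => j _.
rewrite /pmx summxE (le_trans (cn_sum _ _ _))//; apply: ler_sum => a _.
by rewrite mxE cnM ler_piMl ?cn_ge0 ?ind_le.
Qed.

(** Its bound in [pop_spec] does not depend on [A]: the block involves finitely many [pi a], and
    indicators have modulus at most 1. *)
Definition pop A x := blop e co (pmx A) (fun m => ind A (mu m)) x.

Lemma pop_spec A x : (forall m, co m (pop A x) = cblk (pmx A) (fun m => ind A (mu m)) (co^~ x) m)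
  /\ nr (pop A x) <= (Kp + 1) * nr x.
Proof.
have w1 m : (N <= m)%N -> cn (ind A (mu m)) <= 1 by move=> _; exact: ind_le.
have [h1 h2] := blop_spec B (pmx A) x ler01 w1.
split => //; rewrite (le_trans h2)// ler_wpM2r ?nr_ge0// lerD2r.
exact: pmx_le.
Qed.

Lemma co_pop A x m : co m (pop A x) = cblk (pmx A) (fun m => ind A (mu m)) (co^~ x) m.
Proof. by case: (pop_spec A x). Qed.

Lemma pop_lin A a x y : pop A (a *: x + y) = a *: pop A x + pop A y.
Proof.
apply: (co_inj B) => m; rewrite (co_lin B) !co_pop -cblk_lin.
by apply: cblk_eq => // i; rewrite (co_lin B).
Qed.

Lemma popI A D x : pop (A `&` D) x = pop A (pop D x).
Proof.
apply: (co_inj B) => m; rewrite !co_pop (cblk_eq _ (co_pop D x) (fun _ _ => erefl)) cblkM.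
by rewrite pmxI; apply: cblk_eq => // i _; rewrite indI.
Qed.

Lemma popC A x : pop (~` A) x = x - pop A x.
Proof.
apply: (co_inj B) => m; rewrite (coB B) !co_pop pmxC.
transitivity (cblk (1 - pmx A) (fun m => 1 - ind A (mu m)) (co^~ x) m).
  by apply: cblk_eq => // i _; rewrite indC.
by rewrite cblkD cblkN (cblk_scalar (a := 1))// mul1r.
Qed.

Lemma pop0 x : pop set0 x = 0.
Proof.
apply: (co_inj B) => m; rewrite co_pop (co0 B) /pmx big1 => [|a _]; last first.
  by rewrite /ind in_set0 scale0r.
rewrite cblk0// => i _.
by rewrite /ind in_set0.
Qed.

Lemma popT x : pop setT x = x.
Proof. by have := popC set0 x; rewrite pop0 setC0 subr0. Qed.

Section sigma.
Variable F : nat -> set C.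
Hypothesis tF : trivIset setT F.

Let D := \bigcup_n F n.

Let indD m (z : C) := ind D z - \sum_(n < m) ind (F n) z.

Lemma ind_sum k m z : z \in F k -> \sum_(n < m) ind (F n) z = (k < m)%:R.
Proof.
move=> zk; have zn n : n != k -> ind (F n) z = 0.
  move=> nk; rewrite /ind; case: (boolP (z \in F n)) => // zn; exfalso.
  move/eqP: nk; apply; apply: (tF I I); exists z; split; exact: set_mem.
case: ltnP => km.
  rewrite (bigD1 (Ordinal km))//= /ind zk big1 ?addr0// => i.
  by rewrite -val_eqE /= => /zn.
by rewrite big1// => i _; apply: zn; rewrite ltn_eqF// (leq_trans (ltn_ord i)).
Qed.

Lemma ind_bigcup z : (forall m, cn (indD m z) <= 1) /\
  exists m0, forall m, (m0 <= m)%N -> indD m z = 0.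
Proof.
rewrite /indD; case: (boolP (z \in D)) => zD.
  have [k _ zk] := set_mem zD; have zk' : z \in F k by exact: mem_set.
  split=> [m|].
    by rewrite (ind_sum m zk') /ind zD; case: ltnP; rewrite ?subrr ?subr0 ?cn0 ?cn1.
  exists k.+1 => m km; by rewrite (ind_sum m zk') /ind zD km subrr.
have h m : ind D z - \sum_(n < m) ind (F n) z = 0.
  rewrite /ind (negbTE zD) big1 ?subr0// => n _.
  case: (boolP (z \in F n)) => // zn; case/negP: zD; apply/mem_set.
  by exists n => //; exact: set_mem.
by split=> [m|]; [rewrite h cn0|exists 0].
Qed.

Lemma ind_bigcup_seq (s : seq C) : exists m0, forall m, (m0 <= m)%N ->
  {in s, forall z, indD m z = 0}.
Proof.
elim: s => [|z s [m0 h0]]; first by exists 0.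
have [_ [m1 h1]] := ind_bigcup z; exists (maxn m0 m1) => m.
rewrite geq_max => /andP[hm0 hm1] y; rewrite inE => /orP[/eqP->|]; first exact: h1.
exact: h0.
Qed.

(** There is no convergence in operator norm. On the block and on finitely many further coordinates
    the partial sums are eventually exact; on the remaining coordinates the error is dominated by a
    tail of the expansion of [x]. *)
Lemma pop_sigma x : hcvg (fun m => \sum_(n < m) pop (F n) x) (pop D x).
Proof.
have co_sum_pop m i : co i (\sum_(n < m) pop (F n) x) =
    cblk (\sum_(n < m) pmx (F n)) (fun k => \sum_(n < m) ind (F n) (mu k)) (co^~ x) i.
  elim: m => [|m IH].
    rewrite !big_ord0 (co0 B) cblk0// => j _.
    by rewrite big_ord0.
  rewrite !big_ord_recr /= (coD B) IH co_pop -cblkD.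
  by apply: cblk_eq => // j _; rewrite big_ord_recr.
apply/cvgrPdist_lt => d d0.
have /cvgrPdist_lt/(_ _ d0)[K0 _ tx] := trunc_cvg B x.
pose K := maxn N K0.
have xK : nr (x - \sum_(i < K) co i x *: e i) < d.
  have := tx K (leq_maxr _ _).
  by rewrite sub0r normrN ger0_norm ?nr_ge0.
(* The finitely many points at which the indicator sums must be exact: the eigenvalues of the block
   and the first [K] diagonal entries. *)
have [m0 hm0] := ind_bigcup_seq (r ++ [seq mu i | i <- iota 0 K]).
exists m0 => // m /= m0m.
rewrite sub0r normrN ger0_norm ?nr_ge0// (le_lt_trans _ xK)//.
apply: (parseval B); first exact: nr_ge0.
move=> n; apply: le_trans (bessel B n _); apply: ler_sum => i _.
rewrite ler_sqr ?nnegrE ?cn_ge0// !(coB B) co_sum_pop co_pop (co_trunc B) -cblkN -cblkD.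
have -> : pmx D - \sum_(n0 < m) pmx (F n0) = 0.
  rewrite /pmx exchange_big -sumrB /= big_seq big1// => a ar.
  rewrite -scaler_suml -scalerBl.
  by have := hm0 _ m0m a; rewrite /indD mem_cat ar => ->//; rewrite scale0r.
case: (ltnP i K) => iK.
  rewrite (_ : cblk _ _ _ _ = 0) ?cn0 ?cn_ge0//.
  case: (ltnP i N) => iN.
    by rewrite -[nat_of_ord i]/(nat_of_ord (Ordinal iN)) cblk_lt big1// => j _; rewrite mxE mul0r.
  rewrite cblk_ge//; have := hm0 _ m0m (mu i); rewrite /indD mem_cat map_f ?orbT ?mem_iota//.
  by move=> ->//; rewrite mul0r.
rewrite cblk_ge ?subr0; last by rewrite (leq_trans _ iK)// leq_maxl.
by rewrite cnM ler_piMl ?cn_ge0//; case: (ind_bigcup (mu i)) => h _; exact: h.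
Qed.

End sigma.

Lemma pop_dom A M0 x : (forall z, A z -> cn z <= M0) -> exists w, T0 (pop A x) w.
Proof.
move=> AM.
(* The absolute value is taken because [M0] may be negative when [A] is empty. *)
have w1 m : (N <= m)%N -> cn (mu m * ind A (mu m)) <= `|M0|.
  move=> _; rewrite /ind; case: (boolP (mu m \in A)) => h.
    by rewrite mulr1 (le_trans (AM _ (set_mem h)))// ler_norm.
  by rewrite mulr0 cn0.
have [h1 _] := blop_spec B (bmx * pmx A) x (normr_ge0 M0) w1.
exists (blop e co (bmx * pmx A) (fun m => mu m * ind A (mu m)) x) => m.
by rewrite h1 (cblk_eq _ (co_pop A x) (fun _ _ => erefl)) cblkM.
Qed.

Lemma pop_T0 A v w : T0 v w -> T0 (pop A v) (pop A w).
Proof.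
move=> vw m; rewrite co_pop (cblk_eq _ vw (fun _ _ => erefl)).
rewrite (cblk_eq _ (co_pop A v) (fun _ _ => erefl)) !cblkM.
rewrite -[_ *m bmx]/(pmx A * bmx) -pmx_comm.
by apply: cblk_eq => // i _; rewrite mulrC.
Qed.

(** The inverses on the generalized eigenspaces for eigenvalues in [A] are added up, with zero on
    the others; [z] may therefore be an eigenvalue outside [A]. *)
Lemma resolvent_mx A z : (forall a, A a -> z != a) -> exists S : 'M[C]_N,
  [/\ (z%:M - bmx) * S = pmx A, S * bmx = bmx * S & pmx A * S = S].
Proof.
move=> zA.
have /choice[S SP] : forall a, exists S : 'M[C]_N, a \in r -> A a ->
    [/\ (z%:M - bmx) * S * pi a = pi a, S * bmx = bmx * S
      & forall b, S * pi b = pi b * S].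
  move=> a; case: (boolP (a \in r)) => ar; last by exists 0.
  case: (boolP (a \in A)) => aA; last by exists 0 => _ /mem_set; rewrite (negbTE aA).
  by have [S h] := pi_res ar (zA _ (set_mem aA)); exists S.
exists (\sum_(a <- r) ind A a *: (S a * pi a)).
have indP a : ind A a = 0 \/ A a.
  by rewrite /ind; case: (boolP (a \in A)) => aA; [right; exact: set_mem|left].
split.
- rewrite mulr_sumr; apply: eq_big_seq => a ar; rewrite -scalerAr mulrA.
  case: (indP a) => [->|/(SP a ar)[-> _ _]//].
  by rewrite !scale0r.
- rewrite mulr_suml mulr_sumr; apply: eq_big_seq => a ar.
  rewrite -scalerAr -scalerAl; case: (indP a) => [->|/(SP a ar)[_ h _]].
    by rewrite !scale0r.
  by rewrite -mulrA -pi_comm mulrA h mulrA.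
- rewrite mulr_sumr; apply: eq_big_seq => a ar.
  rewrite -scalerAr; case: (indP a) => [->|/(SP a ar)[_ _ h]].
    by rewrite !scale0r.
  have -> : pmx A * (S a * pi a) = S a * (pmx A * pi a).
    rewrite !mulrA; congr (_ * _); rewrite /pmx mulr_suml mulr_sumr.
    by apply: eq_bigr => c _; rewrite -scalerAl -scalerAr h.
  by rewrite pmxM_pi// -scalerAr scalerA indM.
Qed.

(** A positive distance, and not just [z] outside [A], bounds the infinitely many diagonal entries
    [1 / (z - mu m)] uniformly. *)
Lemma pop_resolvent A z d : 0 < d -> (forall a, A a -> d <= cn (z - a)) ->
  exists S : H -> H,
  [/\ exists M, forall y, nr (S y) <= M * nr y,
      forall v, pop A v = v -> pop A (S v) = S v /\ T0 (S v) (z *: S v - v)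
    & forall v w, pop A v = v -> T0 v w -> S (z *: v - w) = v].
Proof.
move=> d0 dA.
have zA a : A a -> z != a.
  move=> /dA; apply: contraTneq => <-.
  by rewrite subrr cn0 -ltNge.
have [Sz [S1 S2 S3]] := resolvent_mx zA.
(* For [mu m] outside [A] the numerator vanishes, so a zero denominator does no harm. *)
pose rho m := ind A (mu m) / (z - mu m).
have rhoE m : (z - mu m) * rho m = ind A (mu m).
  rewrite /rho /ind; case: (boolP (mu m \in A)) => h; last by rewrite mul0r mulr0.
  by rewrite mul1r mulfV// subr_eq0 zA//; exact: set_mem.
have rho_le m : (N <= m)%N -> cn (rho m) <= d^-1.
  move=> _; rewrite /rho /ind; case: (boolP (mu m \in A)) => h; last first.
    by rewrite mul0r cn0 invr_ge0 ltW.
  have dm := dA _ (set_mem h).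
  by rewrite mul1r cnV lef_pV2 ?posrE// (lt_le_trans d0).
have d0' : 0 <= d^-1 by rewrite invr_ge0 ltW.
pose S y := blop e co Sz rho y.
have coS y m : co m (S y) = cblk Sz rho (co^~ y) m.
  by case: (blop_spec B Sz y d0' rho_le).
have pE v m : pop A v = v -> co m v = cblk (pmx A) (fun m => ind A (mu m)) (co^~ v) m.
  by move=> pv; rewrite -{1}pv co_pop.
exists S; split.
- exists (\sum_i \sum_j cn (Sz i j) + d^-1) => y.
  by case: (blop_spec B Sz y d0' rho_le).
- move=> v pv; split.
    apply: (co_inj B) => m; rewrite co_pop (cblk_eq _ (coS v) (fun _ _ => erefl)) cblkM coS.
    by rewrite -[_ *m Sz]/(pmx A * Sz) S3; apply: cblk_eq => // i _; rewrite /rho mulrA indM.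
  move=> m; rewrite (coB B) (coZ B) coS (pE _ m pv) (cblk_eq _ (coS v) (fun _ _ => erefl)) cblkM.
  have -> : z * cblk Sz rho (co^~ v) m = cblk (z%:M *m Sz) (fun m => z * rho m) (co^~ v) m.
    by rewrite -cblkM cblk_scalar.
  rewrite -cblkN -cblkD.
  have -> : z%:M *m Sz - pmx A = bmx *m Sz.
    by rewrite -S1 mulrBl opprB addrC subrK.
  by apply: cblk_eq => // i _; rewrite -rhoE mulrBl opprB addrC subrK.
- move=> v w pv vw; apply: (co_inj B) => m; rewrite coS [RHS](pE _ m pv).
  have cw i : co i (z *: v - w) = cblk (z%:M - bmx) (fun k => z - mu k) (co^~ v) i.
    by rewrite (coB B) (coZ B) vw cblkD cblkN (cblk_scalar (a := z)).
  rewrite (cblk_eq _ cw (fun _ _ => erefl)) cblkM.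
  have -> : Sz *m (z%:M - bmx) = pmx A.
    rewrite -S1 -[LHS]/(Sz * (z%:M - bmx)) mulrBr mulrBl S2; congr (_ - _).
    by rewrite -[LHS]/(Sz *m z%:M) -[RHS]/(z%:M *m Sz) scalar_mxC.
  by apply: cblk_eq => // i _; rewrite mulrC rhoE.
Qed.

End functional_calculus.

End similar_operator.

(** * Spectral operators by perturbation *)

Section sequential.
Context (R : realType) (H : normedModType R[i]).
Local Notation C := R[i].

Lemma seq_closed (S : set (H * H)) :
  (forall (u_ f_ : nat -> H) u f, (forall j, S (u_ j, f_ j)) ->
     hcvg u_ u -> hcvg f_ f -> S (u, f)) -> closed S.
Proof.
move=> h [u f] uf.
have hn n : exists q : H * H, S q /\ nr (u - q.1) < n.+1%:R^-1 /\ nr (f - q.2) < n.+1%:R^-1.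
  have n0 : 0 < (n.+1%:R^-1 : R)%:C by rewrite ltcR invr_gt0.
  have [q [Sq [q1 q2]]] := uf _ (nbhsx_ballx (u, f) _ n0).
  exists q; split => //; move: q1 q2; rewrite -!ball_normE /= !nrE !ltcR.
  by [].
have [q hq] := choice hn.
have inv0 : (fun n => n.+1%:R^-1 : R) @ \oo --> 0 by exact: cvg_harmonic.
apply: (h (fun j => (q j).1) (fun j => (q j).2)) => [j||].
- by rewrite -surjective_pairing; case: (hq j).
- by apply: hcvg_near inv0; apply: nearW => n; apply: ltW; case: (hq n) => _ [].
- by apply: hcvg_near inv0; apply: nearW => n; apply: ltW; case: (hq n) => _ [].
Qed.

Lemma not_closure_dist (A : set C^o) (z : C^o) : ~ closure A z ->
  exists2 d : R, 0 < d & forall a, A a -> d <= cn (z - a).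
Proof.
move=> zA.
have : ~ forall B, nbhs z B -> A `&` B !=set0 by [].
move=> /existsNP[W /not_implyP[/nbhs_ballP[d' /= d'0 zW] nAW]].
have [er e0'] : d' = (complex.Re d')%:C /\ 0 < complex.Re d'.
  by case: d' d'0 {zW} => a b; rewrite ltcE/= => /andP[/eqP-> ->].
exists (complex.Re d') => // a Aa; rewrite leNgt; apply/negP => za.
apply: nAW; exists a; split => //; apply: zW.
by rewrite -ball_normE /= cnE er ltcR.
Qed.

Lemma bounded_cn (A : set C^o) : bounded_set A -> exists M : R, forall z, A z -> cn z <= M.
Proof.
move=> [M0 [M0r hM]].
have [m mE] : exists m : R, M0 = m%:C.
  by case: M0 M0r {hM} => a b; rewrite realE !lecE /= => /orP[] /andP[/eqP h _]; exists a; rewrite ?h// -h.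
exists (m + 1) => z Az.
have : M0 < (m + 1)%:C by rewrite mE ltcR ltrDl.
by move=> /hM/(_ z Az) /=; rewrite cnE lecR.
Qed.

End sequential.

Section spectral.
Context (R : realType) (H : normedModType R[i]).
Local Notation C := R[i].
Context (e : nat -> H) (co : nat -> H -> C) (B : onb e co).
Context (lam : nat -> R) (b : nat -> H) (Cb : R) (kappa : R).
Hypothesis bC : forall n, nr (b n) <= Cb.
Hypothesis Cb1 : 1 <= Cb.
Hypothesis kappa0 : 0 < kappa.
Hypothesis lam_ge : forall n, kappa * n.+1%:R ^+ 2 <= lam n.
Hypothesis lam_gap : forall m n, m != n ->
  kappa * (maxn m n).+1%:R ^+ 3 <= `|lam m - lam n|.

Local Notation T := (pert_op co lam b).

Lemma pert_op_spectral : spectral_operator T.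
Proof.
have Cb0 : 0 < Cb by rewrite (lt_le_trans _ Cb1).
(* The block size [N'.+1] exceeds [20 * Cb / kappa], which is what [20 * (delta * Cb) <= 1]
   needs. *)
pose N' := (Num.truncn (20 * Cb / kappa)).+1.
pose delta := (kappa * N'.+1%:R)^-1.
have N0 : 0 < N'.+1%:R :> R by [].
have delta0 : 0 <= delta by rewrite invr_ge0 mulr_ge0// ltW.
have delta_Cb : 20 * (delta * Cb) <= 1.
  rewrite /delta mulrCA [_^-1 * _]mulrC ler_pdivrMr ?mulr_gt0// mul1r.
  rewrite -ler_pdivrMl// mulrC (le_trans (ltW (truncnS_gt _)))//.
  by rewrite ler_nat.
pose gam m n : R := if in_block N'.+1 m n then 0 else (lam m - lam n)^-1.
have gam_le m n : `|gam m n| <= delta * (m.+1%:R^-1 * n.+1%:R^-1).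
  rewrite /gam; case: ifP => mn; first by rewrite normr0 !mulr_ge0.
  move: mn; rewrite /in_block => /negbT; rewrite negb_or negb_and -!leqNgt => /andP[mn mnN].
  have gap := lam_gap mn; set p := maxn m n in gap.
  have pN : (N' < p)%N by rewrite /p leq_max.
  rewrite normfV /delta -!invfM lef_pV2 ?posrE ?mulr_gt0// ?(lt_le_trans _ gap) ?mulr_gt0 ?exprn_gt0//.
  (* Here the gap has to be cubic: [m.+1], [n.+1] and the block size are each at most [p.+1], so
     their product is at most [p.+1 ^ 3]. *)
  rewrite (le_trans _ gap)// -!mulrA ler_wpM2l ?(ltW kappa0)//.
  rewrite -!natrM -natrX ler_nat !expnS expn0 muln1.
  by apply: leq_mul; [lia|apply: leq_mul; rewrite ltnS leq_max leqnn ?orbT].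
have gamE m n : (lam m - lam n) * gam m n = (~~ in_block N'.+1 m n)%:R.
  rewrite /gam; case: ifP => mn /=; first by rewrite mulr0.
  rewrite mulfV//; move: mn; rewrite /in_block => /negbT; rewrite negb_or => /andP[mn _].
  rewrite -normr_gt0 (lt_le_trans _ (lam_gap mn))// mulr_gt0// exprn_gt0//.
have [X [XK XE]] := sim_fixpoint B bC Cb1 N'.+1 delta0 delta_Cb gam_le.
pose M := bmx co lam N' X.
have [r [pi [ru pi1 piO piC piR]]] := spectral_projections M.
have gs := g_small B Cb1 delta0 delta_Cb gam_le XK.
set g := GX co gam X in gs.
have TP := pert_opP B bC Cb1 kappa0 lam_ge delta0 delta_Cb gam_le gamE XK XE.
pose U := simU co g; pose V := simV co g.
have UV y : U (V y) = y by exact: (simUV B gs).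
have VU y : V (U y) = y by exact: (simVU B gs).
have Ulin a v w : U (a *: v + w) = a *: U v + U w by exact: (simU_lin B gs).
have Vlin a v w : V (a *: v + w) = a *: V v + V w by exact: (simV_lin B gs).
have UB v w : U (v - w) = U v - U w by exact: (simUB B gs).
have U0 : U 0 = 0 by exact: (simU0 B gs).
have UZ a v : U (a *: v) = a *: U v by exact: (simUZ B gs).
have {}TP u f : T (u, f) <-> T0 co lam N' X (V u) (V f) by exact: TP.
(* The projections are transported by the similarity; [x] is in the range of [E A] exactly when
   [V x] is fixed by [pop A]. *)
pose E (A : set C^o) x := U (pop e co lam X r pi A (V x)).
have EE A x : E A (E A x) = E A x.
  by rewrite /E VU -(popI B) // setIid.
have VE A x : V (E A x) = pop e co lam X r pi A (V x) by rewrite /E VU.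
have rangeE A x : range (E A) x -> pop e co lam X r pi A (V x) = V x.
  by move=> [w _ <-]; rewrite -VE EE.
have Erange A x : pop e co lam X r pi A (V x) = V x -> range (E A) x.
  by move=> h; exists x => //; rewrite /E h UV.
split.
  split.
  - move=> x y z; exact: (pert_op_fun B).
  - exact: (pert_op0 B).
  - move=> a p q; exact: (pert_op_lin B).
  - apply: seq_closed => u_ f_ u f; exact: (pert_op_closed_seq B bC Cb1 kappa0 lam_ge).
exists E; first split.
- move=> A _ a x y; by rewrite /E Vlin (pop_lin B)// Ulin.
- exists (2 * ((\sum_i \sum_j \sum_(a <- r) cn (pi a i j) + 1) * 2)) => A _ x.
  rewrite !nrE -rmorphM lecR /E (le_trans (simU_le B gs _))// -!mulrA ler_wpM2l//.
  have [_ h] := pop_spec B lam X r pi A (V x).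
  rewrite (le_trans h)// ler_wpM2l//; last exact: (simV_le B gs).
  rewrite addr_ge0//; do 2 (apply: sumr_ge0 => ? _); apply: sumr_ge0 => a _; exact: cn_ge0.
- by move=> x; rewrite /E (pop0 B) U0.
- by move=> x; rewrite /E (popT B) ?UV.
- by move=> A D _ _ x; rewrite /E VU -(popI B).
- by move=> A _ x; rewrite /E (popC B)// UB UV.
- move=> F _ tF x; apply/hcvgP.
  have := simU_cvg B gs (pop_sigma B lam X r pi tF (V x)).
  rewrite [X in hcvg X _ -> _](_ : _ = fun m => \sum_(0 <= n < m) E (F n) x) //.
  apply/funext => m; rewrite big_mkord.
  by apply: (big_morph _ (simUD B gs) (simU0 B gs)).
split.
- move=> A _ /bounded_cn[M0 AM] _ [x _ <-].
  have [w hw] := pop_dom B lam X r pi (V x) AM.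
  exists (U w); apply/TP; rewrite VU VE//.
- move=> A _ x y /TP xy; apply/TP; rewrite !VE; exact: pop_T0.
(* By contraposition: a point outside the closure of [A] has positive distance from [A], and the
   resolvent of the block operator is transported by [U]. *)
- move=> A _ z; apply: contraPP => zA; apply.
  have [d d0 dA] := not_closure_dist zA.
  have [S [[K SK] S1 S2]] := pop_resolvent B pi1 piO ru piC piR d0 dA.
  exists (fun y => U (S (V y))); split.
  + move=> y /rangeE pv; have [s1 s2] := S1 _ pv.
    have ry : range (E A) (U (S (V y))) by apply: Erange; rewrite VU.
    split=> //; split => //; apply/TP; rewrite VU.
    by rewrite addrC -scaleN1r Vlin scaleN1r addrC -UZ VU.
  + move=> x w /rangeE pv [/TP xw _].
    by rewrite addrC -scaleN1r Vlin scaleN1r addrC -{1}[x]UV -UZ VU S2// UV.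
  + exists (2 * (`|K| * 2)) => y _; rewrite !nrE -rmorphM lecR.
    rewrite (le_trans (simU_le B gs _))// -!mulrA ler_wpM2l//.
    rewrite (le_trans (SK _))// (@le_trans _ _ (`|K| * nr (V y)))//.
      by rewrite ler_wpM2r ?nr_ge0// ler_norm.
    by rewrite ler_wpM2l// (simV_le B gs).
Qed.

End spectral.

(** * The space L2 *)

Section L2_space.
Context d (T : measurableType d) (R : realType).
Variable mu : {measure set T -> \bar R}.
Local Notation C := R[i].
Local Notation H := (L2 mu).
Local Open Scope quotient_scope.
Implicit Types (u v : H) (f g : T -> C).

Lemma measurable_cn f : complex_measurable f -> measurable_fun setT (fun x => cn (f x)).
Proof. exact: measurable_normc. Qed.

Lemma measurable_cnsq f : complex_measurable f ->
  measurable_fun setT (fun x => (cn (f x) ^+ 2)%:E).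
Proof.
by move=> mf; apply/measurable_EFinP; apply: measurable_funX; exact: measurable_cn.
Qed.

Lemma Lnorm2E f : ('N[mu]_2%:E [EFin \o (@Normc.normc R \o f)] =
  (\int[mu]_x (cn (f x) ^+ 2)%:E) `^ 2^-1)%E.
Proof.
rewrite unlock /Lnorm; congr poweR; apply: eq_integral => x _ /=.
by rewrite ger0_norm ?cn_ge0// powR_mulrn ?cn_ge0.
Qed.

Lemma square_integrableP f : square_integrable mu f <->
  complex_measurable f /\ (\int[mu]_x (cn (f x) ^+ 2)%:E < +oo)%E.
Proof.
split=> -[mf]; rewrite /finite_norm ?Lnorm2E => h; split => //.
  by rewrite (@lty_poweRy _ _ 2^-1).
by rewrite /finite_norm Lnorm2E poweR_lty.
Qed.

Lemma L2_sqi u : square_integrable mu u.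
Proof. exact: (L2_sq (repr u)). Qed.

Lemma L2_meas u : complex_measurable u.
Proof. by case: (L2_sqi u). Qed.

Lemma L2_ext u v : {ae mu, forall x, u x = v x} -> u = v.
Proof.
by move=> uv; rewrite -[u]reprK -[v]reprK; apply/eqP/L2_eqP.
Qed.

(** Total, with default value [0] outside the square integrable functions; [clsE] is its
    specification. *)
Definition cls f : H := if pselect (square_integrable mu f) is left h
  then \pi_(L2 mu) (MkL2fun (introT (L2predP mu f) h)) else 0.

Lemma clsE f : square_integrable mu f -> {ae mu, forall x, cls f x = f x}.
Proof. by move=> h; rewrite /cls; case: pselect => // h'; exact: L2_funK. Qed.

Lemma L2_addE u v : {ae mu, forall x, (u + v : H) x = u x + v x}.
Proof.
have := L2_funK ((repr u : L2fun mu) + (repr v : L2fun mu)).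
by rewrite L2_piD !reprK.
Qed.

Lemma L2_scaleE a u : {ae mu, forall x, (a *: u : H) x = a * u x}.
Proof.
by have := L2_funK (a *: (repr u : L2fun mu)); rewrite -[\pi_(_) _]/(L2_scale a u).
Qed.

Lemma ae_trans3 (P Q S : T -> Prop) : (forall x, P x -> Q x -> S x) ->
  {ae mu, forall x, P x} -> {ae mu, forall x, Q x} -> {ae mu, forall x, S x}.
Proof. by move=> h; exact: filterS2. Qed.

Lemma L2_oppE u : {ae mu, forall x, (- u : H) x = - u x}.
Proof. by rewrite -scaleN1r; apply: filterS (L2_scaleE (-1) u) => x ->; rewrite mulN1r. Qed.

Lemma L2_subE u v : {ae mu, forall x, (u - v : H) x = u x - v x}.
Proof. by apply: filterS2 (L2_addE u (- v)) (L2_oppE v) => x -> ->. Qed.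

Lemma L2_0E : {ae mu, forall x, (0 : H) x = 0}.
Proof.
by have := L2_scaleE 0 0; rewrite scale0r; apply: filterS => x ->; rewrite mul0r.
Qed.

Lemma L2_sumE (u : nat -> H) n :
  {ae mu, forall x, (\sum_(i < n) u i : H) x = \sum_(i < n) u i x}.
Proof.
elim: n => [|n IH]; first by rewrite big_ord0; apply: filterS L2_0E => x ->; rewrite big_ord0.
rewrite big_ord_recr /=; apply: filterS2 (L2_addE (\sum_(i < n) u i) (u n)) IH => x -> ->.
by rewrite big_ord_recr.
Qed.

Lemma nrsq u : (nr u ^+ 2)%:E = (\int[mu]_x (cn (u x) ^+ 2)%:E)%E.
Proof.
have [mu' fu] := L2_sqi u.
have -> : nr u = fine ((\int[mu]_x (cn (u x) ^+ 2)%:E) `^ 2^-1)%E.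
  by rewrite -Lnorm2E.
have [_ ] := proj1 (square_integrableP u) (L2_sqi u).
have : (0 <= \int[mu]_x (cn (u x) ^+ 2)%:E)%E.
  by apply: integral_ge0 => x _; rewrite lee_fin sqr_ge0.
case: integral => //= r; rewrite lee_fin => r0 _.
by rewrite powR12_sqrt// sqr_sqrtr.
Qed.

Lemma nrsq_ae u f : complex_measurable f -> {ae mu, forall x, u x = f x} ->
  (nr u ^+ 2)%:E = (\int[mu]_x (cn (f x) ^+ 2)%:E)%E.
Proof.
move=> mf uf; rewrite nrsq; apply: ae_eq_integral => //.
- exact: measurable_cnsq (L2_meas u).
- exact: measurable_cnsq.
- by apply: filterS uf => x -> _.
Qed.

Lemma complex_measurable_real (f : T -> R) : measurable_fun setT f ->
  complex_measurable (fun x => (f x)%:C).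
Proof. by split. Qed.

Lemma complex_measurable_sum (f : nat -> T -> C) n :
  (forall i, complex_measurable (f i)) ->
  complex_measurable (fun x => \sum_(i < n) f i x).
Proof.
move=> mf; elim: n => [|n IH].
  by split; under eq_fun do rewrite big_ord0; exact: measurable_cst.
under eq_fun do rewrite big_ord_recr.
exact: (complex_measurableD IH (mf n)).
Qed.

Lemma complex_measurableB f g : complex_measurable f -> complex_measurable g ->
  complex_measurable (fun x => f x - g x).
Proof.
move=> mf mg; have := complex_measurableD mf (complex_measurableZ (-1) mg).
by congr complex_measurable; apply/funext => x; rewrite !fctE scaleN1r.
Qed.

(** * Completeness of L2 in the form of absolutely convergent series *)

Section abs_convergence.
Variables (u : nat -> H) (M : R).
Hypothesis uM : forall n, \sum_(i < n) nr (u i) <= M.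

Let g n x := \sum_(i < n) cn (u i x).

Let g_ge0 n x : 0 <= g n x. Proof. by apply: sumr_ge0 => i _; exact: cn_ge0. Qed.

Let M0 : 0 <= M. Proof. by have := uM 0; rewrite big_ord0. Qed.

Let mg n : measurable_fun setT (g n).
Proof. by apply: measurable_sum => i; exact: measurable_cn (L2_meas _). Qed.

(** Minkowski's inequality for several summands, read off from the triangle inequality for the
    classes [a i] of the moduli, which have the same norms as the [u i]. *)
Let g_int n : (\int[mu]_x (g n x ^+ 2)%:E <= (M ^+ 2)%:E)%E.
Proof.
pose a i := cls (fun x => (cn (u i x))%:C).
have sa i : square_integrable mu (fun x => (cn (u i x))%:C).
  apply/square_integrableP; split.
    by apply: complex_measurable_real; exact: measurable_cn (L2_meas _).
  under eq_integral do rewrite cn_real ger0_norm ?cn_ge0//.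
  by have [_] := proj1 (square_integrableP (u i)) (L2_sqi (u i)).
have na i : nr (a i) = nr (u i).
  apply/eqP; rewrite -(eqrXn2 (n := 2))// ?nr_ge0//; apply/eqP; apply: EFin_inj.
  rewrite (nrsq_ae _ (clsE (sa i))); last by case: (sa i).
  by rewrite nrsq; apply: eq_integral => x _; rewrite cn_real ger0_norm ?cn_ge0.
have : nr (\sum_(i < n) a i) <= M.
  rewrite (le_trans (nr_sum _ _ _))// (le_trans _ (uM n))//.
  by apply: ler_sum => i _; rewrite na.
rewrite -ler_sqr ?nnegrE ?nr_ge0// -lee_fin; apply: le_trans.
rewrite (@nrsq_ae _ (fun x => (g n x)%:C)).
- by under [leRHS]eq_integral do rewrite cn_real ger0_norm ?g_ge0//.
- by apply: complex_measurable_real; exact: mg.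
- have aE : {ae mu, forall x, forall i, a i x = (cn (u i x))%:C}.
    by apply: ae_foralln => i; exact: clsE.
  apply: filterS2 (L2_sumE a n) aE => x -> ax.
  by rewrite rmorph_sum /=; apply: eq_bigr => i _; rewrite ax.
Qed.

Let G x := limn (fun n => (g n x ^+ 2)%:E).

Let ndg x : nondecreasing_seq (fun n => (g n x ^+ 2)%:E).
Proof.
move=> m n mn; rewrite lee_fin ler_sqr ?nnegrE//.
by apply: (@sum_mono _ (fun i => cn (u i x))) => // i; exact: cn_ge0.
Qed.

Let mg2 n : measurable_fun setT (fun x => (g n x ^+ 2)%:E).
Proof. by apply/measurable_EFinP; apply: measurable_funX; exact: mg. Qed.

Let gG n x : ((g n x ^+ 2)%:E <= G x)%E.
Proof.
apply: lime_ge; first exact/ereal_nondecreasing_is_cvgn/ndg.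
by near=> m; apply: ndg; near: m; exists n.
Unshelve. all: by end_near. Qed.

Let G_integrable : mu.-integrable setT G.
Proof.
apply/integrableP; split.
  apply: (@emeasurable_fun_cvg _ _ _ setT (fun n x => (g n x ^+ 2)%:E)) => [//|x _].
  exact/ereal_nondecreasing_is_cvgn/ndg.
rewrite (eq_integral G); last first.
  by move=> x _; rewrite gee0_abs// (le_trans _ (gG 0 x))// lee_fin sqr_ge0.
rewrite monotone_convergence//; last by move=> n x _; rewrite lee_fin sqr_ge0.
  apply: (@le_lt_trans _ _ (M ^+ 2)%:E); last by rewrite ltry.
  apply: lime_le; last by apply: nearW => n; exact: g_int.
  apply: ereal_nondecreasing_is_cvgn => m n mn; apply: ge0_le_integral => //.
  - by move=> x _; rewrite lee_fin sqr_ge0.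
  - by move=> x _; exact: ndg.
Qed.

Let S n x := \sum_(i < n) u i x.

(** The upper limit exists and is measurable at every point; where [G] is finite the series
    converges absolutely, and [F] is its sum. *)
Let F x : C :=
  (fine (limn_esup (fun n => (complex.Re (S n x))%:E)) +i*
   fine (limn_esup (fun n => (complex.Im (S n x))%:E)))%C.

Let mS n : complex_measurable (S n).
Proof. by apply: (@complex_measurable_sum (fun i => u i)) => i; exact: L2_meas. Qed.

Let mF : complex_measurable F.
Proof.
split; rewrite /F /=.
- apply: measurableT_comp; first exact: fine_measurable.
  apply: measurable_fun_limn_esup => n; apply/measurable_EFinP.
  by case: (mS n).
- apply: measurableT_comp; first exact: fine_measurable.
  apply: measurable_fun_limn_esup => n; apply/measurable_EFinP.
  by case: (mS n).
Qed.

Let Re_sum n x : complex.Re (S n x) = \sum_(i < n) complex.Re (u i x).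
Proof. by apply: (big_morph (@complex.Re R)) => [[a b] [c e]|]. Qed.

Let Im_sum n x : complex.Im (S n x) = \sum_(i < n) complex.Im (u i x).
Proof. by apply: (big_morph (@complex.Im R)) => [[a b] [c e]|]. Qed.

Lemma le_Re_cn (z : C) : `|complex.Re z| <= cn z.
Proof.
by rewrite -ler_sqr ?nnegrE ?cn_ge0// cnsq -normrX ger0_norm ?sqr_ge0// lerDl sqr_ge0.
Qed.

Lemma le_Im_cn (z : C) : `|complex.Im z| <= cn z.
Proof.
by rewrite -ler_sqr ?nnegrE ?cn_ge0// cnsq -normrX ger0_norm ?sqr_ge0// lerDr sqr_ge0.
Qed.

Lemma cn_le_ReIm (z : C) : cn z <= `|complex.Re z| + `|complex.Im z|.
Proof.
rewrite -ler_sqr ?nnegrE ?cn_ge0 ?addr_ge0// cnsq -![complex.Re z ^+ 2]real_normK ?num_real//.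
rewrite -[complex.Im z ^+ 2]real_normK ?num_real// sqrrD lerD2r lerDl.
by rewrite mulrn_wge0// mulr_ge0.
Qed.

Let cvgS x : G x \is a fin_num -> (fun n => cn (F x - S n x)) @ \oo --> 0.
Proof.
move=> Gx.
have gb n : g n x ^+ 2 <= fine (G x) by rewrite -lee_fin fineK.
have gbd n : g n x <= 1 + fine (G x).
  by have := gb n; have := sqr_ge0 (g n x - 1); nra.
have ab (a : nat -> R) : (forall i, `|a i| <= cn (u i x)) ->
    (fun n => \sum_(i < n) a i) @ \oo --> fine (limn_esup (fun n => (\sum_(i < n) a i)%:E)).
  move=> au; have : cvgn (series a).
    apply: normed_cvg; apply: nondecreasing_is_cvgn.
      by apply: nondecreasing_series => i _ _ /=; exact: normr_ge0.
    exists (1 + fine (G x)) => _ [n _ <-]; rewrite /= (le_trans _ (gbd n))//.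
    by rewrite /series /= big_mkord; apply: ler_sum.
  rewrite /series; under eq_fun do rewrite big_mkord.
  move=> /cvg_ex[l al]; have : (fun n => (\sum_(i < n) a i)%:E) @ \oo --> l%:E.
    by apply: cvg_EFin => //; exact: nearW.
  by move=> /cvg_limn_einf_sup[_ ->].
have cR := ab _ (fun i => le_Re_cn (u i x)); have cI := ab _ (fun i => le_Im_cn (u i x)).
apply: (@squeeze0 _ _ (fun n => `|complex.Re (F x) - complex.Re (S n x)| + `|complex.Im (F x) - complex.Im (S n x)|)).
- by move=> n; exact: cn_ge0.
- by apply: nearW => n; apply: le_trans (cn_le_ReIm _) _; case: (F x) (S n x) => [p q] [p' q'].
- apply: cvg0D; rewrite -[X in _ --> X](@normr0 _ R); apply: cvg_norm.
    rewrite -[X in _ --> X](subrr (complex.Re (F x))); apply: cvgB; first exact: cvg_cst.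
    under eq_fun do rewrite Re_sum; rewrite /F /=.
    by under [X in limn_esup X]eq_fun do rewrite Re_sum.
  rewrite -[X in _ --> X](subrr (complex.Im (F x))); apply: cvgB; first exact: cvg_cst.
  under eq_fun do rewrite Im_sum; rewrite /F /=.
  by under [X in limn_esup X]eq_fun do rewrite Im_sum.
Qed.

Let S_le n x : G x \is a fin_num -> cn (S n x) <= Num.sqrt (fine (G x)).
Proof.
move=> Gx; rewrite -ler_sqr ?nnegrE ?cn_ge0 ?sqrtr_ge0// sqr_sqrtr; last first.
  by rewrite fine_ge0// (le_trans _ (gG 0 x))// lee_fin sqr_ge0.
rewrite -lee_fin fineK// (le_trans _ (gG n x))// lee_fin ler_sqr ?nnegrE ?cn_ge0//.
exact: cn_sum.
Qed.

Let F_le x : G x \is a fin_num -> cn (F x) <= Num.sqrt (fine (G x)).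
Proof.
move=> Gx; apply: (le_cvg0 _ (cvgS Gx)); apply: nearW => n.
by rewrite -[F x in leLHS](subrK (S n x)) addrC (le_trans (cnD _ _))// lerD2r S_le.
Qed.

Let sqi_F : square_integrable mu F.
Proof.
apply/square_integrableP; split => //.
have [mG Glt] := integrableP _ _ _ G_integrable.
have G0 x : (0 <= G x)%E by rewrite (le_trans _ (gG 0 x))// lee_fin sqr_ge0.
have finG : {ae mu, forall x, G x \is a fin_num}.
  by have := integrable_ae measurableT G_integrable; apply: filterS => x; apply.
rewrite (eq_integral G) in Glt; last by move=> x _; rewrite gee0_abs.
apply: le_lt_trans Glt; apply: ae_ge0_le_integral => //.
- by move=> x _; rewrite lee_fin sqr_ge0.
- exact: measurable_cnsq.
- apply: filterS finG => x Gx _; rewrite -(fineK Gx) lee_fin.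
  by rewrite -[leRHS]sqr_sqrtr ?fine_ge0// ler_sqr ?nnegrE ?cn_ge0 ?sqrtr_ge0// F_le.
Qed.

Lemma L2_abs_cvg : exists s : H, hcvg (fun n => \sum_(i < n) u i) s.
Proof.
exists (cls F).
have finG : {ae mu, forall x, G x \is a fin_num}.
  by have := integrable_ae measurableT G_integrable; apply: filterS => x; apply.
have nsq n : (nr (cls F - \sum_(i < n) u i) ^+ 2)%:E = (\int[mu]_x (cn (F x - S n x) ^+ 2)%:E)%E.
  apply: (@nrsq_ae _ (fun x => F x - S n x)); first exact: complex_measurableB.
  apply: (ae_trans3 _ (L2_subE (cls F) (\sum_(i < n) u i)) (filterI (clsE sqi_F) (L2_sumE u n))).
  by move=> x -> [-> ->].
(* The dominating function is [4 * G] because [F] and [S n] are both bounded by the square root of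
   [G]. *)
have [] := @dominated_convergence _ _ _ mu setT measurableT (fun n x => (cn (F x - S n x) ^+ 2)%:E) (cst 0%E) (fun x => (4%:E * G x)%E).
- by move=> n; apply: measurable_cnsq; exact: complex_measurableB.
- exact: measurable_cst.
- apply: filterS finG => x /cvgS c _; apply: cvg_EFin; first exact: nearW.
  rewrite [X in X @ _ --> _](_ : _ = fun n => cn (F x - S n x) * cn (F x - S n x)); last first.
    by apply/funext => n /=; rewrite expr2.
  by rewrite -[X in _ --> X](mulr0 0); exact: cvgM.
- exact: integrableZl.
- apply: filterS finG => x Gx n _.
  rewrite gee0_abs ?lee_fin ?sqr_ge0//.
  have h := S_le n Gx; have h' := F_le Gx.
  rewrite -(fineK Gx) -EFinM lee_fin.
  have G0 : 0 <= fine (G x) by rewrite fine_ge0// (le_trans _ (gG 0 x))// lee_fin sqr_ge0.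
  rewrite -(sqr_sqrtr G0); have := sqrtr_ge0 (fine (G x)).
  have := cnD (F x) (- S n x); rewrite cnN; have := cn_ge0 (F x - S n x).
  move: (Num.sqrt _) (cn (F x - S n x)) h h' => q p; nra.
move=> _ _; rewrite integral0 => /fine_cvgP[_ h].
apply/cvgrPdist_lt => eps eps0; move/cvgrPdist_lt : h => /(_ (eps ^+ 2)).
rewrite exprn_gt0// => /(_ isT); apply: filterS => n /=.
rewrite -nsq /= !sub0r !normrN ger0_norm ?sqr_ge0// ger0_norm ?nr_ge0//.
by rewrite ltr_pXn2r// ?nnegrE ?nr_ge0// ltW.
Qed.

End abs_convergence.

End L2_space.

(** * Orthonormal families in L2 *)

Section real_pairing.
Context d (T : measurableType d) (R : realType).
Variable mu : {measure set T -> \bar R}.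
Implicit Types f g h : T -> R.

Definition sqint f := measurable_fun setT f /\
  mu.-integrable setT (fun x => (f x ^+ 2)%:E).

Definition ip f g : R := Rintegral mu setT (fun x => f x * g x).

Lemma sqint_mul f g : sqint f -> sqint g -> mu.-integrable setT (EFin \o (fun x => f x * g x)).
Proof.
move=> [mf hf] [mg hg].
apply: (le_integrable _ _ _ (integrableD measurableT hf hg)) => //.
  by apply/measurable_EFinP; exact: measurable_funM.
move=> x _ /=; rewrite lee_fin normrM [leRHS]ger0_norm ?addr_ge0 ?sqr_ge0//.
rewrite -(real_normK (num_real (f x))) -(real_normK (num_real (g x))).
have := sqr_ge0 (`|f x| - `|g x|); have := mulr_ge0 (normr_ge0 (f x)) (normr_ge0 (g x)); nra.
Qed.

Lemma sqintD f g : sqint f -> sqint g -> sqint (fun x => f x + g x).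
Proof.
move=> [mf hf] [mg hg]; split; first exact: measurable_funD.
have h2 := integrableZl measurableT 2 (integrableD measurableT hf hg).
apply: (le_integrable _ _ _ h2) => //.
  by apply/measurable_EFinP; apply: measurable_funX; exact: measurable_funD.
move=> x _ /=; rewrite lee_fin ger0_norm ?sqr_ge0//.
apply: le_trans (ler_norm _).
by have := sqr_ge0 (f x - g x); nra.
Qed.

Lemma sqintZ a f : sqint f -> sqint (fun x => a * f x).
Proof.
move=> [mf hf]; split; first exact: measurable_funM.
have := integrableZl measurableT (a ^+ 2) hf.
by under eq_fun do rewrite -EFinM -exprMn.
Qed.

Lemma sqint0 : sqint (fun=> 0).
Proof.
split; first exact: measurable_cst.
by rewrite expr0n /=; exact: integrable0.
Qed.

Lemma sqint_sum n (F : nat -> T -> R) :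
  (forall i, sqint (F i)) -> sqint (fun x => \sum_(i < n) F i x).
Proof.
move=> hF; elim: n => [|n IH].
  have -> : (fun x => \sum_(i < 0) F i x) = (fun=> 0) by apply/funext => x; rewrite big_ord0.
  exact: sqint0.
have -> : (fun x => \sum_(i < n.+1) F i x) = (fun x => \sum_(i < n) F i x + F n x).
  by apply/funext => x; rewrite big_ord_recr.
exact: sqintD.
Qed.

Lemma ipC f g : ip f g = ip g f.
Proof. by apply: eq_Rintegral => x _; rewrite mulrC. Qed.

Lemma ipDl f g h : sqint f -> sqint g -> sqint h ->
  ip (fun x => f x + g x) h = ip f h + ip g h.
Proof.
move=> hf hg hh; rewrite /ip -RintegralD//; [|exact: sqint_mul|exact: sqint_mul].
by apply: eq_Rintegral => x _; rewrite mulrDl.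
Qed.

Lemma ipZl a f h : sqint f -> sqint h -> ip (fun x => a * f x) h = a * ip f h.
Proof.
move=> hf hh; rewrite /ip -RintegralZl//; last exact: sqint_mul.
by apply: eq_Rintegral => x _; rewrite mulrA.
Qed.

Lemma ip0l h : ip (fun=> 0) h = 0.
Proof.
rewrite /ip (_ : (fun x => 0 * h x) = cst 0); last by apply/funext => x; rewrite mul0r.
by rewrite /Rintegral integral0.
Qed.

Lemma ip_suml n (a : nat -> R) (F : nat -> T -> R) h : (forall i, sqint (F i)) -> sqint h ->
  ip (fun x => \sum_(i < n) a i * F i x) h = \sum_(i < n) a i * ip (F i) h.
Proof.
move=> hF hh; elim: n => [|n IH].
  have -> : (fun x => \sum_(i < 0) a i * F i x) = (fun=> 0) by apply/funext => x; rewrite big_ord0.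
  by rewrite big_ord0 ip0l.
have -> : (fun x => \sum_(i < n.+1) a i * F i x) = (fun x => \sum_(i < n) a i * F i x + a n * F n x).
  by apply/funext => x; rewrite big_ord_recr.
rewrite big_ord_recr /= ipDl ?IH ?ipZl//; last exact: sqintZ.
by apply: (@sqint_sum n (fun i x => a i * F i x)) => i; exact: sqintZ.
Qed.

Lemma ip_ge0 f : 0 <= ip f f.
Proof. by apply: Rintegral_ge0 => x _; rewrite -expr2 sqr_ge0. Qed.

Lemma ip_ae f g h : sqint f -> measurable_fun setT g -> sqint h -> {ae mu, forall x, f x = g x} ->
  ip f h = ip g h.
Proof.
move=> [mf _] mg [mh _] fg; congr fine; apply: ae_eq_integral => //.
- by apply/measurable_EFinP; exact: measurable_funM.
- by apply/measurable_EFinP; exact: measurable_funM.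
- by apply: filterS fg => x -> _.
Qed.

Section orthonormal.
Variable phi : nat -> T -> R.
Hypothesis phi_l2 : forall n, sqint (phi n).
Hypothesis phi_on : forall m n, ip (phi m) (phi n) = (m == n)%:R.

Lemma sqint_lin n (a : nat -> R) : sqint (fun x => \sum_(i < n) a i * phi i x).
Proof. by apply: (@sqint_sum n (fun i x => a i * phi i x)) => i; exact: sqintZ. Qed.

Lemma ip_sum_phi n (a : nat -> R) k :
  ip (fun x => \sum_(i < n) a i * phi i x) (phi k) = if (k < n)%N then a k else 0.
Proof.
rewrite ip_suml//; under eq_bigr do rewrite phi_on.
case: ltnP => kn.
  rewrite (bigD1 (Ordinal kn))//= eqxx mulr1 big1 ?addr0// => i.
  by rewrite -val_eqE /= => /negbTE ->; rewrite mulr0.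
by rewrite big1// => i _; rewrite ltn_eqF ?mulr0// (leq_trans (ltn_ord i)).
Qed.

Lemma ip_sum_sq n (a : nat -> R) :
  ip (fun x => \sum_(i < n) a i * phi i x) (fun x => \sum_(i < n) a i * phi i x)
  = \sum_(i < n) a i ^+ 2.
Proof.
rewrite ip_suml//; last exact: sqint_lin.
by apply: eq_bigr => i _; rewrite ipC ip_sum_phi ltn_ord expr2.
Qed.

(** The inequality [0 <= ip (f - s) (f - s)] expanded, with [s] the partial sum of the expansion of
    [f]. *)
Lemma real_bessel n f : sqint f -> \sum_(i < n) ip f (phi i) ^+ 2 <= ip f f.
Proof.
move=> hf; pose a i := ip f (phi i).
pose s x := \sum_(i < n) a i * phi i x.
have hs : sqint s by exact: sqint_lin.
have hms : sqint (fun x => -1 * s x) by exact: sqintZ.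
have := ip_ge0 (fun x => f x + -1 * s x).
have sf : ip s f = \sum_(i < n) a i ^+ 2.
  by rewrite ip_suml//; apply: eq_bigr => i _; rewrite ipC expr2.
rewrite ipDl//; last exact: sqintD.
rewrite ipC ipDl// ipZl// sf.
rewrite [X in _ + X](ipC) ipDl// ipZl// ![ip _ (fun x => -1 * s x)]ipC !ipZl//.
by rewrite [ip s s]ip_sum_sq sf; lra.
Qed.

End orthonormal.

End real_pairing.

Section orthonormal_basis_L2.
Context d (T : measurableType d) (R : realType).
Variable mu : {measure set T -> \bar R}.
Local Notation C := R[i].
Local Notation H := (L2 mu).
Implicit Types (u v : H).
Variable phi : nat -> T -> R.
Hypothesis phi_l2 : forall n, sqint mu (phi n).
Hypothesis phi_on : forall m n, ip mu (phi m) (phi n) = (m == n)%:R.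

Definition Re_ u x := complex.Re (u x : C).
Definition Im_ u x := complex.Im (u x : C).

Lemma sqint_dom u (f : T -> R) : measurable_fun setT f -> (forall x, `|f x| <= cn (u x)) ->
  sqint mu f.
Proof.
move=> mf fu; split=> //; apply/integrableP; split.
  by apply/measurable_EFinP; exact: measurable_funX.
have [_] := proj1 (square_integrableP mu u) (L2_sqi u); apply: le_lt_trans.
apply: ge0_le_integral => //.
- by apply: measurableT_comp => //; apply/measurable_EFinP; exact: measurable_funX.
- exact: measurable_cnsq (L2_meas u).
- move=> x _; rewrite abse_EFin lee_fin normrX ler_sqr ?nnegrE ?cn_ge0//.
Qed.

Lemma sqint_Re u : sqint mu (Re_ u).
Proof. by apply: (@sqint_dom u) => [|x]; [case: (L2_meas u)|exact: le_Re_cn]. Qed.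

Lemma sqint_Im u : sqint mu (Im_ u).
Proof. by apply: (@sqint_dom u) => [|x]; [case: (L2_meas u)|exact: le_Im_cn]. Qed.

Lemma nrsq_ip u : nr u ^+ 2 = ip mu (Re_ u) (Re_ u) + ip mu (Im_ u) (Im_ u).
Proof.
apply: EFin_inj; rewrite nrsq /ip -RintegralD//; last 2 first.
- exact: sqint_mul (sqint_Re u) (sqint_Re u).
- exact: sqint_mul (sqint_Im u) (sqint_Im u).
rewrite /Rintegral (_ : integral _ _ _ = (\int[mu]_x (cn (u x) ^+ 2)%:E)%E); last first.
  by apply: eq_integral => x _; rewrite cnsq !expr2.
by rewrite fineK// -nrsq.
Qed.

(** As the functions [phi n] are real, pairing the real and imaginary parts suffices and no
    sesquilinear form is introduced. *)
Definition coef n u : C := (ip mu (Re_ u) (phi n) +i* ip mu (Im_ u) (phi n))%C.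

Lemma sqint_cls (f : T -> C) : sqint mu (fun x => complex.Re (f x)) ->
  sqint mu (fun x => complex.Im (f x)) -> square_integrable mu f.
Proof.
move=> [mr ir] [mi ii]; apply/square_integrableP; split => //.
have /integrableP[_] := integrableD measurableT ir ii.
apply: le_lt_trans; apply: ge0_le_integral => //.
- by move=> x _; rewrite lee_fin sqr_ge0.
- exact: measurable_cnsq.
- by apply: measurableT_comp => //; apply: emeasurable_funD; apply/measurable_EFinP; exact: measurable_funX.
- by move=> x _; rewrite cnsq /= lee_fin ler_norm.
Qed.

Definition basis n : H := cls mu (fun x => (phi n x)%:C).

Lemma basis_sqi n : square_integrable mu (fun x => (phi n x)%:C).
Proof. by apply: sqint_cls => /=; [exact: phi_l2|exact: sqint0]. Qed.

Lemma basisE n : {ae mu, forall x, basis n x = (phi n x)%:C}.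
Proof. exact: clsE (basis_sqi n). Qed.

Lemma coef_ae n u (f : T -> C) : complex_measurable f -> {ae mu, forall x, u x = f x} ->
  coef n u = (ip mu (fun x => complex.Re (f x)) (phi n) +i* ip mu (fun x => complex.Im (f x)) (phi n))%C.
Proof.
move=> [mr mi] uf; congr (_ +i* _)%C; apply: ip_ae => //.
- exact: sqint_Re.
- by apply: filterS uf => x; rewrite /Re_ => ->.
- exact: sqint_Im.
- by apply: filterS uf => x; rewrite /Im_ => ->.
Qed.

Lemma coef_lin n a u v : coef n (a *: u + v) = a * coef n u + coef n v.
Proof.
have mauv : complex_measurable (fun x => a * u x + v x).
  exact: (complex_measurableD (complex_measurableZ a (L2_meas u)) (L2_meas v)).
have auvE : {ae mu, forall x, (a *: u + v : H) x = a * u x + v x}.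
  by apply: filterS2 (L2_addE (a *: u) v) (L2_scaleE a u) => x -> ->.
rewrite (coef_ae n mauv auvE); case: a {mauv auvE} => p q.
have hr := sqint_Re u; have hi := sqint_Im u; have hr' := sqint_Re v; have hi' := sqint_Im v.
have -> : (fun x => complex.Re ((p +i* q)%C * u x + v x)) =
    (fun x => (p * Re_ u x + - q * Im_ u x) + Re_ v x).
  by apply/funext => x; rewrite /Re_ /Im_; case: (u x) (v x) => [r s] [r' s'] /=; rewrite mulNr.
have -> : (fun x => complex.Im ((p +i* q)%C * u x + v x)) =
    (fun x => (p * Im_ u x + q * Re_ u x) + Im_ v x).
  by apply/funext => x; rewrite /Re_ /Im_; case: (u x) (v x) => [r s] [r' s'].
have hx := sqintZ p hr; have hy := sqintZ (- q) hi.
have hz := sqintZ p hi; have hw := sqintZ q hr.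
rewrite !ipDl ?ipZl//; try exact: sqintD.
by rewrite /coef; simpc; congr (_ +i* _)%C; ring.
Qed.

Lemma coef_sum n (c : nat -> C) (u_ : nat -> H) k : coef n (\sum_(i < k) c i *: u_ i : H) = \sum_(i < k) c i * coef n (u_ i).
Proof.
have c0 : coef n 0 = 0.
  have := coef_lin n 1 0 0; rewrite scale1r addr0 mul1r => /eqP.
  by rewrite -subr_eq0 opprD addrA subrr sub0r oppr_eq0 => /eqP.
elim: k => [|k IH]; first by rewrite !big_ord0.
by rewrite !big_ord_recr /= addrC coef_lin IH addrC.
Qed.

Lemma coef_basis m n : coef m (basis n) = (m == n)%:R.
Proof.
rewrite (coef_ae m (proj1 (basis_sqi n)) (basisE n)) /= ip0l phi_on eq_sym.
by case: eqP.
Qed.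

Lemma coef_bessel n u : \sum_(i < n) cn (coef i u) ^+ 2 <= nr u ^+ 2.
Proof.
under eq_bigr do rewrite cnsq /=.
rewrite big_split /= nrsq_ip lerD//; apply: real_bessel => //.
- exact: sqint_Re.
- exact: sqint_Im.
Qed.

Lemma lin_basisE n (c : nat -> C) : {ae mu, forall x,
  (\sum_(i < n) c i *: basis i : H) x = \sum_(i < n) c i * (phi i x)%:C}.
Proof.
have h : {ae mu, forall x, forall i, (c i *: basis i : H) x = c i * (phi i x)%:C}.
  apply: ae_foralln => i.
  by apply: filterS2 (L2_scaleE (c i) (basis i)) (basisE i) => x -> ->.
apply: filterS2 (L2_sumE (fun i => c i *: basis i) n) h => x -> hx.
by apply: eq_bigr => i _; rewrite hx.
Qed.

Lemma nr_lin_basis n (c : nat -> C) :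
  nr (\sum_(i < n) c i *: basis i : H) ^+ 2 = \sum_(i < n) cn (c i) ^+ 2.
Proof.
have ReE x : complex.Re (\sum_(i < n) c i * (phi i x)%:C) = \sum_(i < n) complex.Re (c i) * phi i x.
  rewrite (big_morph (@complex.Re R) (id1 := 0) (op1 := +%R))//; last by case=> ? ? [].
  by apply: eq_bigr => i _; case: (c i) => a b /=; rewrite mulr0 subr0.
have ImE x : complex.Im (\sum_(i < n) c i * (phi i x)%:C) = \sum_(i < n) complex.Im (c i) * phi i x.
  rewrite (big_morph (@complex.Im R) (id1 := 0) (op1 := +%R))//; last by case=> ? ? [].
  by apply: eq_bigr => i _; case: (c i) => a b /=; rewrite mulr0 add0r.
set u : H := \sum_(i < n) _.
have ipE (f : T -> R) (a : nat -> R) : sqint mu f ->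
    {ae mu, forall x, f x = \sum_(i < n) a i * phi i x} -> ip mu f f = \sum_(i < n) a i ^+ 2.
  move=> hf fE; have hs := sqint_lin phi_l2 n a.
  by rewrite (ip_ae hf (proj1 hs) hf fE) ipC (ip_ae hf (proj1 hs) hs fE) ip_sum_sq.
rewrite nrsq_ip (ipE _ (fun i => complex.Re (c i)) (sqint_Re u)); last first.
  by apply: filterS (lin_basisE n c) => x; rewrite /Re_ -ReE => ->.
rewrite (ipE _ (fun i => complex.Im (c i)) (sqint_Im u)); last first.
  by apply: filterS (lin_basisE n c) => x; rewrite /Im_ -ImE => ->.
by rewrite -big_split; apply: eq_bigr => i _; rewrite cnsq.
Qed.

Lemma coef_le n u : cn (coef n u) <= nr u.
Proof.
rewrite -ler_sqr ?nnegrE ?cn_ge0 ?nr_ge0// (le_trans _ (coef_bessel n.+1 u))//.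
by rewrite big_ord_recr /= lerDr; apply: sumr_ge0 => i _; rewrite sqr_ge0.
Qed.

(** Completeness is available for absolutely convergent series only. The expansion is therefore cut
    into pieces of norm at most [2^-j]; the resulting subsequence of partial sums is returned
    because Parseval's identity is later drawn from it. *)
Lemma riesz_fischer_L2 (c : nat -> C) M : (forall n, \sum_(i < n) cn (c i) ^+ 2 <= M) ->
  exists2 s : H, (forall n, coef n s = c n) & exists N_ : nat -> nat,
    hcvg (fun j => \sum_(i < N_ j) c i *: basis i) s.
Proof.
move=> cM; pose f i := cn (c i) ^+ 2; pose P n := \sum_(i < n) f i.
have f0 i : 0 <= f i by rewrite sqr_ge0.
have ndP : nondecreasing_seq P by move=> m n mn; exact: sum_mono.
have PL : P @ \oo --> sup (range P).
  by apply: nondecreasing_cvgn => //; exists M => _ [n _ <-]; exact: cM.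
set L := sup _ in PL.
have PleL n : P n <= L.
  by apply: sup_upper_bound; [split; [exists (P 0%N); exists 0%N|exists M => _ [k _ <-]; exact: cM]|exists n].
have hn j : exists n : nat, L - P n <= (2^-1 ^+ j) ^+ 2.
  have e0 : 0 < (2^-1 ^+ j) ^+ 2 :> R by rewrite !exprn_gt0// invr_gt0.
  move/cvgrPdist_lt : PL => /(_ _ e0)[n _ h]; exists n.
  by have := h n (leqnn n); rewrite /= ger0_norm ?subr_ge0// => /ltW.
have [n_ hn_] := choice hn.
(* Summing the successors gives an increasing sequence with [n_ j <= N_ j] and [j < N_ j], so that
   every coefficient is eventually included. *)
pose N_ j := (\sum_(i < j.+1) (n_ i).+1)%N.
have NS j : N_ j.+1 = (N_ j + (n_ j.+1).+1)%N by rewrite /N_ big_ord_recr.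
have nN j : (n_ j <= N_ j)%N.
  by rewrite /N_ big_ord_recr /= (leq_trans (leqnSn _))// leq_addl.
have jN j : (j < N_ j)%N.
  elim: j => [|j IH]; first by rewrite /N_ big_ord_recr big_ord0.
  by rewrite NS addnS ltnS (leq_trans IH)// leq_addr.
have LN j : L - P (N_ j) <= (2^-1 ^+ j) ^+ 2.
  by rewrite (le_trans _ (hn_ j))// lerD2l lerN2; exact: ndP.
pose S n : H := \sum_(i < n) c i *: basis i.
pose v j := S (N_ j.+1) - S (N_ j).
have vE j : v j = \sum_(i < N_ j.+1) (if (i < N_ j)%N then 0 else c i) *: basis i.
  rewrite /v /S NS !big_split_ord /=.
  rewrite [X in _ = X + _]big1 ?add0r => [|i _]; last by rewrite ltn_ord scale0r.
  rewrite addrAC subrr add0r; apply: eq_bigr => i _.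
  by rewrite ltnNge leq_addr.
have nv j : nr (v j) <= 2^-1 ^+ j.
  rewrite -ler_sqr ?nnegrE ?nr_ge0 ?exprn_ge0 ?invr_ge0//.
  rewrite vE (nr_lin_basis _ (fun i => if (i < N_ j)%N then 0 else c i)) (le_trans _ (LN j))//.
  apply: le_trans (sum_tail (N_ j) (N_ j.+1) f0 PleL); apply: ler_sum => i _.
  by case: ifP => _; rewrite ?cn0 ?expr0n.
have half k : \sum_(i < k) nr (v i) <= 2.
  apply: (@le_trans _ _ (2 - 2 * 2^-1 ^+ k)); last first.
    by rewrite gerBl mulr_ge0// exprn_ge0// invr_ge0.
  elim: k => [|k IH]; first by rewrite big_ord0 expr0 mulr1 subrr.
  rewrite big_ord_recr /= (le_trans (lerD IH (nv k)))// exprS.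
  by rewrite le_eqVlt; apply/orP; left; apply/eqP; field.
have [s0 s0E] := L2_abs_cvg half.
have SNE k : S (N_ 0) + \sum_(i < k) v i = S (N_ k).
  elim: k => [|k IH]; first by rewrite big_ord0 addr0.
  by rewrite big_ord_recr /= addrA IH /v addrC subrK.
have Scv : hcvg (fun j => S (N_ j)) (S (N_ 0) + s0).
  by under eq_fun do rewrite -SNE; apply: hcvgD => //; exact: hcvg_cst.
exists (S (N_ 0) + s0); last by exists N_.
move=> n; apply/eqP; rewrite -subr_eq0; apply/eqP/cn_eq0.
apply: (@le0_cvg0 _ _ (fun j => nr ((S (N_ 0) + s0) - S (N_ j)))) => //; first exact: cn_ge0.
near=> j; have nj : (n < N_ j)%N.
  by rewrite (leq_ltn_trans _ (jN j))//; near: j; exact: nbhs_infty_ge.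
have cS : coef n (S (N_ j)) = c n.
  rewrite coef_sum; under eq_bigr do rewrite coef_basis.
  rewrite (bigD1 (Ordinal nj))//= eqxx mulr1 big1 ?addr0// => i.
  by rewrite -val_eqE /= eq_sym => /negbTE ->; rewrite mulr0.
rewrite -cS [coef n (S _ + s0) - _]addrC -mulN1r -coef_lin.
by rewrite scaleN1r addrC coef_le.
Unshelve. all: by end_near. Qed.

Hypothesis total : forall u, (forall n, coef n u = 0) -> u = 0.

Lemma onb_L2 : onb basis coef.
Proof.
split.
- exact: coef_lin.
- exact: coef_basis.
- exact: coef_bessel.
(* By totality [u] is the vector rebuilt from its own coefficients, hence a limit of partial sums of
   norm at most [M]. *)
- move=> u M M0 uM; have [s sE [N_ Ns]] := @riesz_fischer_L2 (coef^~ u) _ uM.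
  have -> : u = s.
    apply/eqP; rewrite -subr_eq0; apply/eqP/total => n.
    by rewrite -scaleN1r addrC coef_lin sE mulN1r addNr.
  apply: (hcvg_le Ns); apply: nearW => j.
  rewrite -ler_sqr ?nnegrE ?nr_ge0// (nr_lin_basis _ (coef^~ u)).
  exact: uM.
- by move=> c M /riesz_fischer_L2[s sE _]; exists s.
- by move=> u M; exact: L2_abs_cvg.
Qed.

End orthonormal_basis_L2.

(** * Absolutely continuous functions *)

Section interval_lists.
Context (R : realType).
Implicit Types (p q : R * R) (l : seq (R * R)) (f : R -> R).

(** Shared end points are allowed, but a degenerate interval strictly inside another one is not.
    Lists of intervals need not be sorted. *)
Definition itv_disj p q := (p.2 <= q.1) || (q.2 <= p.1).

Definition in_seg (a b : R) p := (a <= p.1) && (p.1 <= p.2) && (p.2 <= b).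

Definition valid a b l := all (in_seg a b) l && pairwise itv_disj l.

Definition len l := \sum_(p <- l) (p.2 - p.1).

Definition vsum f l := \sum_(p <- l) `|f p.2 - f p.1|.

Lemma itv_disjC p q : itv_disj p q = itv_disj q p.
Proof. by rewrite /itv_disj orbC. Qed.

Lemma len_cons p l : len (p :: l) = (p.2 - p.1) + len l.
Proof. by rewrite /len big_cons. Qed.

Lemma len_cat l l' : len (l ++ l') = len l + len l'.
Proof. by rewrite /len big_cat. Qed.

Lemma vsum_cat f l l' : vsum f (l ++ l') = vsum f l + vsum f l'.
Proof. by rewrite /vsum big_cat. Qed.

Lemma valid_sub a b a' b' l : a' <= a -> b <= b' -> valid a b l -> valid a' b' l.
Proof.
move=> aa bb /andP[/allP h pl]; rewrite /valid pl andbT; apply/allP => p /h /andP[/andP[h1 h2] h3].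
by rewrite /in_seg h2 (le_trans aa)//= (le_trans h3).
Qed.

Lemma valid_filter a b l (P : pred (R * R)) : valid a b l -> valid a b [seq q <- l | P q].
Proof.
move=> /andP[h1 h2]; apply/andP; split; last exact: pairwise_filter.
by rewrite all_filter; apply: sub_all h1 => p hp; apply/implyP.
Qed.

(** Induction on the size: the first interval separates the others into those to its left and those
    to its right. *)
Lemma len_valid a b l : a <= b -> valid a b l -> len l <= b - a.
Proof.
have [n] := ubnP (size l); elim: n => // n IH in a b l *.
case: l => [|p l] sl ab; first by rewrite /len big_nil subr_ge0.
move=> /andP[/= /andP[/andP[/andP[ap pp] pb] hl] /andP[/allP dl pl]].
have vl : valid a b l by rewrite /valid hl pl.
rewrite len_cons; pose P q := (q.2 <= p.1 :> R).
have -> : len l = len [seq q <- l | P q] + len [seq q <- l | predC P q].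
  by rewrite -len_cat /len; apply: perm_big; rewrite perm_sym perm_filterC.
have h1 : len [seq q <- l | P q] <= p.1 - a.
  apply: IH => //; first by rewrite size_filter (leq_ltn_trans (count_size _ _)).
  apply/andP; split; last by have /andP[] := valid_filter P vl.
  apply/allP => q; rewrite mem_filter => /andP[Pq ql].
  have /andP[/andP[h1 h2] _] := allP hl _ ql.
  by rewrite /in_seg h1 h2.
have h2 : len [seq q <- l | predC P q] <= b - p.2.
  apply: IH => //; first by rewrite size_filter (leq_ltn_trans (count_size _ _)).
  apply/andP; split; last by have /andP[] := valid_filter (predC P) vl.
  apply/allP => q; rewrite mem_filter => /andP[/= Pq ql].
  have /andP[/andP[h1' h2] h3] := allP hl _ ql.
  have /orP[h|h] := dl _ ql; last by move: Pq; rewrite /P h.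
  by rewrite /in_seg h h2 h3.
lra.
Qed.

(** The two clamps cut a list at [c]; intervals on the wrong side collapse to the point [c], so the
    list keeps its shape. *)
Definition clampl c p := (Num.min p.1 c, Num.min p.2 c).
Definition clampr c p := (Num.max p.1 c, Num.max p.2 c).

Lemma pairwise_map_disj (h : R -> R) l : {homo h : x y / x <= y} ->
  pairwise itv_disj l -> pairwise itv_disj [seq (h p.1, h p.2) | p <- l].
Proof.
move=> hh; rewrite pairwise_map; apply: sub_pairwise => p q.
by rewrite /itv_disj /= => /orP[/hh ->|/hh ->]; rewrite ?orbT.
Qed.

Lemma valid_clampl a b c l : a <= c -> valid a b l -> valid a c (map (clampl c) l).
Proof.
move=> ac /andP[/allP hl pl]; apply/andP; split; last first.
  apply: (@pairwise_map_disj (fun x => Num.min x c)) => // x y xy.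
  by rewrite le_min !ge_min xy ?lexx ?orbT.
apply/allP => _ /mapP[p /hl /andP[/andP[h1 h2] h3] ->].
rewrite /in_seg /=; apply/andP; split; last by rewrite ge_min lexx orbT.
by apply/andP; split; [rewrite le_min h1 ac|rewrite le_min !ge_min h2 lexx orbT].
Qed.

Lemma valid_clampr a b c l : c <= b -> valid a b l -> valid c b (map (clampr c) l).
Proof.
move=> cb /andP[/allP hl pl]; apply/andP; split; last first.
  apply: (@pairwise_map_disj (fun x => Num.max x c)) => // x y xy.
  by rewrite ge_max !le_max xy ?lexx ?orbT.
apply/allP => _ /mapP[p /hl /andP[/andP[h1 h2] h3] ->].
rewrite /in_seg /=; apply/andP; split; last by rewrite ge_max h3 cb.
by apply/andP; split; [rewrite le_max lexx orbT|rewrite ge_max !le_max h2 lexx orbT].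
Qed.

Lemma vsum_clamp f c l : all (fun p => p.1 <= p.2) l ->
  vsum f l <= vsum f (map (clampl c) l) + vsum f (map (clampr c) l).
Proof.
move=> /allP hl; rewrite /vsum !big_map -big_split /= big_seq [leRHS]big_seq.
apply: ler_sum => p /hl pp.
have [h1|h1] := leP p.1 c; have [h2|h2] := leP p.2 c.
- by rewrite lerDl.
- by rewrite [leRHS]addrC ler_distD.
- by have := le_lt_trans pp (le_lt_trans h2 h1); rewrite ltxx.
- by rewrite subrr normr0 add0r.
Qed.

Lemma valid_cat a c b l l' : a <= c -> c <= b -> valid a c l -> valid c b l' -> valid a b (l ++ l').
Proof.
move=> ac cb vl vl'.
have /andP[h1 h2] := valid_sub (lexx a) cb vl.
have /andP[h1' h2'] := valid_sub ac (lexx b) vl'.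
apply/andP; split; first by rewrite all_cat h1.
rewrite pairwise_cat h2 h2' !andbT; apply/allrelP => p q pl ql.
case/andP: vl => /allP/(_ p pl)/andP[_ pc] _; case/andP: vl' => /allP/(_ q ql)/andP[/andP[cq _] _] _.
by rewrite /itv_disj (le_trans pc).
Qed.

Section abs_cont.
Variables (omega : R) (F : R -> R).
Hypothesis omega0 : 0 < omega.

(** The weak inequality [<= eps] is the form that survives passing to suprema, as needed for the
    variation function. *)
Definition acl (G : R -> R) := forall eps, 0 < eps -> exists2 delta, 0 < delta &
  forall l, valid 0 omega l -> len l < delta -> vsum G l <= eps.

Hypothesis acF : acl F.

(** Bounded variation: with [d] belonging to [eps = 1], the segment is cut into pieces of length at
    most [d / 2], each contributing at most 1. *)
Lemma vsum_bounded : exists M, forall l, valid 0 omega l -> vsum F l <= M.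
Proof.
have [d d0 hd] := acF ltr01.
suff h n : forall b, b <= omega -> 0 <= b -> b <= n%:R * (d / 2) -> forall l, valid 0 b l -> vsum F l <= n%:R.
  have [n hn] : exists n : nat, omega / (d / 2) < n%:R.
    by exists (Num.truncn (omega / (d / 2))).+1; exact: truncnS_gt.
  exists n%:R => l; apply: h => //; first exact: ltW.
  by rewrite -ler_pdivrMr ?ltW// divr_gt0.
elim: n => [|n IH] b bw b0 bn l vl.
  have b00 : b = 0 by apply/eqP; rewrite eq_le b0 andbT (le_trans bn)// mul0r.
  rewrite /vsum big_seq big1// => p; case/andP: vl => /allP h _ /h.
  rewrite /in_seg b00 => /andP[/andP[h1 h2] h3].
  have -> : p.1 = p.2 by apply/eqP; rewrite eq_le h2 (le_trans h3).
  by rewrite subrr normr0.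
pose c := Num.max 0 (b - d / 2).
have c0 : 0 <= c by rewrite le_max lexx.
have cb : c <= b by rewrite ge_max b0 gerBl divr_ge0// ltW.
have hl : all (fun p => p.1 <= p.2) l.
  by case/andP: vl => h _; apply: sub_all h => p /andP[/andP[]].
rewrite (le_trans (vsum_clamp F c hl))// -natr1 lerD//.
  apply: (IH c) => //; first exact: le_trans bw.
    rewrite ge_max mulr_ge0//=; last by rewrite divr_ge0// ltW.
    by rewrite lerBlDr; move: bn; rewrite -natr1 mulrDl mul1r.
  exact: valid_clampl vl.
apply: hd; first by apply: valid_sub (valid_clampr cb vl).
apply: (le_lt_trans (len_valid cb (valid_clampr cb vl))).
rewrite ltrBlDr -ltrBlDl lt_max; apply/orP; right.
by rewrite ltrD2l ltrN2 ltr_pdivrMr// ltr_pMr// ltr1n.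
Qed.

Definition Vset x := [set vsum F l | l in [set l | valid 0 x l]].
Definition V x := sup (Vset x).

Lemma Vset_sup x : 0 <= x <= omega -> has_sup (Vset x).
Proof.
move=> /andP[x0 xw]; split; first by exists (vsum F [::]), [::].
have [M hM] := vsum_bounded.
by exists M => _ [l vl <-]; apply: hM; exact: valid_sub vl.
Qed.

Lemma vsum_V x l : 0 <= x <= omega -> valid 0 x l -> vsum F l <= V x.
Proof. by move=> x0 vl; apply: sup_upper_bound; [exact: Vset_sup|exists l]. Qed.

Lemma V_incr s t l : 0 <= s -> s <= t -> t <= omega -> valid s t l -> vsum F l <= V t - V s.
Proof.
move=> s0 st tw vl; rewrite lerBrDl addrC -lerBrDl.
have sw : 0 <= s <= omega by rewrite s0 (le_trans st).
apply: ge_sup; first by case: (Vset_sup sw).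
move=> _ [l' vl' <-]; rewrite lerBrDl addrC -vsum_cat.
by apply: vsum_V; [rewrite (le_trans s0)|exact: valid_cat vl].
Qed.

(** A nearly optimal list for [V t] is cut at [s]; its left part contributes at most [V s]. *)
Lemma V_approx s t eps : 0 < eps -> 0 <= s -> s <= t -> t <= omega ->
  exists2 l, valid s t l & V t - V s <= vsum F l + eps.
Proof.
move=> e0 s0 st tw.
have t0 : 0 <= t <= omega by rewrite tw (le_trans s0).
have sw : 0 <= s <= omega by rewrite s0 (le_trans st).
have [_ [l vl <-] hl] := sup_adherent e0 (Vset_sup t0).
exists (map (clampr s) l); first exact: valid_clampr vl.
have al : all (fun p => p.1 <= p.2) l.
  by case/andP: vl => h _; apply: sub_all h => p /andP[/andP[]].
have := vsum_clamp F s al; have := vsum_V sw (valid_clampl s0 vl).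
move: hl; rewrite -/(V t); lra.
Qed.

Lemma acl_V : acl V.
Proof.
move=> eps e0; have [d d0 hd] := acF e0; exists d => // l vl ll.
(* Each interval of [l] is refined by a list nearly realising the variation on it; this does not
   increase the total length, so the [delta] of [F] still works. The last conjunct strengthens the
   induction, to keep the refinements disjoint from each other. *)
suff h eta : 0 < eta -> forall l, valid 0 omega l -> exists L,
    [/\ valid 0 omega L, len L <= len l, vsum V l <= vsum F L + eta * (size l)%:R
     & forall q, all (itv_disj q) l -> all (itv_disj q) L].
  apply/ler_addgt0Pr => e1 e10.
  pose eta := e1 / (size l).+1%:R.
  have eta0 : 0 < eta by rewrite divr_gt0.
  have [L [vL lL hL _]] := h _ eta0 _ vl.
  rewrite (le_trans hL)// lerD ?hd// ?(le_lt_trans lL)//.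
  by rewrite /eta mulrAC ler_pdivrMr// ler_wpM2l ?ltW// ltr_nat.
move=> eta0; elim=> [|p l' IH] vl'.
  by exists [::]; split => //; rewrite /vsum !big_nil mulr0 addr0.
move: vl'; rewrite /valid /= => /andP[/andP[/andP[/andP[p0 pp] pw] hl] /andP[dl pl]].
have [|L [vL lL hL dL]] := IH; first by rewrite /valid hl pl.
have [lp vlp hlp] := V_approx eta0 p0 pp pw.
exists (lp ++ L); split.
- apply/andP; split.
    rewrite all_cat; case/andP: vL => -> _; rewrite andbT.
    by case/andP: (valid_sub p0 pw vlp).
  rewrite pairwise_cat; case/andP: (vL) => _ ->; case/andP: (vlp) => hlp' ->; rewrite !andbT.
  apply/allrelP => q r qlp rL.
  have /allP/(_ r rL) := dL p dl.
  have /andP[/andP[h1 h2] h3] := allP hlp' _ qlp.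
  by rewrite /itv_disj => /orP[h|h]; rewrite ?(le_trans h3 h) ?(le_trans h h1) ?orbT.
- by rewrite len_cat len_cons lerD// (len_valid pp vlp).
- rewrite vsum_cat /vsum big_cons -/(vsum V l') -/(vsum F lp) -/(vsum F L) /= -natr1 mulrDr mulr1.
  rewrite ger0_norm; last first.
    by have := V_incr p0 pp pw (l := [::]) isT; rewrite /vsum big_nil.
  lra.
- move=> q /= /andP[qp /dL qL]; rewrite all_cat qL andbT.
  apply/allP => r rlp; case/andP: (vlp) => /allP/(_ r rlp)/andP[/andP[h1 h2] h3] _.
  by move: qp; rewrite /itv_disj => /orP[h|h]; rewrite ?(le_trans h h1) ?(le_trans h3 h) ?orbT.
Qed.

Lemma V_ge s t : 0 <= s -> s <= t -> t <= omega -> `|F t - F s| <= V t - V s.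
Proof.
move=> s0 st tw; have := V_incr s0 st tw (l := [:: (s, t)]).
rewrite /vsum big_seq1; apply.
by rewrite /valid /= /in_seg /= lexx st lexx.
Qed.

Lemma acl_VF : acl (fun x => V x - F x).
Proof.
move=> eps e0; have e20 : 0 < eps / 2 by rewrite divr_gt0.
have [d d0 hd] := acl_V e20; exists d => // l vl ll.
have := hd l vl ll; rewrite ler_pdivlMr//; apply: le_trans.
rewrite /vsum mulr_suml big_seq [leRHS]big_seq; apply: ler_sum => p pl.
case/andP: vl => /allP/(_ p pl)/andP[/andP[h1 h2] h3] _.
have h := V_ge h1 h2 h3.
have V0 : 0 <= V p.2 - V p.1 by exact: le_trans h.
rewrite [`|V _ - V _|]ger0_norm// (_ : _ - _ = (V p.2 - V p.1) - (F p.2 - F p.1)); last by ring.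
by rewrite (le_trans (ler_normB _ _))// ger0_norm// mulr_natr mulr2n lerD2l.
Qed.

End abs_cont.

End interval_lists.

(** * Monotone absolutely continuous functions as primitives, by Radon-Nikodym *)

Section primitive.
Context (R : realType).
Variables (omega : R) (G : R -> R).
Hypothesis omega0 : 0 < omega.
Hypothesis ndG : forall s t, 0 <= s -> s <= t -> t <= omega -> G s <= G t.
Hypothesis acG : acl omega G.
Local Notation lam := (@lebesgue_measure R).

Let clamp (x : R) := Num.max 0 (Num.min x omega).

Let clamp_ge0 x : 0 <= clamp x. Proof. by rewrite le_max lexx. Qed.

Let clamp_le x : clamp x <= omega.
Proof. by rewrite ge_max (ltW omega0) ge_min lexx orbT. Qed.

Let clamp_homo : {homo clamp : x y / x <= y}.
Proof.
move=> x y xy; rewrite ge_max clamp_ge0 /= le_max; apply/orP; right.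
by rewrite le_min !ge_min xy lexx orbT.
Qed.

Let clamp_id x : 0 <= x <= omega -> clamp x = x.
Proof. by move=> /andP[x0 xw]; rewrite /clamp min_l// max_r. Qed.

Let clamp_lip x y : x <= y -> clamp y - clamp x <= y - x.
Proof.
move=> xy; have := omega0; rewrite /clamp.
have [h1|h1] := leP x omega; have [h2|h2] := leP y omega.
- by have [h3|h3] := leP 0 x; have [h4|h4] := leP 0 y; lra.
- by have [h3|h3] := leP 0 x; have [h4|h4] := leP 0 omega; lra.
- by have [h3|h3] := leP 0 omega; have [h4|h4] := leP 0 y; lra.
- by have [h3|h3] := leP 0 omega; lra.
Qed.

(** [G] extended by constants, since a Stieltjes measure needs a monotone function on the whole
    line. *)
Definition Gc x := G (clamp x).

Lemma Gc_nd : {homo Gc : x y / x <= y}.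
Proof. by move=> x y xy; apply: ndG => //; exact: clamp_homo. Qed.

Lemma Gc_acl eps : 0 < eps -> exists2 delta, 0 < delta &
  forall l, all (fun p => p.1 <= p.2) l -> pairwise (@itv_disj R) l -> len l < delta ->
    \sum_(p <- l) (Gc p.2 - Gc p.1) <= eps.
Proof.
move=> e0; have [d d0 hd] := acG e0; exists d => // l hl dl ll.
pose l' := [seq (clamp p.1, clamp p.2) | p <- l].
have vl' : valid 0 omega l'.
  apply/andP; split; last exact: pairwise_map_disj.
  apply/allP => _ /mapP[p /(allP hl) pp ->].
  by rewrite /in_seg /= clamp_ge0 clamp_le clamp_homo.
have : len l' < d.
  apply: le_lt_trans ll; rewrite /len big_map big_seq [leRHS]big_seq.
  by apply: ler_sum => p /(allP hl) pp; exact: clamp_lip.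
move=> /(hd _ vl'); apply: le_trans; rewrite /vsum big_map.
by apply: ler_sum => p _; exact: ler_norm.
Qed.

Lemma Gc_continuous : continuous Gc.
Proof.
move=> x; apply/cvgrPdist_lt => e e0.
have e20 : 0 < e / 2 by rewrite divr_gt0.
have [d d0 hd] := Gc_acl e20.
have h s t : s <= t -> t - s < d -> `|Gc t - Gc s| < e.
  move=> st std; rewrite ger0_norm ?subr_ge0 ?Gc_nd//.
  have := hd [:: (s, t)]; rewrite /len /= !big_seq1 st => /(_ isT isT std).
  move=> /le_lt_trans; apply; lra.
near=> t; have xt : `|x - t| < d by near: t; exact: cvgr_dist_lt.
have [xt'|tx] := leP x t.
  by rewrite distrC h//; move: xt; rewrite distrC ger0_norm ?subr_ge0.
by rewrite h ?(ltW tx)//; move: xt; rewrite ger0_norm// subr_ge0 ltW.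
Unshelve. all: by end_near. Qed.

Lemma Gc_rc : right_continuous Gc.
Proof. exact/right_continuousW/Gc_continuous. Qed.

HB.instance Definition _ := isCumulative.Build R _ R Gc Gc_nd Gc_rc.

Let nu := lebesgue_stieltjes_measure Gc.

Let nu_oc a b : a <= b -> nu `]a, b]%classic = (Gc b - Gc a)%:E.
Proof.
move=> ab; rewrite /nu /lebesgue_stieltjes_measure/= /measure_extension/=.
by rewrite measurable_mu_extE/= ?wlength_itv_bnd//; exact: is_ocitv.
Qed.

(** Open, so that an open set met with [D] is a union of bounded open intervals; bounded, so that
    the measure is finite; and containing the segment. *)
Let D : set R := `](-1), (omega + 1)[%classic.
Let mD : measurable D. Proof. exact: measurable_itv. Qed.

Let nuD : (nu D < +oo)%E.
Proof.
apply: (@le_lt_trans _ _ (nu `](-1), (omega + 1)]%classic)).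
  by apply: le_measure; rewrite ?inE//; exact: subset_itv_oo_oc.
by rewrite nu_oc ?ltry//; have := omega0; lra.
Qed.

Let nu' := mfrestr mD nuD.

(** A null set is covered inside [D] by an open set [W] of length below the [delta] of [Gc].
    Finitely many components of [W] form a list of total length below [delta], so their [nu]
    measures sum to at most [e], and so does the whole series. *)
Lemma nu_dom : nu' `<< lam.
Proof.
apply/null_content_dominatesP => A mA A0.
apply/eqP; rewrite eq_le measure_ge0 andbT; apply/lee_addgt0Pr => e e0; rewrite add0e.
have [d d0 hd] := Gc_acl e0.
pose AD := A `&` D.
have mAD : measurable AD by exact: measurableI.
have lAD : lam AD = 0%E.
  by apply: subset_measure0 A0 => //; exact: subIsetl.
have ADfin : (lam AD < +oo)%E by rewrite lAD ltry.
have [U [oU ADU UAD]] := lebesgue_regularity_outer mAD ADfin d0.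
pose W := U `&` D.
have oW : open W by apply: openI => //; exact: interval_open.
have lW : (lam W < d%:E)%E.
  have mU : measurable U by exact: open_measurable.
  apply: (@le_lt_trans _ _ (lam U)).
    by apply: le_measure; [rewrite inE; exact: open_measurable|rewrite inE|exact: subIsetl].
  rewrite -(setDUK ADU) measureU//; [|exact: measurableD|by rewrite setDIK].
  by rewrite [X in (X + _)%E]lAD add0e.
pose I := open_disjoint_itv oW.
have WI : W = \bigcup_k I k by exact: open_disjoint_itv_bigcup.
have oI k : open (I k) by exact: open_disjoint_itv_open.
have mI k : measurable (I k) by exact: open_measurable.
have iI k : is_interval (I k) by exact: open_disjoint_itv_is_interval.
have tI : trivIset setT I by exact: open_disjoint_itv_trivIset.
have ID k : I k `<=` D.
  move=> x Ikx; have : W x by rewrite WI; exists k.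
  by case.
have IE k : I k = `]inf (I k), sup (I k)[%classic.
  rewrite -[LHS](proj1 (interior_id _) (oI k)) interval_bounded_interior//.
  - by exists (-1) => x /ID; rewrite /D /= in_itv /= => /andP[/ltW].
  - by exists (omega + 1) => x /ID; rewrite /D /= in_itv /= => /andP[_ /ltW].
(* Components may be empty; [P] selects the nonempty ones, whose end points are in order. *)
pose p k := (inf (I k), sup (I k)).
pose P k := (p k).1 < (p k).2.
have nP k : ~~ P k -> I k = set0.
  rewrite /P -leNgt => h; rewrite IE; apply/seteqP; split=> // x /=; rewrite in_itv /= => /andP[h1 h2].
  by have := lt_le_trans (lt_trans h1 h2) h; rewrite ltxx.
pose l K := [seq p k | k <- iota 0 K & P k].
have hl K : all (fun q => q.1 <= q.2) (l K).
  by apply/allP => _ /mapP[k + ->]; rewrite mem_filter => /andP[Pk _]; exact: ltW.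
have disj j k : P j -> P k -> j != k -> itv_disj (p j) (p k).
  move=> Pj Pk jk; rewrite /itv_disj; case: leP => //= h1; rewrite leNgt; apply/negP => h2.
  pose m := Num.max (p j).1 (p k).1; pose M := Num.min (p j).2 (p k).2.
  have Pj' : (p j).1 < (p j).2 by [].
  have Pk' : (p k).1 < (p k).2 by [].
  have mM : m < M by rewrite gt_max !lt_min Pj' h2 h1 Pk'.
  pose z := (m + M) / 2.
  have zm : m < z by rewrite /z; lra.
  have zM : z < M by rewrite /z; lra.
  move: zm zM; rewrite gt_max lt_min => /andP[z1 z2] /andP[z3 z4].
  move/eqP: jk; apply; apply: (tI j k Logic.I Logic.I); exists z; split.
    by rewrite IE /= in_itv /= z1.
  by rewrite IE /= in_itv /= z2.
have dl K : pairwise (@itv_disj R) (l K).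
  rewrite pairwise_map; apply: (@sub_in_pairwise _ P (fun j k => j != k)).
  - by move=> j k Pj Pk jk; exact: disj.
  - exact: filter_all.
  - by rewrite -uniq_pairwise filter_uniq ?iota_uniq.
have sumE (c : nat -> R) K : (\sum_(q <- [seq c k | k <- iota 0 K & P k]) q)%:E =
    (\sum_(k < K) (if P k then (c k)%:E else 0))%E.
  rewrite big_map big_filter -sumEFin big_mkcond /= -(big_mkord xpredT (fun k => if P k then (c k)%:E else 0%E)).
  by rewrite /index_iota subn0; apply: eq_bigr => k _; case: ifP.
have ll K : len (l K) < d.
  rewrite -lte_fin; apply: le_lt_trans lW.
  have -> : len (l K) = \sum_(q <- [seq (p k).2 - (p k).1 | k <- iota 0 K & P k]) q.
    by rewrite /len !big_map.
  rewrite sumE; apply: (@le_trans _ _ (\sum_(k < K) lam (I k))%E).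
    apply: lee_sum => k _; case: ifP => // Pk.
    rewrite [I k]IE lebesgue_measure_itv /= lte_fin ifT//.
  have -> : (\sum_(k < K) lam (I k))%E = lam (\big[setU/set0]_(k < K) I k).
    by rewrite measure_bigsetU.
  apply: le_measure; [|rewrite inE; exact: open_measurable|].
    by rewrite inE; apply: bigsetU_measurable => k _; exact: mI.
  by rewrite WI; exact: bigsetU_bigcup.
have nuI K : (\sum_(k < K) nu (I k) <= e%:E)%E.
  have := hd _ (hl K) (dl K) (ll K); rewrite -lee_fin; apply: le_trans.
  have -> : \sum_(q <- l K) (Gc q.2 - Gc q.1) =
      \sum_(q <- [seq Gc (p k).2 - Gc (p k).1 | k <- iota 0 K & P k]) q.
    by rewrite !big_map.
  rewrite sumE; apply: lee_sum => k _; case: ifPn => Pk; last first.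
    by rewrite (nP _ Pk) /nu (measure0 (lebesgue_stieltjes_measure Gc)).
  rewrite -nu_oc ?(ltW Pk)//; apply: le_measure; rewrite ?inE//.
    exact: mI.
  by move=> x; rewrite {1}IE /= !in_itv /= => /andP[-> /ltW ->].
apply: (@le_trans _ _ (nu W)).
  rewrite /nu' /mfrestr /mrestr le_measure ?inE//; first exact: open_measurable.
  by move=> x [Ax Dx]; split => //; exact: ADU.
rewrite WI; apply: (@le_trans _ _ (\sum_(k <oo) nu (I k))%E).
  apply: measure_sigma_subadditive => //; last by apply: bigcup_measurable => k _; exact: mI.
apply: lime_le; first exact: is_cvg_nneseries.
by apply: nearW => K; rewrite big_mkord.
Qed.

Lemma nd_primitive : exists g : R -> R, [/\ forall x, 0 <= g x,
  lam.-integrable setT (EFin \o g) &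
  forall x, 0 <= x <= omega -> G x = G 0 + Rintegral lam `[0, x] g].
Proof.
have [f [f0 ffin fint fE]] := @radon_nikodym_sigma_finite _ (measurableTypeR R) R lam
  (@mfrestr _ (measurableTypeR R) R D (lebesgue_stieltjes_measure Gc) mD nuD) nu_dom.
have intg : lam.-integrable setT (EFin \o (fine \o f)).
  by apply: eq_integrable fint => // x _ /=; rewrite fineK.
exists (fine \o f); split => //.
- by move=> x; rewrite fine_ge0.
- move=> x /andP[x0 xw].
  have nuE : nu' `]0, x]%classic = (Gc x - Gc 0)%:E.
    rewrite /nu' /mfrestr /mrestr setIidl ?nu_oc// => y; rewrite /D /= !in_itv /= => /andP[y0 yx].
    by apply/andP; split; lra.
  have h := etrans (esym nuE) (fE `]0, x]%classic (measurable_itv _)).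
  rewrite /Gc clamp_id ?x0// clamp_id ?lexx ?(ltW omega0)// in h.
  rewrite -Rintegral_itv_obnd_cbnd; last first.
    exact: (integrableS measurableT _ _ intg).
  rewrite /Rintegral (eq_integral f); last by move=> y _ /=; rewrite fineK.
  by rewrite -h /= addrC subrK.
Qed.

End primitive.

Section ac_primitive.
Context (R : realType).
Local Notation lam := (@lebesgue_measure R).
Variables (omega : R) (F : R -> R).
Hypothesis omega0 : 0 < omega.
Hypothesis acF : acl omega F.

(** The two monotone functions [V F] and [V F - F] are primitives of integrable densities, and [F]
    is their difference. *)
Lemma ac_primitive : exists2 g : R -> R, lam.-integrable setT (EFin \o g) &
  forall x, 0 <= x <= omega -> F x = F 0 + Rintegral lam `[0, x] g.
Proof.
have acV := acl_V omega0 acF; have acVF := acl_VF omega0 acF.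
have nd1 s t : 0 <= s -> s <= t -> t <= omega -> V F s <= V F t.
  by move=> s0 st tw; rewrite -subr_ge0 (le_trans _ (V_ge omega0 acF s0 st tw)).
have nd2 s t : 0 <= s -> s <= t -> t <= omega -> V F s - F s <= V F t - F t.
  move=> s0 st tw; have := V_ge omega0 acF s0 st tw.
  by rewrite ler_norml => /andP[_]; lra.
have [g1 [_ ig1 g1E]] := nd_primitive omega0 nd1 acV.
have [g2 [_ ig2 g2E]] := nd_primitive omega0 nd2 acVF.
exists (fun x => g1 x - g2 x); first by have := integrableB measurableT ig1 ig2.
move=> x x0w; rewrite RintegralB//; last 2 first.
- exact: (integrableS measurableT).
- exact: (integrableS measurableT).
have := g1E x x0w; have := g2E x x0w; lra.
Qed.

End ac_primitive.

Section ae_derivative.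
Context (R : realType).
Local Notation lam := (@lebesgue_measure R).

Lemma ae_lebS (P Q : R -> Prop) : (forall x, P x -> Q x) ->
  {ae lam, forall x, P x} -> {ae lam, forall x, Q x}.
Proof. by move=> h; apply: filterS => //; exact: (ae_filter_ringOfSetsType lam). Qed.

Lemma ae_lebS2 (P P' Q : R -> Prop) : (forall x, P x -> P' x -> Q x) ->
  {ae lam, forall x, P x} -> {ae lam, forall x, P' x} -> {ae lam, forall x, Q x}.
Proof. by move=> h; apply: filterS2 => //; exact: (ae_filter_ringOfSetsType lam). Qed.

Lemma primitive_ae (g : R -> R) : lam.-integrable setT (EFin \o g) ->
  {ae lam, forall x : R, 0 < x -> is_derive x 1 (fun y : R => Rintegral lam `[0, y] g) (g x)}.
Proof.
move=> ig.
have ig' (y : R) : lam.-integrable [set` Interval (BLeft 0) (BRight y)] (EFin \o g).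
  by apply: (integrableS measurableT) => //; exact: measurable_itv.
have lg : locally_integrable [set: R] g by apply: open_integrable_locally => //; exact: openT.
have := FTC1 ig' lg; apply: ae_lebS => x h x0.
have [d1 d2] := h x0.
exact: (DeriveDef d1 (etrans (esym (derive1E _ _)) d2)).
Qed.

Variable omega : R.
Hypothesis omega0 : 0 < omega.

Lemma ac_is_derive (F g : R -> R) : lam.-integrable setT (EFin \o g) ->
  (forall x, 0 <= x <= omega -> F x = F 0 + Rintegral lam `[0, x] g) ->
  {ae lam, forall x : R, 0 < x < omega -> is_derive x 1 F (g x)}.
Proof.
move=> ig FE; have := primitive_ae ig; apply: ae_lebS => x h /andP[x0 xw].
have := h x0 => d.
have d' : is_derive x 1 (fun y : R => F 0 + Rintegral lam `[0, y] g) (g x).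
  by have := is_deriveD (is_derive_cst (F 0) x 1) d; rewrite add0r.
apply: near_eq_is_derive d'.
near=> y; rewrite [RHS]FE//; apply/andP; split; apply: ltW; near: y.
  exact: lt_nbhsr.
exact: lt_nbhsl.
Unshelve. all: by end_near. Qed.

End ae_derivative.

(** * One-sided derivatives and integration by parts *)

Section within_derivative.
Context (R : realType).
Variable omega : R.
Hypothesis omega0 : 0 < omega.
Local Notation lam := (@lebesgue_measure R).
Implicit Types (f s : R -> R).

Definition has_rderiv f (x l : R) :=
  (t - x)^-1 * (f t - f x) @[t --> within `[0, omega] x^'] --> l.

Lemma has_rderivP f x l : has_rderiv f x l <-> forall e, 0 < e -> exists2 d, 0 < d &
  forall t, 0 <= t <= omega -> t != x -> `|x - t| < d -> `|l - (t - x)^-1 * (f t - f x)| < e.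
Proof.
split=> [/cvgrPdist_lt h e /h /nbhs_ballP[d /= d0 hd]|h].
  exists d => // t tw tx xt; apply: (hd t xt tx).
  by rewrite /= in_itv.
apply/cvgrPdist_lt => e /h[d d0 hd]; apply/nbhs_ballP; exists d => //= t xt tx tw.
by apply: hd => //; move: tw; rewrite /= in_itv.
Qed.

Lemma is_derive_eps f (x l : R) : is_derive x 1 f l <-> forall e, 0 < e -> exists2 d, 0 < d &
  forall t, t != x -> `|x - t| < d -> `|l - (t - x)^-1 * (f t - f x)| < e.
Proof.
split=> [[dfx dfE] e e0|h].
  move: dfx; rewrite /derivable => dfx.
  have c : h^-1 *: ((f \o shift x) (h *: 1) - f x) @[h --> 0^'] --> l.
    by rewrite -dfE; exact: dfx.
  move/cvgrPdist_lt : c => /(_ e e0)/nbhs_ballP[d /= d0 hd]; exists d => // t tx xt.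
  have := hd (t - x); rewrite /ball /= sub0r normrN distrC => /(_ xt).
  rewrite subr_eq0 => /(_ tx); rewrite /shift /= [_ *: 1]mulr1 subrK.
  by [].
have c : h^-1 *: ((f \o shift x) (h *: 1) - f x) @[h --> 0^'] --> l.
  apply/cvgrPdist_lt => e /h[d d0 hd]; apply/nbhs_ballP; exists d => //= u u0 un0.
  have := hd (u + x); rewrite addrK /shift /= [_ *: 1]mulr1; apply.
    by rewrite -subr_eq0 addrK.
  by move: u0; rewrite /ball /= sub0r opprD addrA addrAC subrr sub0r.
by apply: DeriveDef; [apply/cvg_ex; exists l|exact: (cvg_lim _ c)].
Qed.

Lemma is_derive_rderiv f (x l : R) : is_derive x 1 f l -> has_rderiv f x l.
Proof.
move=> /is_derive_eps h; apply/has_rderivP => e /h[d d0 hd].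
by exists d => // t _; exact: hd.
Qed.

Lemma has_rderiv_is_derive f (x l : R) : 0 < x < omega -> has_rderiv f x l -> is_derive x 1 f l.
Proof.
move=> /andP[x0 xw] /has_rderivP h; apply/is_derive_eps => e /h[d d0 hd].
exists (Num.min d (Num.min x (omega - x))); first by rewrite !lt_min d0 x0 subr_gt0.
move=> t tx; rewrite !lt_min => /and3P[h1 h2 h3]; apply: hd => //.
move: h2 h3; rewrite !ltr_norml => /andP[_ h2] /andP[h3 _].
by apply/andP; split; lra.
Qed.

Lemma has_rderiv_continuous f x l : has_rderiv f x l ->
  f @ within `[0, omega] (nbhs x) --> f x.
Proof.
move=> /has_rderivP/(_ 1 ltr01)[d d0 hd]; apply/cvgrPdist_lt => e e0.
pose L := `|l| + 1; have L0 : 0 < L by rewrite ltr_wpDl.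
apply/nbhs_ballP; exists (Num.min d (e / L)) => /=; first by rewrite lt_min d0 divr_gt0.
move=> t; rewrite /ball /= lt_min => /andP[td te]; rewrite in_itv /= => tw.
have [->|tx] := eqVneq t x; first by rewrite subrr normr0.
have := hd t tw tx td; rewrite ltr_distlC => h.
have tx0 : t - x != 0 by rewrite subr_eq0.
have -> : f x - f t = - ((t - x) * ((t - x)^-1 * (f t - f x))) by rewrite mulVKf// opprB.
rewrite normrN normrM distrC; have hl : `|(t - x)^-1 * (f t - f x)| <= L.
  have := hd t tw tx td; set q := _ * _ => hq.
  by rewrite -[q](subrK l) (le_trans (ler_normD _ _))// addrC lerD2l distrC ltW.
apply: (le_lt_trans (ler_wpM2l (normr_ge0 _) hl)).
by rewrite -ltr_pdivlMr.
Qed.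

Lemma rderiv_oo f f' : (forall x, 0 <= x <= omega -> has_rderiv f x (f' x)) ->
  derivable_oo_LRcontinuous f 0 omega /\ {in `]0, omega[, derive1 f =1 f'}.
Proof.
move=> h.
have hc : {within `[0, omega], continuous f}.
  apply/subspace_continuousP => x; rewrite /= in_itv /= => xw.
  exact: has_rderiv_continuous (h x xw).
split; last first.
  move=> x; rewrite in_itv /= => xw; rewrite derive1E.
  have [x0 x1] := andP xw.
  by have [_ ->] := has_rderiv_is_derive xw (h x (introT andP (conj (ltW x0) (ltW x1)))).
have /(continuous_within_itvP _ omega0)[_ cl cr] := hc.
split => // x; rewrite in_itv /= => xw; have [x0 x1] := andP xw.
by case: (has_rderiv_is_derive xw (h x (introT andP (conj (ltW x0) (ltW x1))))).
Qed.

Lemma acl_continuous F : acl omega F -> {within `[0, omega], continuous F}.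
Proof.
move=> acF; apply/subspace_continuousP => x; rewrite /= in_itv /= => xw.
apply/cvgrPdist_lt => e e0; have e20 : 0 < e / 2 by rewrite divr_gt0.
have [d d0 hd] := acF _ e20.
have h u t : 0 <= u -> u <= t -> t <= omega -> t - u < d -> `|F t - F u| < e.
  move=> u0 ut tw tud; have := hd [:: (u, t)].
  rewrite /valid /in_seg /len /vsum !big_seq1 /= u0 ut tw => /(_ isT tud).
  by move=> /le_lt_trans; apply; lra.
have [x0 x1] := andP xw.
apply/nbhs_ballP; exists d => //= t xt; rewrite /= in_itv /= => /andP[t0 t1].
move: xt; rewrite /ball /=; have [xt|tx] := leP x t.
  by rewrite distrC ger0_norm ?subr_ge0// distrC => ?; exact: h.
by rewrite ger0_norm ?subr_ge0 ?(ltW tx)// => ?; apply: h => //; exact: ltW.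
Qed.

Lemma ae_neq (a : R) : {ae lam, forall x : R, x != a}.
Proof.
exists [set a]; split => //; first by rewrite lebesgue_measure_set1.
by move=> x /= /negP; rewrite negbK => /eqP.
Qed.

Lemma ae_seg (P : R -> Prop) : {ae lam, forall x : R, 0 < x < omega -> P x} ->
  {ae lam, forall x : R, 0 <= x <= omega -> P x}.
Proof.
move=> h.
have : {ae lam, forall x : R, 0 <= x < omega -> P x}.
  apply: ae_lebS2 h (ae_neq 0) => x hx x0 /andP[x0' xw]; apply: hx.
  by rewrite xw andbT lt_neqAle eq_sym x0.
move=> h'; apply: ae_lebS2 h' (ae_neq omega) => x hx xw /andP[x0 xw']; apply: hx.
by rewrite x0 lt_neqAle xw.
Qed.

Section test_function.
Variables (s s' : R -> R) (Ls : R).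
Hypothesis ds : forall x : R, is_derive x 1 s (s' x).
Hypothesis cs' : continuous s'.
Hypothesis s1 : forall x, `|s x| <= 1.
Hypothesis s'L : forall x, `|s' x| <= Ls.

Lemma within_cont (f : R -> R) : continuous f -> {within `[0, omega], continuous f}.
Proof. by move=> cf; apply: continuous_subspaceT. Qed.

Lemma c1_by_parts f f' : (forall x, 0 <= x <= omega -> has_rderiv f x (f' x)) ->
  {within `[0, omega], continuous f'} ->
  Rintegral lam `[0, omega] (fun x => s x * f' x) =
  s omega * f omega - s 0 * f 0 - Rintegral lam `[0, omega] (fun x => s' x * f x).
Proof.
move=> hf cf'; have [h1 h2] := rderiv_oo hf.
have [h3 h4] := @rderiv_oo s s' (fun x _ => is_derive_rderiv (ds x)).
by rewrite (Rintegration_by_parts omega0 (within_cont cs') h3 h4 cf' h1 h2).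
Qed.

Lemma s_lip x y : x <= y -> `|s y - s x| <= Ls * (y - x).
Proof.
move=> xy; have [//|z _ ->] := @MVT_segment R s s' x y xy (fun z _ => ds z).
  apply: continuous_subspaceT => z; apply: differentiable_continuous.
  by apply/derivable1_diffP; case: (ds z).
by rewrite normrM [`|y - x|]ger0_norm ?subr_ge0// ler_wpM2r ?subr_ge0.
Qed.

Lemma ac_bounded F : acl omega F -> exists2 M, 0 <= M & forall x, 0 <= x <= omega -> `|F x| <= M.
Proof.
move=> acF; exists (`|F 0| + V F omega).
  rewrite addr_ge0//; have := vsum_V omega0 acF (x := omega) (l := [::]).
  by rewrite /vsum big_nil lexx (ltW omega0); apply.
move=> x /andP[x0 xw]; have := V_ge omega0 acF (lexx 0) x0 xw.
have V0 : 0 <= V F 0.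
  have := vsum_V omega0 acF (x := 0) (l := [::]); rewrite /vsum big_nil lexx (ltW omega0); exact.
have Vx : V F x <= V F omega.
  by rewrite -subr_ge0 (le_trans _ (V_ge omega0 acF x0 xw (lexx _))).
have : `|F x| <= `|F 0| + `|F x - F 0| by rewrite addrC -{1}[F x](subrK (F 0)) ler_normD.
lra.
Qed.

Lemma acl_mul F : acl omega F -> acl omega (fun x => s x * F x).
Proof.
move=> acF eps e0; have e20 : 0 < eps / 2 by rewrite divr_gt0.
have [d d0 hd] := acF _ e20; have [M M0 hM] := ac_bounded acF.
have Ls0 : 0 <= Ls by rewrite (le_trans _ (s'L 0)).
pose K := Ls * M + 1.
have K0 : 0 < K by rewrite ltr_wpDl// mulr_ge0.
exists (Num.min d (eps / 2 / K)); first by rewrite lt_min d0 divr_gt0.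
move=> l vl; rewrite lt_min => /andP[ll1 ll2].
rewrite (@le_trans _ _ (\sum_(p <- l) (`|F p.2 - F p.1| + Ls * M * (p.2 - p.1))))//.
  rewrite /vsum big_seq [leRHS]big_seq; apply: ler_sum => p pl.
  case/andP: vl => /allP/(_ p pl)/andP[/andP[h1 h2] h3] _.
  have -> : s p.2 * F p.2 - s p.1 * F p.1 = s p.2 * (F p.2 - F p.1) + F p.1 * (s p.2 - s p.1) by ring.
  rewrite (le_trans (ler_normD _ _))// !normrM lerD//.
    by rewrite ler_piMl.
  rewrite mulrAC mulrC ler_pM// ?hM ?h1 ?(le_trans h2)//.
  exact: s_lip.
rewrite big_split /= -mulr_sumr -/(vsum F l) -/(len l).
have := hd _ vl ll1.
have : Ls * M * len l <= K * len l.
  rewrite ler_wpM2r ?lerDl// /len big_seq; apply: sumr_ge0 => p pl.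
  by case/andP: vl => /allP/(_ p pl)/andP[/andP[_ h2] _] _; rewrite subr_ge0.
have : K * len l <= eps / 2 by rewrite mulrC -ler_pdivlMr// ltW.
lra.
Qed.

(** [F] is only absolutely continuous, so classical integration by parts does not apply. The product
    [s * F] is absolutely continuous, hence a primitive of some [h], and [h = s * g + s' * F] almost
    everywhere by the product rule. *)
Lemma ac_by_parts F g : acl omega F -> lam.-integrable setT (EFin \o g) ->
  (forall x, 0 <= x <= omega -> F x = F 0 + Rintegral lam `[0, x] g) ->
  Rintegral lam `[0, omega] (fun x => s x * g x) =
  s omega * F omega - s 0 * F 0 - Rintegral lam `[0, omega] (fun x => s' x * F x).
Proof.
move=> acF ig FE.
have [h ih hE] := ac_primitive omega0 (acl_mul acF).
have dF := ac_is_derive ig FE.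
have dsF := ac_is_derive ih hE.
have hae : {ae lam, forall x, 0 < x < omega -> h x = s x * g x + s' x * F x}.
  apply: ae_lebS2 dF dsF => x dFx dsFx xw.
  have [_ e1] := dsFx xw; have [_ e2] := is_deriveM (ds x) (dFx xw).
  by rewrite -e1 [LHS]e2 [s' x * _]mulrC.
have -> : s omega * F omega - s 0 * F 0 = Rintegral lam `[0, omega] h.
  by rewrite hE ?lexx ?(ltW omega0)// addrC addKr.
have cF := acl_continuous acF.
have is'F : lam.-integrable `[0, omega] (EFin \o (fun x => s' x * F x)).
  apply: continuous_compact_integrable; first exact: segment_compact.
  apply/subspace_continuousP => x xw; apply: cvgM.
    by have /subspace_continuousP := within_cont cs'; exact.
  by move/subspace_continuousP : cF; exact.
have ms : measurable_fun setT s.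
  apply: continuous_measurable_fun => x; apply: differentiable_continuous.
  by apply/derivable1_diffP; case: (ds x).
have isg : lam.-integrable `[0, omega] (EFin \o (fun x => s x * g x)).
  apply: (integrableS measurableT) => //.
  apply: (le_integrable measurableT _ _ ig) => /=.
    apply/measurable_EFinP; apply: measurable_funM => //.
    by case/integrableP: ig => /measurable_EFinP.
  by move=> x _; rewrite lee_fin normrM ler_piMl.
apply/eqP; rewrite eq_sym subr_eq; apply/eqP.
rewrite -RintegralD//; congr fine; apply: ae_eq_integral => //.
- have ih' : lam.-integrable `[0, omega] (EFin \o h) by exact: (integrableS measurableT).
  by case/integrableP: ih'.
- have isgF := @integrableD _ _ _ lam `[0, omega]%classic (measurable_itv _) _ _ isg is'F.
  by case/integrableP: isgF.
- apply: ae_lebS (ae_seg hae) => x hx; rewrite /= in_itv /= => xw.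
  by rewrite hx.
Qed.

End test_function.

End within_derivative.

(** * The sine basis *)

Section lebesgue_on_interval.
Context (R : realType).
Variable omega : R.
Hypothesis omega0 : 0 < omega.
Local Notation lam := (@lebesgue_measure R).
Local Notation mo := (lebesgue_on omega).
Local Notation D := (`[0, omega]%classic : set (measurableTypeR R)).

Lemma ae_mo (P : R -> Prop) : {ae mo, forall x : R, P x} <->
  {ae lam, forall x : R, 0 <= x <= omega -> P x}.
Proof.
split=> -[N [mN N0 PN]].
- exists (N `&` D); split => //; first exact: measurableI.
  by move=> x /= /not_implyP[xw nP]; split; [exact: PN|rewrite /= in_itv].
- exists (N `|` ~` D); split.
  + by apply: measurableU => //; exact: measurableC.
  + rewrite /lebesgue_on /= /mrestr setIUl setICl setU0.
    apply/eqP; rewrite eq_le measure_ge0 andbT -N0 le_measure ?inE//.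
    exact: measurableI.
  + move=> x /= nP; have [xw|xw] := pselect (0 <= x <= omega); [left|right].
      by apply: PN => /= /(_ xw).
    by rewrite /= in_itv.
Qed.

Lemma ae_moT (P : R -> Prop) : (forall x, 0 <= x <= omega -> P x) -> {ae mo, forall x : R, P x}.
Proof. by move=> h; apply/ae_mo; apply: aeW. Qed.

Lemma integral_mo (f : R -> \bar R) : measurable_fun setT f ->
  (\int[mo]_x f x = \int[lam]_(x in D) f x)%E.
Proof.
move=> mf; rewrite -(@eq_measure_integral _ _ _ D lam mo); last first.
  by move=> A mA AD; rewrite /lebesgue_on /= /mrestr setIidl.
rewrite [RHS]integral_mkcond; apply: ae_eq_integral => //.
- by apply/measurable_restrict => //; rewrite setTI; apply: measurable_funS mf.
- by apply: ae_moT => x xw _; rewrite patchE mem_set//= in_itv.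
Qed.

Lemma integrable_mo (f : R -> \bar R) : measurable_fun setT f ->
  mo.-integrable setT f <-> lam.-integrable D f.
Proof.
move=> mf; split=> /integrableP[h1 h2]; apply/integrableP; split => //.
- exact: measurable_funS mf.
- by rewrite -integral_mo//; exact: measurableT_comp.
- by rewrite integral_mo//; exact: measurableT_comp.
Qed.

Lemma Rintegral_mo (f : R -> R) : measurable_fun setT f ->
  Rintegral mo setT f = Rintegral lam D f.
Proof. by move=> mf; rewrite /Rintegral integral_mo//; exact/measurable_EFinP. Qed.

Lemma sqint_bounded (f : R -> R) M : measurable_fun setT f ->
  (forall x, 0 <= x <= omega -> `|f x| <= M) -> sqint mo f.
Proof.
move=> mf fM; split => //; apply/integrable_mo.
  by apply/measurable_EFinP; exact: measurable_funX.
apply: (@le_integrable _ _ _ _ _ _ _ (cst (M ^+ 2)%:E)) => //.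
- by apply/measurable_EFinP; apply: measurable_funX; exact: measurable_funS mf.
- move=> x; rewrite /= in_itv /= => /fM h; rewrite lee_fin normrX.
  apply: le_trans (ler_norm _); have M0 := le_trans (normr_ge0 _) h.
  by rewrite ler_sqr ?nnegrE.
- have h : lam.-integrable D (EFin \o (fun=> M ^+ 2)).
    apply: continuous_compact_integrable; first exact: segment_compact.
    by apply: continuous_subspaceT => x; exact: cst_continuous.
  exact: h.
Qed.

Lemma Rintegral_c1 (F f : R -> R) : (forall x : R, is_derive x 1 F (f x)) -> continuous f ->
  Rintegral lam `[0, omega] f = F omega - F 0.
Proof.
move=> dF cf; have [h1 h2] := @rderiv_oo _ _ omega0 F f (fun x _ => is_derive_rderiv omega (dF x)).
rewrite /Rintegral (continuous_FTC2 omega0 _ h1 h2) -?EFinB//.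
exact: continuous_subspaceT.
Qed.

Lemma continuous_meas (f : R -> R) : continuous f -> measurable_fun (setT : set (measurableTypeR R)) f.
Proof. exact: continuous_measurable_fun. Qed.

End lebesgue_on_interval.

Section sines.
Context (R : realType).
Variable omega : R.
Hypothesis omega0 : 0 < omega.
Local Notation lam := (@lebesgue_measure R).
Local Notation mo := (lebesgue_on omega).

Definition theta : R := trigo.pi / omega.

Lemma theta_gt0 : 0 < theta. Proof. by rewrite divr_gt0// pi_gt0. Qed.

Lemma dsin (c x : R) : is_derive x 1 (fun y : R => sin (c * y)) (c * cos (c * x)).
Proof.
have d1 : is_derive x 1 (fun y : R => c * y) c.
  by have := is_deriveZ c (is_derive_id x 1); rewrite /GRing.scale /= mulr1.
have := @is_derive1_comp _ sin (fun y : R => c * y) x _ _ (is_derive_sin (c * x)) d1.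
by rewrite mulrC.
Qed.

Lemma dcos (c x : R) : is_derive x 1 (fun y : R => cos (c * y)) (- c * sin (c * x)).
Proof.
have d1 : is_derive x 1 (fun y : R => c * y) c.
  by have := is_deriveZ c (is_derive_id x 1); rewrite /GRing.scale /= mulr1.
have -> : - c * sin (c * x) = - sin (c * x) * c by ring.
exact: (@is_derive1_comp _ cos (fun y : R => c * y) x _ _ (is_derive_cos (c * x)) d1).
Qed.

Lemma csin (c : R) : continuous (fun y : R => sin (c * y)).
Proof.
move=> x; apply: differentiable_continuous; apply/derivable1_diffP.
by case: (dsin c x).
Qed.

Lemma ccos (c : R) : continuous (fun y : R => cos (c * y)).
Proof.
move=> x; apply: differentiable_continuous; apply/derivable1_diffP.
by case: (dcos c x).
Qed.

Lemma sin_natpi (k : nat) : sin (k%:R * trigo.pi) = 0 :> R.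
Proof.
elim: k => [|k IH]; first by rewrite mul0r sin0.
by rewrite -natr1 mulrDl mul1r sinDpi IH oppr0.
Qed.

Lemma theta_omega : theta * omega = trigo.pi.
Proof. by rewrite /theta divfK// gt_eqF. Qed.

Definition freq (n : nat) : R := n.+1%:R * theta.

Lemma sin_freq_omega n : sin (freq n * omega) = 0.
Proof. by rewrite /freq -mulrA theta_omega sin_natpi. Qed.

Definition phi n (x : R) : R := Num.sqrt (2 / omega) * sin (freq n * x).

Lemma int_cos c : c != 0 -> sin (c * omega) = 0 ->
  Rintegral lam `[0, omega] (fun x => cos (c * x)) = 0.
Proof.
move=> c0 sc.
have dF (x : R) : is_derive x 1 (fun x : R => c^-1 * sin (c * x)) (cos (c * x)).
  by have := is_deriveZ c^-1 (dsin c x); rewrite /GRing.scale /= mulKf.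
by rewrite (Rintegral_c1 omega0 dF (@ccos c)) sc !mulr0 sin0 mulr0 subrr.
Qed.

Lemma phi_cont n : continuous (phi n).
Proof. by move=> x; apply: cvgM; [exact: cvg_cst|exact: csin]. Qed.

Lemma phi_meas n : measurable_fun (setT : set (measurableTypeR R)) (phi n).
Proof. by apply: continuous_meas; exact: phi_cont. Qed.

Lemma phi_le n x : `|phi n x| <= Num.sqrt (2 / omega).
Proof. by rewrite /phi normrM ger0_norm ?sqrtr_ge0// ler_piMr ?sqrtr_ge0// sin_max. Qed.

Lemma phi_sqint n : sqint mo (phi n).
Proof. by apply: (@sqint_bounded _ _ _ (Num.sqrt (2 / omega))); [exact: phi_meas|move=> x _; exact: phi_le]. Qed.

Lemma int_ccos c : lam.-integrable `[0, omega] (EFin \o (fun x => cos (c * x))).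
Proof.
apply: continuous_compact_integrable; first exact: segment_compact.
by apply: continuous_subspaceT => x; exact: ccos.
Qed.

Lemma phi_on m n : ip mo (phi m) (phi n) = (m == n)%:R.
Proof.
rewrite /ip Rintegral_mo; last by apply: measurable_funM; exact: phi_meas.
have w2 : 0 <= 2 / omega by rewrite divr_ge0// ltW.
have -> : (fun x => phi m x * phi n x) = (fun x => omega^-1 * (cos ((freq m - freq n) * x) - cos ((freq m + freq n) * x))).
  apply/funext => x; rewrite /phi mulrACA -expr2 sqr_sqrtr//.
  rewrite [(freq m - _) * _]mulrBl [(freq m + _) * _]mulrDl cosB cosD; field.
  by rewrite gt_eqF.
have ms : measurable (`[0, omega]%classic : set (measurableTypeR R)) by exact: measurable_itv.
rewrite RintegralZl//; last first.
  by have := integrableB ms (int_ccos (freq m - freq n)) (int_ccos (freq m + freq n)).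
rewrite RintegralB//; [|exact: int_ccos|exact: int_ccos].
have f0 k : 0 < freq k by rewrite mulr_gt0 ?theta_gt0.
rewrite [X in _ - X]int_cos ?subr0; last 2 first.
- by rewrite gt_eqF// addr_gt0.
- by rewrite [(freq m + _) * _]mulrDl sinD !sin_freq_omega mul0r mulr0 addr0.
case: (eqVneq m n) => [->|mn].
  have -> : (fun x => cos ((freq n - freq n) * x)) = (cst 1 : R -> R).
    by apply/funext => x; rewrite subrr mul0r cos0.
  rewrite Rintegral_cst// mul1r /= lebesgue_measure_itv /= lte_fin omega0 -EFinB /= subr0.
  by rewrite mulVf// gt_eqF.
rewrite int_cos ?mulr0//; last by rewrite [(freq m - _) * _]mulrBl sinB !sin_freq_omega mul0r mulr0 subrr.
rewrite -mulrBl mulf_eq0 negb_or subr_eq0 eqr_nat (gt_eqF theta_gt0) andbT.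
by apply: contra mn => /eqP[->].
Qed.

End sines.

(** * Totality of the sine system *)

Section step_polynomials.
Context (R : realType).

Lemma bernoulli_ge (x : R) n : 0 <= x <= 1 -> 1 - n%:R * x <= (1 - x) ^+ n.
Proof.
move=> /andP[x0 x1]; elim: n => [|n IH]; first by rewrite mul0r subr0 expr0.
have h : 0 <= 1 - x by rewrite subr_ge0.
rewrite exprS (le_trans _ (ler_wpM2l h IH))//.
have := mulr_ge0 (ler0n R n) (sqr_ge0 x); rewrite -natr1 expr2; move: (n%:R) => y; nra.
Qed.

(* Brosowski-Deutsch: for [0 <= q <= 1] these polynomials in [q] tend to the
   indicator function of [q < 1 / 2]. *)
Definition step_seq (q : R) m := (1 - q ^+ m) ^+ (2 ^ m).

Lemma step_seq01 q m : 0 <= q <= 1 -> 0 <= step_seq q m <= 1.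
Proof.
move=> /andP[q0 q1]; have qm : 0 <= q ^+ m <= 1 by rewrite exprn_ge0//= exprn_ile1.
have [h0 h1] := andP qm.
by rewrite exprn_ge0 ?exprn_ile1//= ?subr_ge0// gerBl.
Qed.

(** Bernoulli's inequality bounds [step_seq q m] below by [1 - (2 * q) ^+ m]. *)
Lemma step_seq_lt q : 0 <= q < 1 / 2 -> step_seq q m @[m --> \oo] --> (1 : R).
Proof.
move=> /andP[q0 q1].
have q01 : 0 <= q <= 1 by rewrite q0; lra.
have h : (fun m => (2 * q) ^+ m) @ \oo --> (0 : R).
  by apply: cvg_expr; rewrite ger0_norm ?mulr_ge0//; lra.
have h1 : (fun m => 1 - (2 * q) ^+ m) @ \oo --> (1 : R).
  by rewrite -[X in _ --> X]subr0; apply: cvgB => //; exact: cvg_cst.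
apply: (@squeeze_cvgr _ _ _ _ (fun m => 1 - (2 * q) ^+ m) (cst 1)) => //; last exact: cvg_cst.
apply: nearW => m; case/andP: (step_seq01 m q01) => _ ->; rewrite andbT.
have [q0' q1'] := andP q01.
rewrite (le_trans _ (@bernoulli_ge (q ^+ m) (2 ^ m) _))//.
  by rewrite exprMn natrX.
by rewrite exprn_ge0//= exprn_ile1.
Qed.

(** With [x = q ^+ m] and [k = 2 ^ m], the product [(1 - x)^k * (1 + x)^k] is at most 1 and
    [(1 + x)^k >= k * x], so the sequence is bounded by [(2 * q)^-1 ^+ m]. *)
Lemma step_seq_gt q : 1 / 2 < q <= 1 -> step_seq q m @[m --> \oo] --> (0 : R).
Proof.
move=> /andP[q0 q1]; have qp : 0 < q by lra.
have q01 : 0 <= q <= 1 by rewrite q1 (ltW qp).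
have h : (fun m => (2 * q)^-1 ^+ m) @ \oo --> (0 : R).
  apply: cvg_expr; rewrite ger0_norm ?invr_ge0 ?mulr_ge0 ?(ltW qp)//.
  by rewrite invf_lt1 ?mulr_gt0//; lra.
apply: squeeze0 h => [m|]; first by case/andP: (step_seq01 m q01).
apply: nearW => m; set x := q ^+ m.
have x0 : 0 < x by rewrite exprn_gt0.
have x1 : x <= 1 by rewrite exprn_ile1// ltW.
have k0 : 0 < (2 ^ m)%:R * x by rewrite mulr_gt0// ltr0n expn_gt0.
rewrite (_ : (2 * q)^-1 ^+ m = ((2 ^ m)%:R * x)^-1); last first.
  by rewrite exprVn exprMn natrX.
rewrite /step_seq -/x.
move: (2 ^ m)%N k0 => k k0.
have hk : 1 + k%:R * x <= (1 + x) ^+ k.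
  elim: k {k0} => [|k IH]; first by rewrite mul0r addr0 expr0.
  have p : 0 <= 1 + x by lra.
  rewrite exprS (le_trans _ (ler_wpM2l p IH))// -natr1.
  have := mulr_ge0 (ler0n R k) (sqr_ge0 x); rewrite expr2; move: (k%:R) => y; nra.
have hp : (1 - x) ^+ k * (1 + x) ^+ k <= 1.
  by rewrite -exprMn exprn_ile1//; nra.
have e0 : 0 <= (1 - x) ^+ k by rewrite exprn_ge0// subr_ge0.
rewrite -[leLHS](mulfK (lt0r_neq0 k0)) ler_piMl ?invr_ge0 ?(ltW k0)//.
apply: le_trans hp; apply: ler_wpM2l => //; apply: le_trans hk.
by rewrite lerDr.
Qed.

End step_polynomials.

Section totality.
Context (R : realType).
Variable omega : R.
Hypothesis omega0 : 0 < omega.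
Local Notation lam := (@lebesgue_measure R).
Local Notation mo := (lebesgue_on omega).
Local Notation D := (`[0, omega]%classic : set (measurableTypeR R)).
Local Notation theta := (theta omega).

Variable f : R -> R.
Hypothesis f2 : sqint mo f.
Hypothesis f_orth : forall n, ip mo f (phi omega n) = 0.

Let mf : measurable_fun (setT : set (measurableTypeR R)) f. Proof. by case: f2. Qed.

Let mD : measurable D. Proof. exact: measurable_itv. Qed.

Let one_sqint : sqint mo (cst 1).
Proof. by apply: (@sqint_bounded _ _ _ 1) => // x _ /=; rewrite normr1. Qed.

Let f_int : mo.-integrable setT (EFin \o f).
Proof.
have := sqint_mul f2 one_sqint; congr (_.-integrable _ _).
by apply/funext => x /=; rewrite mulr1.
Qed.

Let fh_int (h : R -> R) : measurable_fun (setT : set (measurableTypeR R)) h ->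
  (forall x, `|h x| <= 1) -> mo.-integrable setT (EFin \o (fun x => f x * h x)).
Proof.
move=> mh h1; apply: (le_integrable measurableT _ _ f_int) => /=.
  by apply/measurable_EFinP; exact: measurable_funM.
by move=> x _; rewrite lee_fin normrM ler_piMr.
Qed.

Let J (h : R -> R) := Rintegral mo setT (fun x => f x * h x).

Let sc j i x := sin (j%:R * theta * x) * cos (theta * x) ^+ i.

Let msc j i : measurable_fun (setT : set (measurableTypeR R)) (sc j i).
Proof.
apply: measurable_funM; first by apply: continuous_meas; exact: csin.
by apply: measurable_funX; apply: continuous_meas; exact: ccos.
Qed.

Let sc_le j i x : `|sc j i x| <= 1.
Proof.
rewrite /sc normrM normrX mulr_ile1 ?exprn_ge0 ?sin_max//.
by rewrite exprn_ile1 ?cos_max.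
Qed.

Let sc_step j i x : sc j.+1 i.+1 x = 2^-1 * (sc j.+2 i x + sc j i x).
Proof.
rewrite /sc exprS.
have -> : j.+2%:R * theta * x = j.+1%:R * theta * x + theta * x by rewrite -[j.+2%:R]natr1; ring.
have -> : j%:R * theta * x = j.+1%:R * theta * x - theta * x by rewrite -[j.+1%:R]natr1; ring.
by rewrite sinD sinB; field.
Qed.

(** Induction on the power of the cosine: by the addition formulas one factor [cos (theta * x)] is
    traded for the neighbouring sines. *)
Let J_sc i : forall j, J (sc j i) = 0.
Proof.
elim: i => [|i IH] [|j].
- rewrite /J /sc (_ : (fun x => _) = cst 0) ?Rintegral_cst ?mul0r//.
  by apply/funext => x; rewrite !mul0r sin0 mul0r mulr0.
- have := f_orth j; rewrite /ip.
  have -> : (fun x => f x * phi omega j x) = (fun x => Num.sqrt (2 / omega) * (f x * sc j.+1 0 x)).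
    by apply/funext => x; rewrite /phi /sc expr0 mulr1 mulrCA.
  rewrite RintegralZl//; last exact: fh_int.
  move=> /eqP; rewrite mulf_eq0 => /orP[|/eqP//].
  by rewrite sqrtr_eq0 leNgt divr_gt0.
- rewrite /J /sc (_ : (fun x => _) = cst 0) ?Rintegral_cst ?mul0r//.
  by apply/funext => x; rewrite !mul0r sin0 mul0r mulr0.
- have -> : J (sc j.+1 i.+1) = 2^-1 * (J (sc j.+2 i) + J (sc j i)).
    rewrite /J -RintegralD//; [|exact: fh_int|exact: fh_int].
    rewrite -RintegralZl//; last first.
      by have := integrableD measurableT (fh_int (msc j.+2 i) (@sc_le _ _)) (fh_int (msc j i) (@sc_le _ _)).
    by apply: eq_Rintegral => x _; rewrite sc_step; ring.
  by rewrite !IH addr0 mulr0.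
Qed.

Let w x := f x * sin (theta * x).

Let J_poly (p : {poly R}) : Rintegral mo setT (fun x => w x * p.[cos (theta * x)]) = 0.
Proof.
have -> : (fun x => w x * p.[cos (theta * x)]) = (fun x => \sum_(i < size p) p`_i * (f x * sc 1 i x)).
  apply/funext => x; rewrite horner_coef mulr_sumr; apply: eq_bigr => i _.
  by rewrite /w /sc mul1r; ring.
have fint i : mo.-integrable setT (EFin \o (fun x => f x * sc 1 i x)) by apply: fh_int.
elim: (size p) => [|n IH].
  rewrite (_ : (fun x => _) = cst 0) ?Rintegral_cst ?mul0r//.
  by apply/funext => x; rewrite big_ord0.
rewrite (_ : (fun x => _) = (fun x => \sum_(i < n) p`_i * (f x * sc 1 i x) + p`_n * (f x * sc 1 n x))); last first.
  by apply/funext => x; rewrite big_ord_recr.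
rewrite RintegralD//; last 2 first.
- elim: n {IH} => [|n IH].
    have := @integrable0 _ _ R mo setT; congr (_.-integrable _ _).
    by apply/funext => x /=; rewrite big_ord0.
  have := integrableD measurableT IH (integrableZl measurableT p`_n (fint n)).
  by congr (_.-integrable _ _); apply/funext => x /=; rewrite big_ord_recr.
- by have := integrableZl measurableT p`_n (fint n).
rewrite IH RintegralZl//.
by rewrite -/(J (sc 1 n)) J_sc mulr0 addr0.
Qed.

Let mw : measurable_fun (setT : set (measurableTypeR R)) w.
Proof. by apply: measurable_funM => //; apply: continuous_meas; exact: csin. Qed.

Let w_int : mo.-integrable setT (EFin \o w).
Proof.
by apply: fh_int; [apply: continuous_meas; exact: csin|move=> x; exact: sin_max].
Qed.

(* [w] is orthogonal to the polynomials in [cos (theta x)], hence to the step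
   functions they approximate. *)
Let int_gt a : 0 <= a <= omega -> Rintegral lam `]a, omega] w = 0.
Proof.
move=> /andP[a0 aw]; pose c := cos (theta * a).
(* Affine in the cosine, with values in [[0, 1]] and value [1 / 2] at [x = a]. The cosine decreases
   on the segment, so [x > a] corresponds to [q < 1 / 2], where the step polynomials tend to 1. *)
pose q : {poly R} := (1 / 2 - c / 4)%:P + (1 / 4)%:P * 'X.
pose p m : {poly R} := (1 - q ^+ m) ^+ (2 ^ m).
have qE x : q.[cos (theta * x)] = 1 / 2 + (cos (theta * x) - c) / 4.
  by rewrite /q !hornerE; field.
have pE m x : (p m).[cos (theta * x)] = step_seq (q.[cos (theta * x)]) m.
  by rewrite /p /step_seq horner_exp hornerD hornerN horner_exp hornerC.
have q01 x : 0 <= q.[cos (theta * x)] <= 1.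
  rewrite qE; have := cos_le1 (theta * x); have := cos_geN1 (theta * x).
  have := cos_le1 (theta * a); have := cos_geN1 (theta * a); rewrite -/c.
  by move=> *; apply/andP; split; lra.
have arg x : 0 <= x <= omega -> theta * x \in `[0, trigo.pi].
  move=> /andP[x0 xw]; rewrite in_itv /= mulr_ge0 ?(ltW (theta_gt0 omega0))//=.
  by rewrite -(theta_omega omega0) ler_pM2l// theta_gt0.
pose F m x := (w x * (p m).[cos (theta * x)])%:E.
pose F0 x := (w x * (a < x)%R%:R)%:E.
have cosE x : 0 <= x <= omega -> (c < cos (theta * x)) = (x < a).
  by move=> xw; rewrite /c ltr_cos ?arg ?a0// ltr_pM2l ?theta_gt0.
have cosE' x : 0 <= x <= omega -> (cos (theta * x) < c) = (a < x).
  by move=> xw; rewrite /c ltr_cos ?arg ?a0// ltr_pM2l ?theta_gt0.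
have mp m : measurable_fun (setT : set (measurableTypeR R)) (fun x => (p m).[cos (theta * x)]).
  rewrite (_ : (fun x => _) = fun x => (1 - (1 / 2 + (cos (theta * x) - c) / 4) ^+ m) ^+ (2 ^ m)); last first.
    by apply/funext => x; rewrite pE qE.
  have mc : measurable_fun (setT : set (measurableTypeR R)) (fun x => cos (theta * x)).
    by apply: continuous_meas; exact: ccos.
  apply: measurable_funX; apply: measurable_funB => //; apply: measurable_funX.
  apply: measurable_funD => //; apply: measurable_funM => //.
  exact: measurable_funB.
have mI : measurable (`]a, omega]%classic : set (measurableTypeR R)) by exact: measurable_itv.
have p1 m x : `|(p m).[cos (theta * x)]| <= 1.
  by rewrite pE; have [h0 h1] := andP (step_seq01 m (q01 x)); rewrite ger0_norm.
have mF0 : measurable_fun (setT : set (measurableTypeR R)) F0.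
  apply/measurable_EFinP; apply: measurable_funM => //.
  rewrite (_ : (fun x => _) = (\1_(`]a, +oo[%classic : set (measurableTypeR R)) : R -> R)).
    by apply: measurable_indic; exact: measurable_itv.
  apply/funext => x; rewrite indicE; congr (_%:R); congr nat_of_bool.
  by apply/idP/idP; rewrite inE /= in_itv /= andbT.
have [] := @dominated_convergence _ _ _ mo setT measurableT F F0 (fun x => `|w x|%:E).
- move=> m; apply/measurable_EFinP; exact: measurable_funM.
- exact: mF0.
- apply/ae_mo; apply: ae_lebS (ae_neq a) => x xa xw _.
  rewrite /F /F0; apply: cvg_EFin; first exact: nearW.
  rewrite [X in X @ _ --> _](_ : _ = fun m => w x * step_seq q.[cos (theta * x)] m); last first.
    by apply/funext => m; rewrite /= pE.
  apply: cvgM; first exact: cvg_cst.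
  case: ltgtP xa => // h _.
    apply: step_seq_lt; have [-> _] := andP (q01 x); rewrite qE.
    by rewrite -cosE' // in h; lra.
  apply: step_seq_gt; have [_ ->] := andP (q01 x); rewrite qE andbT.
  by rewrite -cosE // in h; lra.
- by have := integrable_norm w_int.
- by apply: aeW => x m _; rewrite lee_fin normrM ler_piMr.
move=> _ _ h.
have : (fun m => \int[mo]_x F m x)%E @ \oo --> (0 : \bar R)%E.
  have -> : (fun m => \int[mo]_x F m x)%E = cst 0%E; last exact: cvg_cst.
  apply/funext => m.
  have iF : mo.-integrable setT (F m).
    apply: (le_integrable measurableT _ _ w_int) => /=.
      by apply/measurable_EFinP; exact: measurable_funM.
    by move=> x _; rewrite lee_fin normrM ler_piMr.
  have := J_poly (p m); rewrite /Rintegral -/(F m) => h0.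
  by rewrite -[LHS]fineK ?integrable_fin_num// h0.
move=> /(cvg_unique _ h) h0.
rewrite integral_mo// in h0.
rewrite /Rintegral (_ : \int[lam]_(x in _) _ = 0)%E// -h0 //.
rewrite [LHS]integral_mkcond [RHS]integral_mkcond; apply: eq_integral => x _.
rewrite !patchE; case: ifPn => [|/negP xa].
  rewrite inE /= in_itv /= => /andP[ax xw].
  have xD : D x by rewrite /= in_itv /= xw (ltW (le_lt_trans a0 ax)).
  by rewrite (mem_set xD) /F0 ax mulr1.
case: ifPn => //; rewrite inE /= in_itv /= => /andP[x0 xw].
rewrite /F0; case: ltP => [ax|]; last by rewrite mulr0.
by case: xa; rewrite inE /= in_itv /= ax.
Qed.


(** All integrals of [w] over initial segments vanish, so its derivative as a primitive is 0 almost
    everywhere; [sin (theta * x)] is positive inside the segment and can be cancelled. *)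
Lemma orth_ae0 : {ae mo, forall x : R, f x = 0}.
Proof.
pose W : R -> R := w \_ D.
have wD : lam.-integrable D (EFin \o w).
  by apply/integrable_mo => //; exact/measurable_EFinP.
have iW : lam.-integrable setT (EFin \o W).
  rewrite (_ : EFin \o W = (EFin \o w) \_ D); last by rewrite restrict_EFin.
  exact: (integrable_mkcond _ mD).1 wD.
have W0 x : 0 <= x <= omega -> 0 = 0 + Rintegral lam `[0, x] W :> R.
  move=> /andP[x0 xw]; rewrite add0r.
  rewrite (_ : Rintegral lam `[0, x] W = Rintegral lam `[0, x] w); last first.
    apply: eq_Rintegral => y; rewrite inE /= in_itv /= => /andP[y0 yx].
    by rewrite /W /patch mem_set//= in_itv /= y0 (le_trans yx xw).
  have := @Rintegral_itvB R w (BLeft 0) (BRight omega) x wD; rewrite !bnd_simp => /(_ x0 xw).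
  rewrite int_gt ?x0// => /eqP; rewrite subr_eq0 => /eqP <-.
  have E : (fun x => w x * (1 : {poly R}).[cos (theta * x)]) = w.
    by apply/funext => y; rewrite hornerC mulr1.
  by have := J_poly 1; rewrite E Rintegral_mo.
have := @ac_is_derive R omega (cst 0) W iW W0.
move=> h; apply/ae_mo; apply: ae_seg; apply: ae_lebS h => x h /andP[x0 xw].
have := h _; rewrite x0 xw => /(_ isT) dx.
have := @derive_val _ _ _ _ _ _ _ dx; rewrite derive_cst /W /patch mem_set; last first.
  by rewrite /= in_itv /= !ltW.
move=> /esym/eqP; rewrite mulf_eq0 => /orP[/eqP//|/eqP s0].
have : 0 < sin (theta * x).
  rewrite sin_gt0_pi// mulr_gt0 ?theta_gt0//=.
  by rewrite -(theta_omega omega0) ltr_pM2l// theta_gt0.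
by rewrite s0 ltxx.
Qed.

End totality.

Section sine_basis.
Context (R : realType).
Variable omega : R.
Hypothesis omega0 : 0 < omega.
Local Notation mo := (lebesgue_on omega).

Lemma ae_moS (P Q : R -> Prop) : (forall x, 0 <= x <= omega -> P x -> Q x) ->
  {ae mo, forall x : R, P x} -> {ae mo, forall x : R, Q x}.
Proof. by move=> h /ae_mo hP; apply/ae_mo; apply: ae_lebS hP => x hx xw; apply: h (hx xw). Qed.

Lemma ae_moS2 (P P' Q : R -> Prop) : (forall x, 0 <= x <= omega -> P x -> P' x -> Q x) ->
  {ae mo, forall x : R, P x} -> {ae mo, forall x : R, P' x} -> {ae mo, forall x : R, Q x}.
Proof.
move=> h /ae_mo hP /ae_mo hP'; apply/ae_mo; apply: ae_lebS2 hP hP' => x hx hx' xw.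
exact: h (hx xw) (hx' xw).
Qed.

Lemma phi_total (u : L2 mo) : (forall n, @coef _ _ R mo (phi omega) n u = 0) -> u = 0.
Proof.
move=> u0; apply: L2_ext.
have h1 : {ae mo, forall x : R, Re_ u x = 0}.
  by apply: (orth_ae0 omega0 (sqint_Re u)) => n; have := u0 n => -[].
have h2 : {ae mo, forall x : R, Im_ u x = 0}.
  by apply: (orth_ae0 omega0 (sqint_Im u)) => n; have := u0 n => -[].
have h0 : {ae mo, forall x : R, (0 : L2 mo) x = 0} by exact: L2_0E.
have h3 : {ae mo, forall x : R, u x = 0}.
  apply: ae_moS2 h1 h2 => x _; rewrite /Re_ /Im_.
  by case: (u x) => a b /= -> ->.
by apply: ae_moS2 h3 h0 => x _ -> ->.
Qed.

Lemma sine_onb : onb (@basis _ _ R mo (phi omega)) (@coef _ _ R mo (phi omega)).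
Proof. by apply: onb_L2; [exact: phi_sqint|exact: phi_on|exact: phi_total]. Qed.

End sine_basis.

(** * Complex-valued derivatives *)

Section complex_derivative.
Context (R : realType).
Local Notation C := R[i].
Variable omega : R.
Hypothesis omega0 : 0 < omega.
Local Notation lam := (@lebesgue_measure R).
Local Notation I := `[0, omega]%classic.
Implicit Types (y : R -> C^o) (f : R -> R).

Definition rp y (x : R) : R := complex.Re (y x).
Definition ip_ y (x : R) : R := complex.Im (y x).

Lemma complex_cvgP (T : Type) (F : set_system T) (FF : Filter F) (f : T -> C^o) (l : C^o) :
  f @ F --> l <-> ((fun t => complex.Re (f t)) @ F --> complex.Re l) /\
                  ((fun t => complex.Im (f t)) @ F --> complex.Im l).
Proof.
split=> [/cvgrPdist_lt h|[/cvgrPdist_lt hr /cvgrPdist_lt hi]].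
  split; apply/cvgrPdist_lt => e e0.
    have e0' : (0 : C) < e%:C by rewrite ltcR.
    apply: filterS (h _ e0') => t; rewrite cnE ltcR; apply: le_lt_trans.
    by have := le_Re_cn (l - f t); case: (l) (f t) => [a b] [a' b'].
  have e0' : (0 : C) < e%:C by rewrite ltcR.
  apply: filterS (h _ e0') => t; rewrite cnE ltcR; apply: le_lt_trans.
  by have := le_Im_cn (l - f t); case: (l) (f t) => [a b] [a' b'].
apply/cvgrPdist_lt => e e0.
have [er e0'] : e = (complex.Re e)%:C /\ 0 < complex.Re e.
  by case: e e0 => a b; rewrite ltcE/= => /andP[/eqP-> ->].
have e2 : 0 < complex.Re e / 2 by rewrite divr_gt0.
apply: filterS2 (hr _ e2) (hi _ e2) => t h1 h2; rewrite cnE er ltcR.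
apply: (le_lt_trans (cn_le_ReIm _)); move: h1 h2.
case: (l) (f t) => [a b] [a' b'] /=; lra.
Qed.

Lemma within_proper x : 0 <= x <= omega -> ProperFilter (within I x^').
Proof.
move=> /andP[x0 xw]; split; last by apply: within_filter; exact: dnbhs_filter.
move=> /nbhs_ballP[d /= d0]; apply/existsNP.
have [xl|xl] := leP (omega / 2) x.
  exists (x - Num.min (d / 2) (omega / 2)).
  have m0 : 0 < Num.min (d / 2) (omega / 2) by rewrite lt_min !divr_gt0.
  have [m1 m2] : Num.min (d / 2) (omega / 2) <= d / 2 /\ Num.min (d / 2) (omega / 2) <= omega / 2.
    by rewrite !ge_min !lexx orbT.
  move: (Num.min _ _) m0 m1 m2 => m m0 m1 m2 h; apply: h.
  - rewrite /ball /= opprB addrC subrK ger0_norm ?ltW//; lra.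
  - by rewrite -subr_eq0 addrC addrA addNr add0r oppr_eq0 gt_eqF.
  - by rewrite in_itv /=; lra.
exists (x + Num.min (d / 2) (omega / 2)).
have m0 : 0 < Num.min (d / 2) (omega / 2) by rewrite lt_min !divr_gt0.
have [m1 m2] : Num.min (d / 2) (omega / 2) <= d / 2 /\ Num.min (d / 2) (omega / 2) <= omega / 2.
  by rewrite !ge_min !lexx orbT.
move: (Num.min _ _) m0 m1 m2 => m m0 m1 m2 h; apply: h.
- by rewrite /ball /= opprD addrA subrr sub0r normrN ger0_norm ?ltW//; lra.
- by rewrite -subr_eq0 addrC addrA addNr add0r gt_eqF.
- by rewrite in_itv /=; lra.
Qed.

Lemma diff_quotientE y x (l : C^o) : diff_quotient y x t @[t --> within I x^'] --> l <->
  has_rderiv omega (rp y) x (complex.Re l) /\ has_rderiv omega (ip_ y) x (complex.Im l).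
Proof.
rewrite complex_cvgP /has_rderiv /diff_quotient.
have e1 t : complex.Re ((t - x)^-1%:C * (y t - y x)) = (t - x)^-1 * (rp y t - rp y x).
  by rewrite /rp; case: (y t) (y x) => [a b] [a' b'] /=; rewrite mul0r subr0.
have e2 t : complex.Im ((t - x)^-1%:C * (y t - y x)) = (t - x)^-1 * (ip_ y t - ip_ y x).
  by rewrite /ip_; case: (y t) (y x) => [a b] [a' b'] /=; rewrite mul0r addr0.
have -> : (fun t => (t - x)^-1 * (rp y t - rp y x)) = (fun t => complex.Re ((t - x)^-1%:C * (y t - y x))).
  by apply/funext => t; rewrite e1.
have -> : (fun t => (t - x)^-1 * (ip_ y t - ip_ y x)) = (fun t => complex.Im ((t - x)^-1%:C * (y t - y x))).
  by apply/funext => t; rewrite e2.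
by [].
Qed.

Lemma derivable_has_rderiv y x : derivable_within I y x ->
  has_rderiv omega (rp y) x (complex.Re (derive_within I y x)) /\
  has_rderiv omega (ip_ y) x (complex.Im (derive_within I y x)).
Proof. by move=> h; apply/diff_quotientE. Qed.

Lemma has_rderiv_derive y x a b : 0 <= x <= omega ->
  has_rderiv omega (rp y) x a -> has_rderiv omega (ip_ y) x b ->
  derivable_within I y x /\ derive_within I y x = (a +i* b)%C.
Proof.
move=> xw ha hb.
have h : diff_quotient y x t @[t --> within I x^'] --> ((a +i* b)%C : C^o) by apply/diff_quotientE.
have pf := within_proper xw.
split; first by apply/cvg_ex; exists (a +i* b)%C.
by apply: (@cvg_lim C^o) => //; exact: norm_hausdorff.
Qed.

Lemma has_rderiv_eq f g x l : 0 <= x <= omega -> (forall t, 0 <= t <= omega -> f t = g t) ->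
  has_rderiv omega f x l -> has_rderiv omega g x l.
Proof.
move=> xw fg /has_rderivP h; apply/has_rderivP => e /h[d d0 hd]; exists d => // t tw.
by rewrite -!fg//; exact: hd.
Qed.

Lemma ac_acl (y : R -> C^o) : absolutely_continuous 0 omega y ->
  acl omega (rp y) /\ acl omega (ip_ y).
Proof.
move=> acy.
suff h eps : 0 < eps -> exists2 delta, 0 < delta & forall l, valid 0 omega l -> len l < delta ->
    \sum_(p <- l) cn (y p.2 - y p.1) <= eps.
  split=> eps /h[d d0 hd]; exists d => // l vl ll; apply: le_trans (hd l vl ll);
    apply: ler_sum => p _.
  - by have := le_Re_cn (y p.2 - y p.1); rewrite /rp; case: (y p.2) (y p.1) => [a b] [a' b'].
  - by have := le_Im_cn (y p.2 - y p.1); rewrite /ip_; case: (y p.2) (y p.1) => [a b] [a' b'].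
move=> e0; have [d d0 hd] := acy _ e0; exists d => // l vl ll.
pose s (i : 'I_(size l)) := (nth (0, 0) l i).1; pose t (i : 'I_(size l)) := (nth (0, 0) l i).2.
have [/allP al /(pairwiseP (0, 0)) pl] := andP vl.
have h := hd (size l) s t.
have {h} : \sum_i `|y (t i) - y (s i)| < eps%:C.
  apply: h => [i||].
  - by have /andP[/andP[-> ->] ->] := al _ (mem_nth (0, 0) (ltn_ord i)).
  - move=> i j _ _ [z [/=]]; rewrite !in_itv /= => /andP[z1 z2] /andP[z3 z4].
    apply/val_inj; apply: contrapT => /eqP ij.
    have dj : itv_disj (nth (0, 0) l i) (nth (0, 0) l j).
      move: ij; rewrite neq_ltn => /orP[ij|ij]; first by apply: pl; rewrite ?inE ?ltn_ord.
      by rewrite itv_disjC; apply: pl; rewrite ?inE ?ltn_ord.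
    by case/orP: dj => dj; [have := lt_trans z3 z2|have := lt_trans z1 z4]; rewrite ltNge dj.
  - by move: ll; rewrite /len (big_nth (0, 0)) big_mkord.
under eq_bigr do rewrite cnE.
rewrite -rmorph_sum ltcR => /ltW; apply: le_trans.
by rewrite (big_nth (0, 0)) big_mkord.
Qed.

Lemma acl_ac (y : R -> C^o) : acl omega (rp y) -> acl omega (ip_ y) ->
  absolutely_continuous 0 omega y.
Proof.
(* Thirds rather than halves: [acl] yields weak inequalities, and a strict one is required. *)
move=> acr aci eps e0; have e3 : 0 < eps / 3 by rewrite divr_gt0.
have [d1 d10 h1] := acr _ e3; have [d2 d20 h2] := aci _ e3.
exists (Num.min d1 d2); first by rewrite lt_min d10.
move=> n s t st dj; rewrite lt_min => /andP[l1 l2].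
(* Degenerate intervals are dropped: they are empty as open intervals, so they may lie inside
   another one and violate [itv_disj]. *)
pose l := [seq (s i, t i) | i <- enum 'I_n & s i < t i].
have sumE (F : R -> R -> R) : (forall x, F x x = 0) -> \sum_(p <- l) F p.1 p.2 = \sum_i F (s i) (t i).
  move=> F0; rewrite /l big_map big_filter big_enum_cond /= [RHS](bigID (fun i => s i < t i)) /=.
  rewrite [X in _ = _ + X]big1 ?addr0// => i; rewrite -leNgt => ti.
  have [_ [h _]] := st i.
  by rewrite (le_anti (introT andP (conj ti h))) F0.
have vl : valid 0 omega l.
  apply/andP; split.
    by apply/allP => _ /mapP[i _ ->]; have [a [b c]] := st i; rewrite /in_seg /= a b c.
  rewrite /l pairwise_map; apply: (@sub_in_pairwise _ (fun i => s i < t i) (fun i j : 'I_n => i != j)).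
  - move=> i j; rewrite /in_mem /= => si sj ij; apply/orP; rewrite /=.
    have [|ts] := leP (t i) (s j); [by left|right].
    rewrite leNgt; apply/negP => st'.
    pose z := (Num.max (s i) (s j) + Num.min (t i) (t j)) / 2.
    have mm : Num.max (s i) (s j) < Num.min (t i) (t j).
      by rewrite gt_max !lt_min si sj st' ts.
    have [m1 m2] : s i <= Num.max (s i) (s j) /\ s j <= Num.max (s i) (s j).
      by rewrite !le_max !lexx orbT.
    have [m3 m4] : Num.min (t i) (t j) <= t i /\ Num.min (t i) (t j) <= t j.
      by rewrite !ge_min !lexx orbT.
    move/eqP: ij; apply; apply: (dj i j) => //.
    by exists z; split; rewrite /= in_itv /=; rewrite /z; apply/andP; split; lra.
  - by rewrite all_filter; apply/allP => i _; apply/implyP.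
  - by apply: pairwise_filter; rewrite -uniq_pairwise enum_uniq.
have el : len l = \sum_i (t i - s i) by apply: (sumE (fun a b => b - a)) => x; rewrite subrr.
have er : vsum (rp y) l = \sum_i `|rp y (t i) - rp y (s i)|.
  by apply: (sumE (fun a b => `|rp y b - rp y a|)) => x; rewrite subrr normr0.
have ei : vsum (ip_ y) l = \sum_i `|ip_ y (t i) - ip_ y (s i)|.
  by apply: (sumE (fun a b => `|ip_ y b - ip_ y a|)) => x; rewrite subrr normr0.
have := h1 _ vl; rewrite el => /(_ l1); rewrite er => b1.
have := h2 _ vl; rewrite el => /(_ l2); rewrite ei => b2.
under eq_bigr do rewrite cnE.
rewrite -rmorph_sum ltcR.
apply: (@le_lt_trans _ _ (\sum_i (`|rp y (t i) - rp y (s i)| + `|ip_ y (t i) - ip_ y (s i)|))).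
  apply: ler_sum => i _; apply: (le_trans (cn_le_ReIm _)).
  by rewrite /rp /ip_; case: (y (t i)) (y (s i)) => [a b] [a' b'].
by rewrite big_split /=; lra.
Qed.

End complex_derivative.

(** * Iterated derivatives and Dirichlet conditions *)

Section tower.
Context (R : realType).
Variable omega : R.
Hypothesis omega0 : 0 < omega.
Local Notation lam := (@lebesgue_measure R).
Local Notation I := `[0, omega]%classic.
Local Notation freq := (freq omega).

(* [a j] plays the role of the [j]-th derivative for [j < 2k], and [g] of the
   almost everywhere defined derivative of order [2k]. *)
Record tower k (a : nat -> R -> R) (g : R -> R) : Prop := Tower {
  tower_deriv : forall j, (j < (2 * k).-1)%N -> forall x, 0 <= x <= omega ->
    has_rderiv omega (a j) x (a j.+1 x);
  tower_acl : acl omega (a (2 * k).-1);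
  tower_int : lam.-integrable setT (EFin \o g);
  tower_prim : forall x, 0 <= x <= omega ->
    a (2 * k).-1 x = a (2 * k).-1 0 + Rintegral lam `[0, x] g;
  tower_bc : forall j, (j < k)%N -> a (2 * j) 0 = 0 /\ a (2 * j) omega = 0 }.

Lemma rderiv_within (f : R -> R) (f' : R -> R) : (forall x, 0 <= x <= omega -> has_rderiv omega f x (f' x)) ->
  {within I, continuous f}.
Proof.
move=> h; apply/subspace_continuousP => x; rewrite /= in_itv /= => /h.
exact: has_rderiv_continuous.
Qed.

Lemma ccosZ (c : R) : continuous (fun x => c * cos (c * x)).
Proof. by move=> x; apply: cvgM; [exact: cvg_cst|exact: ccos]. Qed.

Section coefficients.
Variables (k : nat) (a : nat -> R -> R) (g : R -> R) (n : nat).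
Hypothesis k0 : (0 < k)%N.
Hypothesis aT : tower k a g.
Local Notation nu := (freq n).

Let S f := Rintegral lam I (fun x => sin (nu * x) * f x).
Let C f := Rintegral lam I (fun x => cos (nu * x) * f x).

Let cont j : (j <= (2 * k).-1)%N -> {within I, continuous (a j)}.
Proof.
rewrite leq_eqVlt => /orP[/eqP->|jk]; first exact: acl_continuous (tower_acl aT).
exact: rderiv_within (tower_deriv aT jk).
Qed.

Let intZ (c : R) (h f : R -> R) : {within I, continuous f} -> continuous h ->
  Rintegral lam I (fun x => c * h x * f x) = c * Rintegral lam I (fun x => h x * f x).
Proof.
move=> cf ch; under eq_Rintegral do rewrite -mulrA; rewrite RintegralZl//.
apply: continuous_compact_integrable; first exact: segment_compact.
apply/subspace_continuousP => x xw; apply: cvgM.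
  by have /subspace_continuousP := @within_cont R omega h ch; exact.
by move/subspace_continuousP : cf; exact.
Qed.

(** The boundary terms vanish because the sine does at both ends, so no condition on [a j] is
    needed. *)
Let step_S j : (j < (2 * k).-1)%N -> S (a j.+1) = - (nu * C (a j)).
Proof.
move=> jk; have := c1_by_parts omega0 (dsin nu) (@ccosZ nu) (tower_deriv aT jk) (cont jk).
rewrite /S => ->; rewrite sin_freq_omega// mulr0 sin0 !mul0r subrr sub0r.
by rewrite intZ//; [exact: cont (ltnW jk)|exact: ccos].
Qed.

(** The cosine does not vanish at the ends; this is where the Dirichlet conditions on even
    derivatives enter. *)
Let step_C j : (j < k)%N -> (2 * j < (2 * k).-1)%N -> C (a (2 * j).+1) = nu * S (a (2 * j)).
Proof.
move=> jk jk2.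
have cs : continuous (fun x => - nu * sin (nu * x)).
  by move=> x; apply: cvgM; [exact: cvg_cst|exact: csin].
have := c1_by_parts omega0 (dcos nu) cs (tower_deriv aT jk2) (cont jk2).
have [-> ->] := tower_bc aT jk.
rewrite /C => ->; rewrite !mulr0 subrr sub0r.
by rewrite intZ ?mulNr ?opprK//; [exact: cont (ltnW jk2)|exact: csin].
Qed.

Let S_even j : (j < k)%N -> S (a (2 * j)) = (- nu ^+ 2) ^+ j * S (a 0).
Proof.
elim: j => [|j IH] jk; first by rewrite muln0 expr0 mul1r.
rewrite mulnS add2n step_S ?step_C//; [|lia|lia|lia].
rewrite (IH (ltnW jk)) [_ ^+ j.+1]exprS; move: (_ ^+ j) (S _) => u v; ring.
Qed.

(** Integration by parts [2k] times. Only the step from [g] needs the absolutely continuous version;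
    the others are classical. *)
Lemma tower_coef : Rintegral lam I (fun x => sin (nu * x) * g x) =
  (-1) ^+ k * nu ^+ (2 * k) * Rintegral lam I (fun x => sin (nu * x) * a 0 x).
Proof.
have k1 : (k.-1 < k)%N by rewrite prednK.
have e1 : (2 * k).-1 = (2 * k.-1).+1 by lia.
rewrite (@ac_by_parts R omega omega0 (fun x => sin (nu * x)) (fun x => nu * cos (nu * x)) `|nu| _ _ _ _ (a (2 * k).-1)).
- rewrite sin_freq_omega// mulr0 sin0 !mul0r subrr sub0r.
  rewrite intZ; [|exact: cont|exact: ccos].
  have := step_C k1; rewrite /C e1 => ->; last by lia.
  have -> : (-1) ^+ k * nu ^+ (2 * k) = (- nu ^+ 2) ^+ k.-1 * - nu ^+ 2.
    by rewrite -exprSr prednK// [RHS]exprNn -exprM.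
  rewrite S_even// -/(S (a 0)); move: (S (a 0)) ((- nu ^+ 2) ^+ k.-1) => u v; ring.
- exact: dsin.
- exact: ccosZ.
- by move=> x; exact: sin_max.
- by move=> x; rewrite normrM ler_piMr// cos_max.
- exact: tower_acl aT.
- exact: tower_int aT.
- exact: tower_prim aT.
Qed.

End coefficients.

Lemma prim_ex (f : R -> R) : {within I, continuous f} ->
  exists F : R -> R, F 0 = 0 /\ forall x, 0 <= x <= omega -> has_rderiv omega F x (f x).
Proof.
move=> cf; pose c (x : R) := Num.min omega (Num.max 0 x).
have cc : continuous c.
  by move=> x; apply: continuous_min; [exact: cst_continuous|apply: continuous_max => //; exact: cst_continuous].
have cI x : 0 <= c x <= omega by rewrite le_min (ltW omega0) le_max lexx ge_min lexx.
have cK x : 0 <= x <= omega -> c x = x.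
  by move=> /andP[x0 xw]; rewrite /c (max_idPr x0) (min_idPr xw).
have cfc : continuous (f \o c).
  move=> x; move/subspace_continuousP : cf => /(_ (c x)).
  rewrite /= in_itv /= => /(_ (cI x)) h.
  apply: (@cvg_comp _ _ _ c f (nbhs x) (within I (nbhs (c x))) _ _ h).
  move=> A hA; have h' : nbhs x (c @^-1` [set t | I t -> A t]) by exact: (cc x _ hA).
  apply: filterS h' => t /= h'; apply: h'.
  by rewrite in_itv /=.
(* Clamping extends [f] continuously, and integrating from [-1] makes the end points of the segment
   interior, so the fundamental theorem covers them too. *)
pose F (x : R) := Rintegral lam `[-1, x] (f \o c).
exists (fun x => F x - F 0); split; first by rewrite subrr.
move=> x xw; rewrite -[f x](congr1 f (cK x xw)).
apply: is_derive_rderiv.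
have int (u v : R) : lam.-integrable `[u, v] (EFin \o (f \o c)).
  by apply: continuous_compact_integrable; [exact: segment_compact|exact: continuous_subspaceT].
have [x0 xw'] := andP xw.
have [||dF EF] := @continuous_FTC1_closed R (f \o c) (-1) x (omega + 1) _ (int _ _) _ (cfc x).
- by rewrite (le_lt_trans xw')// ltrDl.
- by rewrite (lt_le_trans _ x0)// ltrN10.
have dFx : is_derive x 1 F ((f \o c) x).
  exact: (DeriveDef dF (etrans (esym (derive1E _ _)) EF)).
move: F {dF EF} dFx => F dFx.
have -> : (fun x1 : R => F x1 - F 0) = F \- cst (F 0) by [].
have -> : f (c x) = (f \o c) x - 0 by rewrite subr0.
exact: is_deriveB dFx (is_derive_cst (F 0) x 1).
Qed.

Lemma has_rderiv_lin f g x u v (c : R) : has_rderiv omega f x u -> has_rderiv omega g x v ->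
  has_rderiv omega (fun t => c * f t + g t) x (c * u + v).
Proof.
rewrite /has_rderiv => hf hg.
have -> : (fun t => (t - x)^-1 * (c * f t + g t - (c * f x + g x))) =
  (fun t => c * ((t - x)^-1 * (f t - f x)) + (t - x)^-1 * (g t - g x)).
  by apply/funext => t; ring.
by apply: cvgD => //; apply: cvgM => //; exact: cvg_cst.
Qed.

Lemma has_rderivZ f x u (c : R) : has_rderiv omega f x u ->
  has_rderiv omega (fun t => c * f t) x (c * u).
Proof.
rewrite /has_rderiv => hf.
have -> : (fun t => (t - x)^-1 * (c * f t - c * f x)) = (fun t => c * ((t - x)^-1 * (f t - f x))).
  by apply/funext => t; ring.
by apply: cvgM => //; exact: cvg_cst.
Qed.

Lemma has_rderiv_affine (c d x : R) : has_rderiv omega (fun t => c * t + d) x c.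
Proof.
apply: is_derive_rderiv.
have d1 : is_derive x 1 (fun y : R => c * y) c.
  by have := is_deriveZ c (is_derive_id x 1); rewrite /GRing.scale /= mulr1.
by have := is_deriveD d1 (is_derive_cst d x 1); rewrite addr0.
Qed.

(** The constant [c] is the mean of [F] over the segment, which makes both boundary values
    vanish. *)
Lemma dirichlet_primitive (F : R -> R) : {within I, continuous F} -> exists (g : R -> R) (c : R),
  [/\ g 0 = 0, g omega = 0 & forall x, 0 <= x <= omega -> has_rderiv omega g x (c - F x)].
Proof.
move=> cF; have [G [G0 hG]] := prim_ex cF.
exists (fun x => -1 * G x + (G omega / omega * x + 0)), (G omega / omega); split.
- by rewrite G0; ring.
- by field; rewrite gt_eqF.
- move=> x xw; have -> : G omega / omega - F x = -1 * F x + G omega / omega by ring.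
  by apply: has_rderiv_lin; [exact: hG|exact: has_rderiv_affine].
Qed.

(** The problem of order [2m] splits into second order problems: [- g'' = f] is solved with
    Dirichlet conditions, and induction is applied to [g]. *)
Lemma green_smooth m (f : R -> R) : {within I, continuous f} -> exists a : nat -> R -> R,
  [/\ forall j, (j < 2 * m)%N -> forall x, 0 <= x <= omega -> has_rderiv omega (a j) x (a j.+1 x),
      forall j, (j < m)%N -> a (2 * j) 0 = 0 /\ a (2 * j) omega = 0 &
      forall x, 0 <= x <= omega -> a (2 * m) x = (-1) ^+ m * f x].
Proof.
elim: m f => [|m IH] f cf; first by exists (fun=> f); split => // x _; rewrite expr0 mul1r.
have [F [F0 hF]] := prim_ex cf.
have [g [c [g0 gw hg]]] := dirichlet_primitive (rderiv_within hF).
have [b [b1 b2 b3]] := IH g (rderiv_within hg).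
exists (fun j => if (j <= 2 * m)%N then b j
  else if j == (2 * m).+1 then fun x => (-1) ^+ m * (c - F x) else fun x => (-1) ^+ m.+1 * f x).
split.
- move=> j jm x xw.
  have [j1|] := leqP j.+1 (2 * m); first by rewrite (ltnW j1); exact: b1 j1 _ xw.
  rewrite ltnS leq_eqVlt => /predU1P[<-|j2].
    rewrite leqnn eqxx; apply: (@has_rderiv_eq _ omega (fun t => (-1) ^+ m * g t)) => //.
      by move=> t tw; rewrite b3.
    by apply: has_rderivZ; exact: hg.
  have -> : j = (2 * m).+1 by lia.
  rewrite eqxx ltnn (_ : ((2 * m).+2 == (2 * m).+1) = false); last by lia.
  have -> : (-1) ^+ m.+1 * f x = (-1) ^+ m * (-1 * f x + 0) by rewrite exprS; ring.
  apply: has_rderivZ.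
  have -> : (fun t => c - F t) = (fun t => -1 * F t + (0 * t + c)).
    by apply/funext => t; ring.
  by apply: has_rderiv_lin; [exact: hF|exact: has_rderiv_affine].
- move=> j; rewrite ltnS leq_eqVlt => /predU1P[->|jm].
    by rewrite leqnn !b3 ?g0 ?gw ?mulr0// lexx (ltW omega0).
  by rewrite leq_pmul2l// (ltnW jm); exact: b2.
- move=> x xw.
  have e1 : (2 * m.+1 <= 2 * m)%N = false.
    by apply/negbTE; rewrite -ltnNge mulnS add2n ltnS leqnSn.
  have e2 : (2 * m.+1 == (2 * m).+1)%N = false by rewrite mulnS add2n eqSS gtn_eqF.
  by rewrite e1 e2.
Qed.

End tower.

(** * The Dirichlet problem with square integrable right-hand side *)

Section primitive.
Context (R : realType).
Variable omega : R.
Hypothesis omega0 : 0 < omega.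
Local Notation lam := (@lebesgue_measure R).
Local Notation I := (`[0, omega]%classic : set (measurableTypeR R)).

Section acl_primitive.
Variables (F g : R -> R).
Hypothesis ig : lam.-integrable I (EFin \o g).
Hypothesis ig2 : lam.-integrable I (EFin \o (fun x => g x ^+ 2)).
Hypothesis FE : forall x, 0 <= x <= omega -> F x = F 0 + Rintegral lam `[0, x] g.

Let N x := Rintegral lam `[0, x] (fun x => g x ^+ 2).

Let sub (h : R -> R) (p q : R) : 0 <= p -> q <= omega -> lam.-integrable I (EFin \o h) ->
  lam.-integrable `]p, q] (EFin \o h).
Proof.
move=> p0 qw ih; apply: (integrableS _ _ _ ih); [exact: measurable_itv|exact: measurable_itv|].
move=> x; rewrite /= !in_itv /= => /andP[px xq].
by rewrite (ltW (le_lt_trans p0 px)) (le_trans xq qw).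
Qed.

Let dif (h : R -> R) (p q : R) : 0 <= p -> p <= q -> q <= omega -> lam.-integrable I (EFin \o h) ->
  Rintegral lam `[0, q] h - Rintegral lam `[0, p] h = Rintegral lam `]p, q] h.
Proof.
move=> p0 pq qw ih; apply: (@Rintegral_itvB R h (BLeft 0) (BRight q) p); rewrite ?bnd_simp//.
apply: (integrableS _ _ _ ih); [exact: measurable_itv|exact: measurable_itv|].
by move=> x; rewrite /= !in_itv /= => /andP[-> /le_trans]; apply.
Qed.

Let N_mono p q : 0 <= p -> p <= q -> q <= omega -> N p <= N q.
Proof.
move=> p0 pq qw; rewrite -subr_ge0 dif//.
by apply: Rintegral_ge0 => x _; exact: sqr_ge0.
Qed.

(** The pointwise inequality [|g| <= c * g^2 + 1 / c], integrated. It separates a part summing to at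
    most [c * N omega] from a part proportional to length. *)
Let F_le (c p q : R) : 0 < c -> 0 <= p -> p <= q -> q <= omega ->
  `|F q - F p| <= c * (N q - N p) + c^-1 * (q - p).
Proof.
move=> c0 p0 pq qw.
have pw := le_trans pq qw; have q0 := le_trans p0 pq.
rewrite (FE (x := q)) ?q0// (FE (x := p)) ?p0// opprD addrACA subrr add0r dif//.
have mpq : measurable (`]p, q]%classic : set (measurableTypeR R)) by exact: measurable_itv.
have i1 : lam.-integrable `]p, q] (EFin \o (fun=> 1 : R)).
  have h : lam.-integrable `[0, omega] (EFin \o (fun=> 1 : R)).
    apply: continuous_compact_integrable; first exact: segment_compact.
    by apply: continuous_subspaceT => x; exact: cst_continuous.
  exact: sub.
have i2 := sub p0 qw ig2.
have i2' : lam.-integrable `]p, q] (EFin \o (fun x => c * g x ^+ 2)) by have := integrableZl mpq c i2.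
have i1' : lam.-integrable `]p, q] (EFin \o (fun x : R => c^-1 * 1)) by have := integrableZl mpq c^-1 i1.
apply: le_trans (le_normr_Rintegral mpq (sub p0 qw ig)) _.
apply: (@le_trans _ _ (Rintegral lam `]p, q] (fun x => c * g x ^+ 2 + c^-1 * 1))).
  apply: le_Rintegral => //.
  - by have := integrable_norm (sub p0 qw ig).
  - by have := integrableD mpq i2' i1'.
  - move=> x _; rewrite -[g x ^+ 2]real_normK ?num_real// mulr1.
    have := normr_ge0 (g x); move: (`|g x|) => y y0.
    have h : 0 <= c^-1 * (c * y - 1) ^+ 2 by rewrite mulr_ge0 ?sqr_ge0 ?invr_ge0 ?ltW.
    have e : c^-1 * (c * y - 1) ^+ 2 = c * y ^+ 2 + c^-1 - 2 * y by field; rewrite gt_eqF.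
    by rewrite e in h; lra.
rewrite RintegralD// RintegralZl// RintegralZl// Rintegral_cst// -dif//.
rewrite lerD2l mul1r /= lebesgue_measure_itv /= lte_fin.
case: ifPn => [_|]; first by rewrite -EFinB.
by rewrite -leNgt => qp; rewrite (le_anti (introT andP (conj pq qp))) subrr.
Qed.

Lemma acl_primitive : acl omega F.
Proof.
move=> eps e0; have B0 : 0 <= N omega by apply: Rintegral_ge0 => x _; exact: sqr_ge0.
pose c := eps / (2 * (N omega + 1)).
have c0 : 0 < c by rewrite divr_gt0// mulr_gt0// ltr_wpDl.
exists (eps * c / 2); first by rewrite divr_gt0// mulr_gt0.
move=> l vl ll.
have w0 := ltW omega0.
have /andP[al pl] := vl.
apply: (@le_trans _ _ (c * (\sum_(p <- l) (N p.2 - N p.1)) + c^-1 * len l)).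
  rewrite !mulr_sumr -big_split /= /vsum big_seq [leRHS]big_seq; apply: ler_sum => p.
  by move=> /(allP al)/andP[/andP[h1 h2] h3]; exact: F_le.
have hN : \sum_(p <- l) (N p.2 - N p.1) <= N omega.
  (* [M] is [N] extended to a monotone function on the line. It maps non-overlapping intervals to
     non-overlapping ones, so [len_valid] bounds the sum of the increments. *)
  pose M x := N (Num.min omega (Num.max 0 x)).
  have MK x : 0 <= x <= omega -> M x = N x.
    by move=> /andP[x0 xw]; rewrite /M (max_idPr x0) (min_idPr xw).
  have Mm : {homo M : x y / x <= y}.
    move=> x y xy; apply: N_mono.
    - by rewrite le_min w0 le_max lexx.
    - have h : Num.max 0 x <= Num.max 0 y by rewrite ge_max !le_max lexx xy orbT.
      by rewrite le_min !ge_min lexx /= h orbT.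
    - by rewrite ge_min lexx.
  have := @len_valid _ (N 0) (N omega) [seq (M p.1, M p.2) | p <- l] (N_mono (lexx _) w0 (lexx _)).
  rewrite /len big_map /= => h.
  have -> : \sum_(p <- l) (N p.2 - N p.1) = \sum_(p <- l) (M p.2 - M p.1).
    rewrite big_seq [RHS]big_seq; apply: eq_bigr => p /(allP al)/andP[/andP[h1 h2] h3].
    by rewrite !MK ?h3 ?h1 ?(le_trans h1)//= (le_trans h2).
  apply: (le_trans (h _)).
    apply/andP; split; last exact: pairwise_map_disj.
    apply/allP => _ /mapP[p /(allP al)/andP[/andP[h1 h2] h3] ->].
    have p2w := le_trans h2 h3; have p20 := le_trans h1 h2.
    have M1 : M p.1 = N p.1 by apply: MK; rewrite h1.
    have M2 : M p.2 = N p.2 by apply: MK; rewrite p20.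
    rewrite /in_seg /= M1 M2; apply/andP; split; first (apply/andP; split).
    - exact: N_mono.
    - exact: N_mono.
    - exact: N_mono.
  by rewrite gerBl; apply: Rintegral_ge0 => x _; exact: sqr_ge0.
have h1 : c * \sum_(p <- l) (N p.2 - N p.1) <= eps / 2.
  apply: (le_trans (ler_wpM2l (ltW c0) hN)); rewrite /c.
  rewrite mulrAC ler_pdivrMr ?mulr_gt0 ?ltr_wpDl//.
  by move: (N omega) e0 => b e0; nra.
have h2 : c^-1 * len l <= eps / 2.
  rewrite mulrC ler_pdivrMr//; apply: ltW; apply: (lt_le_trans ll).
  by rewrite mulrAC.
lra.
Qed.

End acl_primitive.

(** The second order step next to [f] has only an absolutely continuous first derivative; after it
    the right-hand side is continuous, and [green_smooth] takes the other [k.-1] steps. *)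
Lemma tower_ex k (f : R -> R) : (0 < k)%N -> lam.-integrable setT (EFin \o f) ->
  lam.-integrable I (EFin \o (fun x => f x ^+ 2)) ->
  exists a, tower omega k a (fun x => (-1) ^+ k * f x).
Proof.
move=> k0 jf if2.
have iI : lam.-integrable I (EFin \o f) by apply: (integrableS measurableT).
pose P x := Rintegral lam `[0, x] f.
have P0 : P 0 = 0.
  by rewrite /P set_itv1 Rintegral_set1.
have aP : acl omega P.
  by apply: (acl_primitive iI if2) => x xw; rewrite P0 add0r.
have [g [c [g0 gw hg]]] := dirichlet_primitive omega0 (acl_continuous aP).
have [b [b1 b2 b3]] := green_smooth omega0 k.-1 (rderiv_within hg).
have e1 : (2 * k).-1 = (2 * k.-1).+1 by lia.
exists (fun j => if (j <= 2 * k.-1)%N then b j else fun x => (-1) ^+ k.-1 * (c - P x)).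
have sgn : (-1) ^+ k = - (-1) ^+ k.-1 :> R by rewrite -[k in LHS]prednK// exprS mulN1r.
have ig : lam.-integrable setT (EFin \o (fun x => (-1) ^+ k * f x)).
  by have := integrableZl measurableT ((-1) ^+ k) jf.
have pr x : 0 <= x <= omega -> (-1) ^+ k.-1 * (c - P x) =
    (-1) ^+ k.-1 * (c - P 0) + Rintegral lam `[0, x] (fun x => (-1) ^+ k * f x).
  move=> xw; rewrite RintegralZl//; last by apply: (integrableS measurableT) => //; exact: measurable_itv.
  by rewrite -/(P x) P0 sgn; ring.
split.
- move=> j; rewrite e1 ltnS => jk x xw; rewrite jk.
  move: jk; rewrite leq_eqVlt => /predU1P[->|jk]; last by rewrite jk; exact: b1.
  rewrite ltnn; apply: (@has_rderiv_eq _ omega (fun t => (-1) ^+ k.-1 * g t)) => //.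
    by move=> t tw; rewrite b3.
  by apply: has_rderivZ; exact: hg.
- rewrite e1 ltnn; apply: (@acl_primitive _ (fun x => (-1) ^+ k * f x)) => //.
    by apply: (integrableS measurableT).
  rewrite (_ : (fun x => _) = (fun x => f x ^+ 2))//.
  by apply/funext => x; rewrite exprMn -exprM mulnC exprM sqrrN expr1n expr1n mul1r.
- exact: ig.
- by move=> x xw; rewrite e1 ltnn; exact: pr.
- move=> j jk; have h : (j <= k.-1)%N by rewrite -ltnS prednK.
  rewrite leq_pmul2l// h; move: h; rewrite leq_eqVlt => /predU1P[->|]; last exact: b2.
  by rewrite !b3 ?g0 ?gw ?mulr0// lexx (ltW omega0).
Qed.

End primitive.

(** * Towers of derivatives and the Sobolev space *)

Section sobolev_tower.
Context (R : realType).
Local Notation C := R[i].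
Variable omega : R.
Hypothesis omega0 : 0 < omega.
Local Notation lam := (@lebesgue_measure R).
Local Notation mo := (lebesgue_on omega).
Local Notation I := `[0, omega]%classic.
Variable k : nat.
Hypothesis k0 : (0 < k)%N.

Let k2 : (0 < 2 * k)%N. Proof. by rewrite muln_gt0. Qed.

Lemma tower_ae a g : tower omega k a g ->
  {ae lam, forall x : R, 0 <= x <= omega -> has_rderiv omega (a (2 * k).-1) x (g x)}.
Proof.
move=> aT; apply: ae_seg; apply: ae_lebS (ac_is_derive (tower_int aT) (tower_prim aT)) => x h xw.
by apply: is_derive_rderiv; exact: h.
Qed.

Lemma ae_derive y (gr gi : R -> R) :
  {ae lam, forall x : R, 0 <= x <= omega -> has_rderiv omega (rp y) x (gr x)} ->
  {ae lam, forall x : R, 0 <= x <= omega -> has_rderiv omega (ip_ y) x (gi x)} ->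
  {ae mo, forall x : R, derive_within I y x = (gr x +i* gi x)%C}.
Proof.
move=> hr hi; apply/ae_mo; apply: ae_lebS2 hr hi => x h1 h2 xw.
by have [] := has_rderiv_derive omega0 xw (h1 xw) (h2 xw).
Qed.

Lemma derivnS (y : R -> C^o) : derivn_within I (2 * k) y = derive_within I (derivn_within I (2 * k).-1 y).
Proof. by rewrite -[X in derivn_within _ X]prednK. Qed.

Lemma sobolev_tower y : sobolev omega (2 * k) y -> dirichlet_bc omega k y ->
  exists gr gi : R -> R, [/\ tower omega k (fun j => rp (derivn_within I j y)) gr,
    tower omega k (fun j => ip_ (derivn_within I j y)) gi &
    {ae mo, forall x : R, derivn_within I (2 * k) y x = (gr x +i* gi x)%C}].
Proof.
move=> [hd acy _] bc; have [acr aci] := ac_acl acy.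
have [gr igr grE] := ac_primitive omega0 acr; have [gi igi giE] := ac_primitive omega0 aci.
have tr : tower omega k (fun j => rp (derivn_within I j y)) gr.
  split => //.
  - move=> j jk x xw; have xI : x \in `[0, omega] by rewrite in_itv.
    by have [] := derivable_has_rderiv (hd j jk x xI).
  - by move=> j jk; have [h1 h2] := bc j jk; rewrite /rp h1 h2.
have ti : tower omega k (fun j => ip_ (derivn_within I j y)) gi.
  split => //.
  - move=> j jk x xw; have xI : x \in `[0, omega] by rewrite in_itv.
    by have [] := derivable_has_rderiv (hd j jk x xI).
  - by move=> j jk; have [h1 h2] := bc j jk; rewrite /ip_ h1 h2.
exists gr, gi; split => //.
by rewrite derivnS; exact: (ae_derive (tower_ae tr) (tower_ae ti)).
Qed.

Lemma tower_sobolev a b gr gi : tower omega k a gr -> tower omega k b gi ->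
  sqint mo gr -> sqint mo gi -> let y : R -> C^o := fun x => (a 0 x +i* b 0 x)%C in
  [/\ sobolev omega (2 * k) y, dirichlet_bc omega k y &
    {ae mo, forall x : R, derivn_within I (2 * k) y x = (gr x +i* gi x)%C}].
Proof.
move=> aT bT sr si y.
have dE j : (j <= (2 * k).-1)%N -> forall x, 0 <= x <= omega ->
    derivn_within I j y x = (a j x +i* b j x)%C.
  elim: j => [//|j IH] jk x xw.
  have h1 := tower_deriv aT jk xw; have h2 := tower_deriv bT jk xw.
  have h1' : has_rderiv omega (rp (derivn_within I j y)) x (a j.+1 x).
    by apply: has_rderiv_eq h1 => // t tw; rewrite /rp IH// ltnW.
  have h2' : has_rderiv omega (ip_ (derivn_within I j y)) x (b j.+1 x).
    by apply: has_rderiv_eq h2 => // t tw; rewrite /ip_ IH// ltnW.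
  by have [] := has_rderiv_derive omega0 xw h1' h2'.
have rE j : (j <= (2 * k).-1)%N -> forall x, 0 <= x <= omega -> a j x = rp (derivn_within I j y) x.
  by move=> jk x xw; rewrite /rp dE.
have iE j : (j <= (2 * k).-1)%N -> forall x, 0 <= x <= omega -> b j x = ip_ (derivn_within I j y) x.
  by move=> jk x xw; rewrite /ip_ dE.
have ae : {ae mo, forall x : R, derivn_within I (2 * k) y x = (gr x +i* gi x)%C}.
  rewrite derivnS; apply: ae_derive.
    apply: ae_lebS (tower_ae aT) => x h xw; apply: has_rderiv_eq (h xw) => //; exact: rE.
  apply: ae_lebS (tower_ae bT) => x h xw; apply: has_rderiv_eq (h xw) => //; exact: iE.
have acl_eq (f g : R -> R) : (forall x, 0 <= x <= omega -> f x = g x) -> acl omega f -> acl omega g.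
  move=> fg af eps /af[d d0 hd]; exists d => // l vl ll.
  rewrite (_ : vsum g l = vsum f l); first exact: hd.
  rewrite /vsum big_seq [RHS]big_seq; apply: eq_bigr => p.
  have /andP[/allP al _] := vl; move=> /al/andP[/andP[h1 h2] h3].
  by rewrite !fg// ?h1 ?h3 ?andbT ?(le_trans h1)//= (le_trans h2).
split => //.
- split.
  + move=> j jk x; rewrite in_itv /= => xw.
    have h1 : has_rderiv omega (rp (derivn_within I j y)) x (a j.+1 x).
      by apply: has_rderiv_eq (tower_deriv aT jk xw) => // t tw; apply: rE => //; exact: ltnW.
    have h2 : has_rderiv omega (ip_ (derivn_within I j y)) x (b j.+1 x).
      by apply: has_rderiv_eq (tower_deriv bT jk xw) => // t tw; apply: iE => //; exact: ltnW.
    by have [] := has_rderiv_derive omega0 xw h1 h2.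
  + apply: acl_ac.
      by apply: acl_eq (tower_acl aT); exact: rE.
    by apply: acl_eq (tower_acl bT); exact: iE.
  + pose w : measurableTypeR R -> C := fun x => (gr x +i* gi x)%C.
    exists (cls mo w); have h := @clsE _ _ R mo w (@sqint_cls _ _ R mo w sr si).
    by apply: ae_moS2 h ae => x _ -> ->.
- move=> j jk; have jk2 : (2 * j <= (2 * k).-1)%N by rewrite -ltnS prednK// ltn_pmul2l.
  have [a0 aw] := tower_bc aT jk; have [b0 bw] := tower_bc bT jk.
  by rewrite !dE ?lexx ?(ltW omega0)// a0 aw b0 bw.
Qed.

End sobolev_tower.

(** * Multiplication by an L2 function *)

Section multiplication.
Context d (T : measurableType d) (R : realType).
Variable mu : {measure set T -> \bar R}.
Hypothesis mu_fin : (mu setT < +oo)%E.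
Local Notation H := (L2 mu).
Local Notation C := R[i].
Variable phi : nat -> T -> R.
Variable K : R.
Hypothesis phi_meas : forall n, measurable_fun setT (phi n).
Hypothesis K0 : 0 <= K.
Hypothesis phi_K : forall n x, `|phi n x| <= K.
Hypothesis phi_l2 : forall n, sqint mu (phi n).
Hypothesis B : onb (@basis _ _ R mu phi) (@coef _ _ R mu phi).
Variable q : H.

Let ae_and (P Q : T -> Prop) : {ae mu, forall x, P x} -> {ae mu, forall x, Q x} ->
  {ae mu, forall x, P x /\ Q x}.
Proof. by apply: ae_trans3. Qed.

Let qphi n x : C := q x * (phi n x)%:C.

Definition mul_basis n : H := cls mu (qphi n).

Lemma complex_measurableM (f g : T -> C) : complex_measurable f -> complex_measurable g ->
  complex_measurable (fun x => f x * g x).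
Proof.
move=> [fr fi] [gr gi]; split.
- rewrite (_ : (fun x => _) = (fun x => complex.Re (f x) * complex.Re (g x) - complex.Im (f x) * complex.Im (g x))).
    by apply: measurable_funB; apply: measurable_funM.
  by apply/funext => x; case: (f x) (g x) => [a b] [a' b'].
- rewrite (_ : (fun x => _) = (fun x => complex.Re (f x) * complex.Im (g x) + complex.Im (f x) * complex.Re (g x))).
    by apply: measurable_funD; apply: measurable_funM.
  by apply/funext => x; case: (f x) (g x) => [a b] [a' b'].
Qed.

Let phi_cm n : complex_measurable (fun x => (phi n x)%:C).
Proof. by split => /=; [exact: phi_meas|exact: measurable_cst]. Qed.

Let qphi_cm n : complex_measurable (qphi n).
Proof. by apply: complex_measurableM; [exact: L2_meas|exact: phi_cm]. Qed.

Let cn_qphi n x : cn (qphi n x) ^+ 2 <= K ^+ 2 * cn (q x) ^+ 2.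
Proof.
rewrite /qphi cnM exprMn mulrC ler_wpM2r ?sqr_ge0//.
by rewrite cn_real -[K ^+ 2]ger0_norm ?sqr_ge0// normrX ler_sqr ?nnegrE// [`|K|]ger0_norm.
Qed.

Let int_qphi n : (\int[mu]_x (cn (qphi n x) ^+ 2)%:E <= (K ^+ 2 * nr q ^+ 2)%:E)%E.
Proof.
rewrite EFinM nrsq -ge0_integralZl//; last 3 first.
- by apply: measurable_cnsq; exact: L2_meas.
- by move=> x _; rewrite lee_fin sqr_ge0.
- by rewrite lee_fin sqr_ge0.
apply: ge0_le_integral => //.
- by move=> x _; rewrite lee_fin sqr_ge0.
- by apply: measurable_cnsq; exact: qphi_cm.
- by apply: emeasurable_funM => //; apply: measurable_cnsq; exact: L2_meas.
- by move=> x _; rewrite -EFinM lee_fin.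
Qed.

Let qphi_sqi n : square_integrable mu (qphi n).
Proof.
apply/square_integrableP; split; first exact: qphi_cm.
by apply: le_lt_trans (int_qphi n) _; rewrite ltry.
Qed.

Lemma nr_mul_basis n : nr (mul_basis n) <= K * nr q.
Proof.
rewrite -ler_sqr ?nnegrE ?mulr_ge0 ?nr_ge0// exprMn -lee_fin.
by rewrite (nrsq_ae (qphi_cm n) (clsE (qphi_sqi n))).
Qed.

Lemma mul_basis_sum (c : nat -> C) n : {ae mu, forall x,
  (\sum_(i < n) c i *: mul_basis i : H) x = q x * (\sum_(i < n) c i *: @basis _ _ R mu phi i : H) x}.
Proof.
elim: n => [|n IH].
  by rewrite !big_ord0; apply: filterS (L2_0E mu) => x ->; rewrite mulr0.
rewrite !big_ord_recr /=.
have h1 := ae_and (L2_addE (\sum_(i < n) c i *: mul_basis i) (c n *: mul_basis n)) (L2_scaleE (c n) (mul_basis n)).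
have h2 := ae_and (L2_addE (\sum_(i < n) c i *: @basis _ _ R mu phi i) (c n *: @basis _ _ R mu phi n)) (L2_scaleE (c n) (@basis _ _ R mu phi n)).
have h3 := ae_and (clsE (qphi_sqi n)) (basisE phi_l2 n).
apply: (ae_trans3 _ (ae_and h1 h2) (ae_and h3 IH)) => x [[-> ->] [-> ->]] [[h4 ->] ->].
by rewrite [mul_basis n x]h4 /qphi mulrDr; ring.
Qed.

Let am_gm (eps a b : R) : 0 < eps -> a * b <= eps * a ^+ 2 + eps^-1 * b ^+ 2.
Proof.
move=> e0; have h : 0 <= eps^-1 * (eps * a - b) ^+ 2 by rewrite mulr_ge0 ?sqr_ge0 ?invr_ge0 ?ltW.
have h' : 0 <= eps * a ^+ 2 + eps^-1 * b ^+ 2.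
  by rewrite addr_ge0// mulr_ge0 ?sqr_ge0 ?invr_ge0// ltW.
have e : eps^-1 * (eps * a - b) ^+ 2 = eps * a ^+ 2 + eps^-1 * b ^+ 2 - 2 * (a * b).
  by field; rewrite gt_eqF.
by rewrite e in h; lra.
Qed.

(* The partial sums are [q] times those of the expansion of [u]; splitting
   [s - q u] accordingly, AM-GM bounds its [L1] norm by multiples of [L2] norms. *)
Lemma mul_lim (u s : H) :
  hcvg (fun n => \sum_(i < n) @coef _ _ R mu phi i u *: mul_basis i) s ->
  {ae mu, forall x, s x = q x * u x}.
Proof.
set c := fun i => @coef _ _ R mu phi i u => hs.
have hu := trunc_cvg B u.
pose E x := cn (s x - q x * u x).
have mE : complex_measurable (fun x => s x - q x * u x).
  by apply: complex_measurableB; [exact: L2_meas|apply: complex_measurableM; exact: L2_meas].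
have E_le n (eps : R) : 0 < eps ->
  {ae mu, forall x, setT x -> ((E x)%:E <= eps%:E * 1 + eps^-1%:E * (cn ((s - \sum_(i < n) c i *: mul_basis i : H) x) ^+ 2)%:E
    + (eps%:E * (cn (q x) ^+ 2)%:E + eps^-1%:E * (cn ((u - \sum_(i < n) c i *: @basis _ _ R mu phi i : H) x) ^+ 2)%:E))%E}.
  move=> e0; set Tn := \sum_(i < n) c i *: mul_basis i; set Sn := \sum_(i < n) c i *: @basis _ _ R mu phi i.
  apply: (ae_trans3 _ (mul_basis_sum c n) (ae_and (L2_subE s Tn) (L2_subE u Sn))) => x.
  rewrite -/Tn -/Sn => hT [-> ->] _.
  rewrite mule1 -!EFinM -!EFinD lee_fin /E hT.
  have -> : s x - q x * u x = (s x - q x * (Sn : H) x) - q x * (u x - (Sn : H) x) by ring.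
  rewrite (le_trans (cnD _ _))// cnN cnM lerD ?am_gm//.
  by have := @am_gm eps 1 (cn (s x - q x * (Sn : H) x)) e0; rewrite mul1r expr1n mulr1.
have M0 : exists2 M, 0 <= M & (mu setT = M%:E)%E.
  exists (fine (mu setT)); first by rewrite fine_ge0.
  by rewrite fineK// ge0_fin_numE.
have [M M_ge0 ME] := M0.
have int_E n (eps : R) : 0 < eps -> (\int[mu]_x (E x)%:E <=
   (eps * M + eps^-1 * nr (s - \sum_(i < n) c i *: mul_basis i) ^+ 2 +
   (eps * nr q ^+ 2 + eps^-1 * nr (u - \sum_(i < n) c i *: @basis _ _ R mu phi i) ^+ 2))%:E)%E.
  move=> e0; set Tn := \sum_(i < n) c i *: mul_basis i; set Sn := \sum_(i < n) c i *: @basis _ _ R mu phi i.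
  have ei : (0 <= eps^-1%:E)%E by rewrite lee_fin invr_ge0 ltW.
  have ep : (0 <= eps%:E)%E by rewrite lee_fin ltW.
  have mc (v : H) : measurable_fun setT (fun x => (cn (v x) ^+ 2)%:E) by apply: measurable_cnsq; exact: L2_meas.
  have mcz (a : \bar R) (v : H) : measurable_fun setT (fun x => a * (cn (v x) ^+ 2)%:E)%E.
    by apply: emeasurable_funM => //; exact: mc.
  have pc (a : \bar R) (v : H) x : (0 <= a)%E -> (0 <= a * (cn (v x) ^+ 2)%:E)%E.
    by move=> a0; rewrite mule_ge0// lee_fin sqr_ge0.
  have p1 : (0 <= eps%:E * 1)%E by rewrite mule1.
  apply: (@le_trans _ _ (\int[mu]_x (eps%:E * 1 + eps^-1%:E * (cn ((s - Tn : H) x) ^+ 2)%:E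
    + (eps%:E * (cn (q x) ^+ 2)%:E + eps^-1%:E * (cn ((u - Sn : H) x) ^+ 2)%:E)))%E).
    apply: ae_ge0_le_integral => //.
    - by move=> x _; rewrite lee_fin cn_ge0.
    - by apply/measurable_EFinP; exact: measurable_cn.
    - by move=> x _; apply: adde_ge0; apply: adde_ge0; rewrite ?p1 ?pc.
    - by apply: emeasurable_funD; apply: emeasurable_funD.
    - exact: E_le.
  rewrite ge0_integralD//; last 4 first.
  - by move=> x _; apply: adde_ge0; rewrite ?p1 ?pc.
  - exact: emeasurable_funD.
  - by move=> x _; apply: adde_ge0; rewrite ?p1 ?pc.
  - exact: emeasurable_funD.
  rewrite !ge0_integralD//; try by move=> x _; rewrite pc.
  rewrite !ge0_integralZl//; try by move=> x _; rewrite lee_fin sqr_ge0.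
  by rewrite integral_cst// mul1e ME -!nrsq -!EFinM -!EFinD.
have int0 : (\int[mu]_x (E x)%:E = 0)%E.
  apply/eqP; rewrite eq_le; apply/andP; split; last first.
    by apply: integral_ge0 => x _; rewrite lee_fin cn_ge0.
  apply/lee_addgt0Pr => e e0; rewrite add0e.
  (* This makes the two terms independent of [n] at most [e / 2]; the other two, with factor
     [eps^-1], are then made small by the choice of [n]. *)
  pose eps := e / (2 * (M + nr q ^+ 2 + 1)).
  have L0 : 0 < M + nr q ^+ 2 + 1 by rewrite ltr_wpDl// addr_ge0// sqr_ge0.
  have eps0 : 0 < eps by rewrite divr_gt0// mulr_gt0.
  have c0 : (fun n => eps^-1 * (nr (s - \sum_(i < n) c i *: mul_basis i) ^+ 2 +
      nr (u - \sum_(i < n) c i *: @basis _ _ R mu phi i) ^+ 2)) @ \oo --> 0.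
    have sq0 (z : nat -> R) : z @ \oo --> 0 -> (fun n => z n ^+ 2) @ \oo --> 0.
      move=> z0; have -> : (fun n => z n ^+ 2) = (fun n => z n * z n) by apply/funext => n; rewrite expr2.
      by rewrite -[X in _ --> X](mulr0 0); exact: cvgM.
    by apply: cvg0M; apply: cvg0D; exact: sq0.
  move/cvgrPdist_lt : c0 => /(_ (e / 2)); rewrite divr_gt0// => /(_ isT)[n _ /(_ n (leqnn _))].
  rewrite sub0r normrN => /(le_lt_trans (ler_norm _)) hn.
  apply: (le_trans (int_E n eps eps0)); rewrite lee_fin.
  have he : eps * (M + nr q ^+ 2) <= e / 2.
    rewrite /eps; set L := M + nr q ^+ 2 in L0 *.
    by rewrite mulrAC ler_pdivrMr ?mulr_gt0//; nra.
  by move: hn he; rewrite !mulrDr; lra.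
have mE' : measurable_fun setT (EFin \o E) by apply/measurable_EFinP; exact: measurable_cn.
have /(ae_eq_integral_abs mu measurableT mE') : (\int[mu]_x `|(EFin \o E) x| = 0)%E.
  by rewrite -[RHS]int0; apply: eq_integral => x _; rewrite /= ger0_norm ?cn_ge0.
apply: filterS => x /(_ Logic.I) [/cn_eq0/eqP].
by rewrite subr_eq0 => /eqP.
Qed.

End multiplication.

(** * The Dirichlet operator *)

Section dirichlet_sine_basis.
Context (R : realType).
Local Notation C := R[i].
Variable omega : R.
Hypothesis omega0 : 0 < omega.
Local Notation lam := (@lebesgue_measure R).
Local Notation mo := (lebesgue_on omega).
Local Notation D := (`[0, omega]%classic : set (measurableTypeR R)).
Local Notation H := (L2 mo).
Variable k : nat.
Hypothesis k1 : (1 < k)%N.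

Let k0 : (0 < k)%N. Proof. exact: ltnW. Qed.
Let mD : measurable D. Proof. exact: measurable_itv. Qed.

Local Notation co := (@coef _ _ R mo (phi omega)).
Let B := sine_onb omega0.

Definition eigval n : R := freq omega n ^+ (2 * k).

Lemma coef_Rint (u : H) (F G : R -> R) n : measurable_fun D F -> measurable_fun D G ->
  {ae mo, forall x : R, u x = (F x +i* G x)%C} ->
  co n u = (Rintegral lam D (fun x => phi omega n x * F x) +i* Rintegral lam D (fun x => phi omega n x * G x))%C.
Proof.
move=> mF mG uE.
have mphi := @phi_meas R omega n.
have mphiD : measurable_fun D (phi omega n) by exact: measurable_funTS.
have h (f g : R -> R) : measurable_fun (setT : set (measurableTypeR R)) f -> measurable_fun D g ->
    {ae mo, forall x : R, f x = g x} ->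
    ip mo f (phi omega n) = Rintegral lam D (fun x => phi omega n x * g x).
  move=> mf mg fg; rewrite /ip Rintegral_mo; last exact: measurable_funM.
  congr fine; apply: ae_eq_integral => //.
  - by apply/measurable_EFinP; apply: measurable_funM => //; exact: measurable_funTS.
  - by apply/measurable_EFinP; apply: measurable_funM.
  - have := (ae_mo omega (fun x => f x = g x)).1 fg.
    apply: ae_lebS => x hx; rewrite /= in_itv /= => /hx ->.
    by rewrite mulrC.
have [mr mi] := L2_meas u.
congr (_ +i* _)%C; apply: h => //.
- by apply: ae_moS uE => x _; rewrite /Re_ => ->.
- by apply: ae_moS uE => x _; rewrite /Im_ => ->.
Qed.

Lemma tower_cont a g : tower omega k a g -> {within D, continuous (a 0)}.
Proof. by move=> aT; apply: (rderiv_within (tower_deriv aT (j := 0) _)); lia. Qed.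

Lemma tower_meas a g : tower omega k a g -> measurable_fun D (a 0).
Proof. by move=> /tower_cont; apply: subspace_continuous_measurable_fun. Qed.

(** [tower_coef] for the real and imaginary parts; its sign [(-1) ^+ k] cancels the one in [h]. *)
Lemma coef_rel (a b : nat -> R -> R) (gr gi : R -> R) (u h : H) n :
  tower omega k a gr -> tower omega k b gi ->
  {ae mo, forall x : R, u x = (a 0 x +i* b 0 x)%C} ->
  {ae mo, forall x : R, h x = (-1) ^+ k * (gr x +i* gi x)%C} ->
  co n h = (eigval n)%:C * co n u.
Proof.
move=> aT bT uE hE.
have mg c g : tower omega k c g -> measurable_fun D g.
  by move=> /tower_int/integrableP[/measurable_EFinP mg _]; exact: measurable_funTS.
have sgnC : (-1) ^+ k = (((-1) ^+ k : R)%:C) :> C by rewrite rmorphXn rmorphN1.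
rewrite (coef_Rint n (tower_meas aT) (tower_meas bT) uE).
rewrite (@coef_Rint h (fun x => (-1) ^+ k * gr x) (fun x => (-1) ^+ k * gi x)); last 3 first.
- by apply: measurable_funM => //; exact: mg aT.
- by apply: measurable_funM => //; exact: mg bT.
- by apply: ae_moS hE => x _ ->; rewrite sgnC; congr (_ +i* _)%C; rewrite !(mul0r, subr0, addr0).
suff e c g : tower omega k c g -> Rintegral lam D (fun x => phi omega n x * ((-1) ^+ k * g x)) =
    eigval n * Rintegral lam D (fun x => phi omega n x * c 0 x).
  by rewrite (e _ _ aT) (e _ _ bT); congr (_ +i* _)%C; rewrite /= !(mul0r, subr0, addr0).
move=> cT.
have isin (f : R -> R) : lam.-integrable D (EFin \o f) -> lam.-integrable D (EFin \o (fun x => sin (freq omega n * x) * f x)).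
  move=> jf; apply: (le_integrable mD _ _ jf).
    apply/measurable_EFinP; apply: measurable_funM.
      by apply: measurable_funTS; apply: continuous_meas; exact: csin.
    by case/integrableP: jf => /measurable_EFinP.
  by move=> x _; rewrite lee_fin normrM ler_piMl// sin_max.
have ig : lam.-integrable D (EFin \o g) by apply: (integrableS measurableT) => //; exact: tower_int cT.
have ic : lam.-integrable D (EFin \o c 0).
  by apply: continuous_compact_integrable; [exact: segment_compact|exact: tower_cont cT].
have -> : (fun x => phi omega n x * ((-1) ^+ k * g x)) =
    (fun x => (Num.sqrt (2 / omega) * (-1) ^+ k) * (sin (freq omega n * x) * g x)).
  by apply/funext => x; rewrite /phi; ring.
have -> : (fun x => phi omega n x * c 0 x) =
    (fun x => Num.sqrt (2 / omega) * (sin (freq omega n * x) * c 0 x)).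
  by apply/funext => x; rewrite /phi; ring.
rewrite !RintegralZl//; [|exact: isin|exact: isin].
rewrite (tower_coef omega0 n k0 cT) /eigval.
have s2 : (-1) ^+ k * (-1) ^+ k = 1 :> R by rewrite -exprMn mulrNN mulr1 expr1n.
set e := (-1) ^+ k in s2 *; set v := freq omega n ^+ _; set r := Num.sqrt _; set t := Rintegral _ _ _.
have -> : r * e * (e * v * t) = (e * e) * (v * (r * t)) by ring.
by rewrite s2 mul1r.
Qed.

Lemma sqint_patch (f : R -> R) : measurable_fun D f ->
  lam.-integrable D (EFin \o (fun x => f x ^+ 2)) -> sqint mo (f \_ D).
Proof.
move=> mf if2.
have mfD : measurable_fun (setT : set (measurableTypeR R)) (f \_ D).
  by apply/(measurable_restrictT _ mD).
split => //; apply/integrable_mo.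
  by apply/measurable_EFinP; exact: measurable_funX.
apply: eq_integrable if2 => // x xD.
by rewrite /= patchE xD.
Qed.

Variable q : H.
Local Notation K := (Num.sqrt (2 / omega)).
Local Notation b := (@mul_basis _ _ R mo (phi omega) q).

Lemma mo_fin : (mo setT < +oo)%E.
Proof.
rewrite /lebesgue_on /= /mrestr setTI lebesgue_measure_itv /= lte_fin omega0.
by rewrite -EFinB ltry.
Qed.

Lemma mul_lim_sine (u s : H) :
  hcvg (fun n => \sum_(i < n) co i u *: b i) s -> {ae mo, forall x : R, s x = q x * u x}.
Proof.
exact: (@mul_lim _ _ R mo mo_fin (phi omega) K (@phi_meas R omega) (sqrtr_ge0 _) (@phi_le R omega) (@phi_sqint R omega) B q u s).
Qed.

Lemma eigval_gt0 n : 0 < eigval n.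
Proof. by rewrite exprn_gt0// mulr_gt0 ?theta_gt0. Qed.

Lemma eigvalE n : eigval n = theta omega ^+ (2 * k) * n.+1%:R ^+ (2 * k).
Proof. by rewrite /eigval /freq exprMn mulrC. Qed.

Lemma eigval_ge n : theta omega ^+ (2 * k) * n.+1%:R ^+ 2 <= eigval n.
Proof.
rewrite eigvalE ler_wpM2l ?exprn_ge0 ?(ltW (theta_gt0 omega0))//.
by rewrite -!natrX ler_nat leq_pexp2l//; lia.
Qed.

(** Both [a ^ 3 <= a ^ p.-1] and [c ^ p <= c * a ^ p.-1], and [c + 1 <= a]. With [p = 2 * k] this is
    where [k > 1] is used for the cubic gaps. *)
Lemma expn_gap a c p : (c < a)%N -> (3 < p)%N -> (a ^ 3 + c ^ p <= a ^ p)%N.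
Proof.
move=> ca; case: p => // p p3.
have a0 : (0 < a)%N by exact: leq_ltn_trans ca.
apply: (@leq_trans (a ^ p + c * a ^ p)).
  apply: leq_add; first by rewrite leq_pexp2l.
  by rewrite expnS leq_mul2l leq_exp2r ?(ltnW ca) ?orbT//; lia.
by rewrite -{1}[(a ^ p)%N]mul1n -mulnDl add1n expnS leq_mul2r ca orbT.
Qed.

Lemma eigval_gap m n : m != n ->
  theta omega ^+ (2 * k) * (maxn m n).+1%:R ^+ 3 <= `|eigval m - eigval n|.
Proof.
wlog nm : m n / (n < m)%N => [hw|_].
  rewrite neq_ltn => /orP[h|h]; last by apply: hw => //; rewrite gtn_eqF.
  by rewrite maxnC distrC; apply: hw => //; rewrite gtn_eqF.
rewrite (maxn_idPl (ltnW nm)) !eigvalE -mulrBr normrM ger0_norm ?exprn_ge0 ?(ltW (theta_gt0 omega0))//.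
rewrite ler_wpM2l ?exprn_ge0 ?(ltW (theta_gt0 omega0))//.
apply: le_trans (ler_norm _).
by rewrite lerBrDr -!natrX -natrD ler_nat; apply: expn_gap; rewrite ?ltnS//; lia.
Qed.

Let ae_and (P Q : R -> Prop) : {ae mo, forall x : R, P x} -> {ae mo, forall x : R, Q x} ->
  {ae mo, forall x : R, P x /\ Q x}.
Proof. by apply: ae_moS2. Qed.

Lemma L_dir_pert : L_dir k q = pert_op co eigval b.
Proof.
apply/seteqP; split=> -[u f] /=.
- move=> [y [sy bc uE fE]].
  have [gr [gi [aT bT dE]]] := sobolev_tower omega0 k0 sy bc.
  have [_ _ [w wE]] := sy.
  pose h : H := (-1) ^+ k *: w.
  have hE : {ae mo, forall x : R, h x = (-1) ^+ k * derivn_within `[0, omega] (2 * k) y x}.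
    by apply: ae_moS2 (L2_scaleE ((-1) ^+ k) w) wE => x _ -> ->.
  have hE' : {ae mo, forall x : R, h x = (-1) ^+ k * (gr x +i* gi x)%C}.
    by apply: ae_moS2 hE dE => x _ -> ->.
  have uE' : {ae mo, forall x : R, u x = (rp y x +i* ip_ y x)%C}.
    by apply: ae_moS uE => x _ /= ->; rewrite /rp /ip_; case: (y x).
  have coh n := coef_rel n aT bT uE' hE'.
  exists h; split => //.
  pose W := (theta omega ^+ (2 * k))^-1.
  have W0 : 0 <= W by rewrite invr_ge0 exprn_ge0// ltW// theta_gt0.
  (* The coefficients of [h] are square summable and the eigenvalues grow at least quadratically, so
     those of [u] are absolutely summable and the expansion of [q u] converges. *)
  have l1 N : \sum_(i < N) cn (co i u) <= nr h * (2 * W).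
    apply: (@le_trans _ _ (\sum_(i < N) cn (co i h) * (W * (i.+1%:R)^-1))).
      apply: ler_sum => i _; rewrite coh cnM cn_real ger0_norm ?(ltW (eigval_gt0 i))//.
      rewrite mulrAC ler_peMl ?cn_ge0// /W -invfM.
      rewrite -ler_pdivrMr ?invr_gt0 ?mulr_gt0 ?exprn_gt0 ?theta_gt0//.
      rewrite invrK mul1r; apply: le_trans (eigval_ge i).
      rewrite ler_wpM2l ?exprn_ge0 ?(ltW (theta_gt0 omega0))//.
      by rewrite expr2 ler_peMl// ler1n.
    apply: (@sum_mulr_le_sqr _ N (fun i => cn (co i h)) (fun i => W * (i.+1%:R)^-1)); rewrite ?nr_ge0 ?mulr_ge0//; first exact: (bessel B).
    under eq_bigr do rewrite exprMn; rewrite -mulr_sumr exprMn mulrC.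
    by rewrite ler_wpM2r ?sqr_ge0//; exact: sum_invsqr_le.
  have sm : summable co u b (nr h * (2 * W) * (K * nr q)).
    move=> N; rewrite (@le_trans _ _ (\sum_(i < N) cn (co i u) * (K * nr q)))//.
      apply: ler_sum => i _; rewrite ler_wpM2l ?cn_ge0//.
      by apply: nr_mul_basis; [exact: phi_meas|exact: sqrtr_ge0|exact: phi_le].
    by rewrite -mulr_suml ler_wpM2r ?mulr_ge0 ?sqrtr_ge0 ?nr_ge0.
  have [hs _] := lcP B sm; set s := lc _ _ _ in hs.
  have sE := mul_lim_sine hs.
  rewrite (_ : h - f = s)//; apply: L2_ext.
  have h1 := ae_and fE hE.
  have h2 := ae_and (L2_subE h f) sE.
  have h3 := ae_and h1 uE.
  apply: ae_moS2 h2 h3 => x _ [-> ->] [[/= -> ->] ->].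
  by ring.
- move=> [h0 /= [coh0 hs0]]; pose h : H := h0; have coh : forall n, co n h = (eigval n)%:C * co n u := coh0.
  have hs : hcvg (fun n => \sum_(i < n) co i u *: b i) (h - f) := hs0.
  have sE := mul_lim_sine hs.
  (* A representative of a class is arbitrary off the segment; extension by zero makes it integrable
     on the line, as [tower] requires. *)
  have patch (f0 : R -> R) : sqint mo f0 -> [/\ lam.-integrable setT (EFin \o f0 \_ D),
      lam.-integrable D (EFin \o (fun x => (f0 \_ D) x ^+ 2)) & sqint mo (f0 \_ D)].
    move=> sf; have [mf if2] := sf.
    have if2D : lam.-integrable D (EFin \o (fun x => f0 x ^+ 2)).
      by apply/integrable_mo => //; apply/measurable_EFinP; exact: measurable_funX.
    have one : sqint mo (cst 1) by apply: (@sqint_bounded _ _ _ 1) => // x _ /=; rewrite normr1.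
    have if1 : lam.-integrable D (EFin \o f0).
      apply/integrable_mo; first exact/measurable_EFinP.
      have := sqint_mul sf one; congr (_.-integrable _ _).
      by apply/funext => x /=; rewrite mulr1.
    split.
    - have -> : EFin \o f0 \_ D = (EFin \o f0) \_ D by rewrite restrict_EFin.
      exact: (integrable_mkcond _ mD).1 if1.
    - by apply: eq_integrable if2D => // x xD; rewrite /= patchE xD.
    - by apply: sqint_patch => //; exact: measurable_funTS.
  have [jr jr2 sr] := patch _ (sqint_Re h); have [ji ji2 si] := patch _ (sqint_Im h).
  (* Solves [(-1)^k y^(2k) = h] with Dirichlet conditions, separately for the real and imaginary
     parts. *)
  have [a aT] := tower_ex omega0 k0 jr jr2; have [c cT] := tower_ex omega0 k0 ji ji2.
  have [sy bc dE] := tower_sobolev omega0 k0 aT cT (sqintZ ((-1) ^+ k) sr) (sqintZ ((-1) ^+ k) si).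
  set y := (fun x => (a 0 x +i* c 0 x)%C) in sy bc dE.
  have hE : {ae mo, forall x : R, h x = (-1) ^+ k * derivn_within `[0, omega] (2 * k) y x}.
    apply: ae_moS dE => x xw ->.
    have xD : (x \in D) by rewrite inE /= in_itv.
    rewrite !patchE xD /Re_ /Im_.
    have s2 : (-1) ^+ k * (-1) ^+ k = 1 :> C by rewrite -exprMn mulrNN mulr1 expr1n.
    have -> : ((-1) ^+ k * complex.Re (h x) +i* ((-1) ^+ k * complex.Im (h x)))%C = (-1) ^+ k * h x.
      have -> : (-1) ^+ k = (((-1) ^+ k : R)%:C) :> C by rewrite rmorphXn rmorphN1.
      by case: (h x) => p r; congr (_ +i* _)%C; rewrite /= !(mul0r, subr0, addr0).
    by rewrite mulrA s2 mul1r.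
  have csq g e : tower omega k e g -> sqint mo (e 0 \_ D).
    move=> eT; apply: sqint_patch; first exact: tower_meas eT.
    apply: continuous_compact_integrable; first exact: segment_compact.
    apply/subspace_continuousP => x xw; have := tower_cont eT => /subspace_continuousP/(_ x xw) ce.
    have -> : (fun x => e 0 x ^+ 2) = (fun x => e 0 x * e 0 x) by apply/funext => z; rewrite expr2.
    exact: cvgM.
  pose Y : measurableTypeR R -> C := fun x => ((a 0 \_ D) x +i* (c 0 \_ D) x)%C.
  have vE : {ae mo, forall x : R, cls mo Y x = y x}.
    have := @clsE _ _ R mo Y (@sqint_cls _ _ R mo Y (csq _ _ aT) (csq _ _ cT)).
    apply: ae_moS => x xw ->; have xD : (x \in D) by rewrite inE /= in_itv.
    by rewrite /Y !patchE xD.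
  (* The eigenvalues are nonzero, so the coefficients of [h] determine those of [u], and the
     solution just built has the same ones. *)
  have uv : u = cls mo Y.
    apply: (co_inj B) => n.
    have hE' : {ae mo, forall x : R, h x = (-1) ^+ k * ((-1) ^+ k * (Re_ h \_ D) x +i* ((-1) ^+ k * (Im_ h \_ D) x))%C}.
      by apply: ae_moS2 hE dE => x _ -> ->.
    have := coef_rel n aT cT vE hE'; rewrite coh => /mulfI; apply.
    by rewrite eq_complex /= negb_and gt_eqF ?eigval_gt0.
  have uE : {ae mo, forall x : R, u x = y x} by rewrite uv.
  exists y; split => //=.
  have h2 := ae_and (L2_subE h f) sE.
  have h3 := ae_and hE uE.
  apply: ae_moS2 h2 h3 => x _ [-> e] [<- <-].
  by rewrite -e; ring.
Qed.

End dirichlet_sine_basis.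

Theorem corollary5 (R : realType) (k : nat) (omega : R) (q : L2itv omega) :
  (1 < k)%N -> 0 < omega -> spectral_operator (L_dir k q).
Proof.
move=> k1 omega0; rewrite (L_dir_pert omega0 k1).
(* [Num.sqrt (2 / omega)] bounds every [phi n], hence the columns [q phi n]; the summand 1 keeps the
   bound at least 1 even for small [q]. *)
apply: (@pert_op_spectral _ _ _ _ (sine_onb omega0) _ _ (1 + Num.sqrt (2 / omega) * nr q) (theta omega ^+ (2 * k))).
- move=> n; apply: (@le_trans _ _ (Num.sqrt (2 / omega) * nr q)); last by rewrite lerDr.
  by apply: nr_mul_basis; [exact: phi_meas|exact: sqrtr_ge0|exact: phi_le].
- by rewrite lerDl mulr_ge0 ?sqrtr_ge0 ?nr_ge0.
- by rewrite exprn_gt0// theta_gt0.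
- exact: eigval_ge.
- exact: eigval_gap.
Qed.
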